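(* Let $q$ be a power of a prime $p$, let $0\le j\le q-2$ and $n\ge1$ be integers, and put $k=2j+2+(n-1)(q-1)$ and $m\equiv j+1\pmod{q-1}$. Let $M,D,A,F,T$ be the $n\times n$ matrices over $\mathbb{C}_\infty$ defined in the context. If $n\le4$, then all of the following hold: 1. $\mathrm{Ker}(MA)\cap\mathrm{Ker}(F+MD)=\mathrm{Ker}(MA)\cap F(\mathrm{Ker}(I+MA))=0$; 2. if $q$ is odd, $MD$ is diagonalizable; if $q$ is even, $MD$ is diagonalizable if and only if $\dim_{\mathbb{C}_\infty}S^{1,new}_{k,m}(\Gamma_0(t))\le1$; 3. $S^1_{k,m}(\Gamma_0(t))=S^{1,old}_{k,m}(\Gamma_0(t))\oplus S^{1,new}_{k,m}(\Gamma_0(t))=(\mathrm{Ker}(MA)\oplus\mathrm{Ker}(MD))\oplus(\mathrm{Ker}(T)\cap F\,\mathrm{Ker}(T))$, where $S^1_{k,m}(\Gamma_0(t))$ is identified with $\mathbb{C}_\infty^n$ via the basis described in the context.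
   Context: Modular forms. $K=\mathbb{F}_q(t)$, $K_\infty$ is its completion at $\infty=1/t$, $\mathbb{C}_\infty$ is the completion of an algebraic closure of $K_\infty$, and $\Omega=\mathbb{P}^1(\mathbb{C}_\infty)-\mathbb{P}^1(K_\infty)$ is the Drinfeld upper half plane. For $\gamma=\begin{pmatrix}a&b\\c&d\end{pmatrix}\in GL_2(K_\infty)$ and $\varphi:\Omega\to\mathbb{C}_\infty$ put $(\varphi|_{k,m}\gamma)(z)=\varphi(\gamma z)(\det\gamma)^m(cz+d)^{-k}$. For $\Gamma=GL_2(\mathbb{F}_q[t])$ or $\Gamma=\Gamma_0(t)=\{\begin{pmatrix}a&b\\c&d\end{pmatrix}\in GL_2(\mathbb{F}_q[t]): c\equiv0 \bmod t\}$, $S^1_{k,m}(\Gamma)$ is the (finite dimensional) $\mathbb{C}_\infty$-space of cusp forms of weight $k$ and type $m$: rigid analytic $\varphi:\Omega\to\mathbb{C}_\infty$ with $\varphi|_{k,m}\gamma=\varphi$ for all $\gamma\in\Gamma$, holomorphic and vanishing at all cusps. It depends on $m$ only modulo $q-1$. The Atkin operator on $S^1_{k,m}(\Gamma_0(t))$ is $\mathbf{U}_t(\varphi)(z)=\sum_{b\in\mathbb{F}_q}\varphi\left(\frac{z+b}{t}\right)$; the Hecke operator on $S^1_{k,m}(GL_2(\mathbb{F}_q[t]))$ is $\mathbf{T}_t(\varphi)(z)=t^k\varphi(tz)+\sum_{b\in\mathbb{F}_q}\varphi\left(\frac{z+b}{t}\right)$ (item 1 is the matrix form of $\mathrm{Ker}(\mathbf{T}_t)=0$).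 Oldforms: let $\delta_1,\delta_t:S^1_{k,m}(GL_2(\mathbb{F}_q[t]))\to S^1_{k,m}(\Gamma_0(t))$ be $\delta_1(\varphi)=\varphi$, $\delta_t(\varphi)(z)=t^m\varphi(tz)$, and $\delta(\varphi,\psi)=\delta_1\varphi+\delta_t\psi$; then $S^{1,old}_{k,m}(\Gamma_0(t))=\mathrm{Im}(\delta)$. Newforms: let $\varphi^{Fr}=\varphi|_{k,m}\begin{pmatrix}0&-1\\t&0\end{pmatrix}$ (Fricke involution), $Tr(\varphi)=\sum_{\gamma\in R}\varphi|_{k,m}\gamma$ with $R=\{\mathrm{Id}\}\cup\{\begin{pmatrix}0&-1\\1&b\end{pmatrix}:b\in\mathbb{F}_q\}$, and $Tr'(\varphi)=Tr(\varphi^{Fr})$; then $S^{1,new}_{k,m}(\Gamma_0(t))=\mathrm{Ker}(Tr)\cap\mathrm{Ker}(Tr')$. Basis. Let $\Gamma_1(t)\subset\Gamma_0(t)$ be the subgroup with diagonal entries $\equiv1 \bmod t$. Teitelbaum's residue isomorphism identifies $S^1_{k,m}(\Gamma_1(t))$ with the harmonic cocycles of weight $k$ for $\Gamma_1(t)$: functions $\mathbf{c}$ from oriented edges of the Bruhat-Tits tree of $GL_2(K_\infty)$ (edges $=GL_2(K_\infty)/Z(K_\infty)\mathcal{I}(K_\infty)$, with $\mathcal{I}$ the Iwahori subgroup) to the dual of $V=\bigoplus_{i=0}^{k-2}\mathbb{C}_\infty X^iY^{k-2-i}$ which are harmonic, antisymmetric under edge reversal, and $\Gamma_1(t)$-equivariant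 for the action $(\gamma\omega)(X^iY^{k-2-i})=\det(\gamma)^{1-m}\omega((aX+bY)^i(cX+dY)^{k-2-i})$. Such a cocycle is determined by its value on the edge $\bar e$ represented by $\begin{pmatrix}0&1\\1&0\end{pmatrix}$, and a basis is $\mathbf{c}_0,\dots,\mathbf{c}_{k-2}$ where $\mathbf{c}_i(\bar e)(X^lY^{k-2-l})=1$ if $l=i$ and $0$ otherwise. For $k,j,n,m$ as in the claim, $S^1_{k,m}(\Gamma_0(t))$ has basis $\mathbf{c}_{j+(b-1)(q-1)}$, $1\le b\le n$. Matrices (size $n\times n$). $M=(m_{a,b})$ has entries in $\mathbb{F}_p$: $$m_{a,b}=-\left[\binom{j+(n-a)(q-1)}{j+(n-b)(q-1)}+(-1)^{j+1}\binom{j+(n-a)(q-1)}{j+(b-1)(q-1)}\right]\ (a\ne b),\qquad m_{a,a}=(-1)^j\binom{j+(n-a)(q-1)}{j+(a-1)(q-1)},$$ with $\binom{x}{y}=0$ if $y>x$. With $s_i=j+1+(i-1)(q-1)$: $D=\mathrm{diag}(t^{s_1},\dots,t^{s_n})$; $F$ is the antidiagonal matrix whose entry in row $n+1-b$, column $b$ is $(-t)^{s_b}$; $A$ is the antidiagonal matrix with all antidiagonal entries $(-1)^{j+1}$; $I$ is the identity; $T=I+MA$. In the basis $\mathbf{c}_{j+(b-1)(q-1)}$, $1\le b\le n$, of $S^1_{k,m}(\Gamma_0(t))$ (column convention), $\mathbf{U}_t$ has matrix $MD$, the Fricke involution has matrix $t^{m-k}F$, $Tr$ has matrix $T$, and $Tr'$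 has matrix $t^{m-k}(F+MD)$; moreover $\mathrm{Im}(\delta_1)=\mathrm{Ker}(MA)$, $\mathrm{Im}(\delta_t)=\mathrm{Ker}(MD)$ and newforms are $\mathrm{Ker}(T)\cap F(\mathrm{Ker}(T))$. *)

(* Defs.v *)
From HB Require Import structures.
From mathcomp Require Import all_boot all_order all_algebra.
From mathcomp Require Import reals.
Set Implicit Arguments.
Unset Strict Implicit.
Unset Printing Implicit Defensive.
Import Order.TTheory GRing.Theory Num.Theory.
Local Open Scope ring_scope.

Section Preliminaries.
Variables (R : realType) (Fq : finFieldType) (L : closedFieldType).
Variables (v : L -> R) (emb : {rmorphism Fq -> L}) (t : L).

Definition lim_for (u : nat -> L) (l : L) : Prop :=
  forall eps : R, 0 < eps ->
    exists N : nat, forall i, (N <= i)%N -> v (u i - l) < eps.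

Definition cauchy_for (u : nat -> L) : Prop :=
  forall eps : R, 0 < eps ->
    exists N : nat, forall i i', (N <= i)%N -> (N <= i')%N -> v (u i - u i') < eps.

Definition evalA_for (a : {poly Fq}) : L := (map_poly emb a).[t].

Definition ratK_for (x : L) : Prop :=
  exists a b : {poly Fq}, b != 0 /\ x = evalA_for a / evalA_for b.

Definition Koo_for (x : L) : Prop :=
  forall eps : R, 0 < eps -> exists2 y, ratK_for y & v (x - y) < eps.

Definition algebraic_for (y : L) : Prop :=
  exists P : {poly L}, [/\ P != 0, forall i, Koo_for P`_i & root P y].

End Preliminaries.

(* A model of C_oo, which is thereby determined up to isometric isomorphism:
   since |t| > 1, t is transcendental over F_q and |.| induces on F_q(t) the
   place oo; as C_oo is complete, the closure of F_q(t) is its completion K_oo;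
   as C_oo is algebraically closed, the elements algebraic over K_oo form an
   algebraic closure of K_oo; this one is dense in the complete field C_oo.
   The last field of the record is normalised by |t| = q. *)
Record Cinfty (R : realType) (Fq : finFieldType) := MkCinfty {
  Cfield :> closedFieldType;
  absC : Cfield -> R;
  embC : {rmorphism Fq -> Cfield};
  tC : Cfield;
  absC_ge0 : forall x, 0 <= absC x;
  absC_eq0 : forall x, (absC x == 0) = (x == 0);
  absCM : forall x y, absC (x * y) = absC x * absC y;
  absC_ultra : forall x y, absC (x + y) <= Num.max (absC x) (absC y);
  absC_complete : forall u : nat -> Cfield,
    cauchy_for absC u -> exists l, lim_for absC u l;
  absC_dense : forall (x : Cfield) (eps : R), 0 < eps ->
    exists2 y, algebraic_for absC embC tC y & absC (x - y) < eps;
  absC_t : absC tC = #|Fq|%:R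
}.

Arguments absC {R Fq c}.
Arguments embC {R Fq c}.

Section DrinfeldForms.
Variables (R : realType) (Fq : finFieldType) (C : Cinfty R Fq).

Local Notation q := #|Fq|.
Local Notation t := (tC C).

Definition cvgC (u : nat -> C) (l : C) : Prop := lim_for absC u l.

Definition evalA (a : {poly Fq}) : C := evalA_for embC t a.
Definition ratK (x : C) : Prop := ratK_for embC t x.
Definition Koo (x : C) : Prop := Koo_for absC embC t x.

Definition mx2 (K : Type) (a b c d : K) : 'M[K]_2 :=
  \matrix_(i, i') if i == ord0 then (if i' == ord0 then a else b)
                  else (if i' == ord0 then c else d).

Definition GL2K (g : 'M[C]_2) : Prop :=
  (forall i i', ratK (g i i')) /\ g \in unitmx.
Definition GL2Koo (g : 'M[C]_2) : Prop :=
  (forall i i', Koo (g i i')) /\ g \in unitmx.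

(* F_q[t] is {poly Fq}, with t = 'X. *)

Definition GL2A : pred 'M[{poly Fq}]_2 := fun g => g \in unitmx.
Definition Gamma0 : pred 'M[{poly Fq}]_2 :=
  fun g => (g \in unitmx) && ('X %| g 1 0).
Definition Gamma1 : pred 'M[{poly Fq}]_2 :=
  fun g => [&& Gamma0 g, 'X %| g 0 0 - 1 & 'X %| g 1 1 - 1].

Definition mxA (g : 'M[{poly Fq}]_2) : 'M[C]_2 := map_mx evalA g.

(* As oo lies in P^1(K_oo), Omega is the complement of K_oo in C_oo.
   A function on Omega is encoded as a function on C_oo that vanishes off
   Omega; all the operators below preserve this condition (for g in GL_2(K_oo)
   and z in K_oo, [mobius g z] is in K_oo, even when c z + d = 0). *)
Definition Omega (z : C) : Prop := ~ Koo z.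
Definition on_Omega (phi : C -> C) : Prop := forall z, ~ Omega z -> phi z = 0.

Definition autj (g : 'M[C]_2) (z : C) : C := g 1 0 * z + g 1 1.
Definition mobius (g : 'M[C]_2) (z : C) : C := (g 0 0 * z + g 0 1) / autj g z.

Definition slash (k : nat) (m : int) (phi : C -> C) (g : 'M[C]_2) : C -> C :=
  fun z => phi (mobius g z) * (\det g) ^ m * (autj g z) ^- k.

(* [far r z] says that the distance of z to K_oo is at least r. *)
Definition far (r : R) (z : C) : Prop := forall x, Koo x -> r <= absC (z - x).

(* The affinoids Omega_i form the standard admissible covering of Omega. *)
Definition Omega_aff (i : nat) (z : C) : Prop :=
  absC z <= q%:R ^+ i /\ far (q%:R ^- i) z.

Definition rigid_analytic (phi : C -> C) : Prop :=
  forall (i : nat) (eps : R), 0 < eps ->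
    exists P Q : {poly C}, forall z, Omega_aff i z ->
      Q.[z] != 0 /\ absC (phi z - P.[z] / Q.[z]) < eps.

(* The exponential of the lattice f F_q[t]:
   e(z) = z \prod_(a != 0) (1 - z / (f a)), the product being taken over the
   nonzero a in F_q[t] of degree < d, then d --> oo. *)
Definition expo_trunc (f : {poly Fq}) (d : nat) (z : C) : C :=
  z * \prod_(a : {ffun 'I_d -> Fq} | a != [ffun=> 0])
        (1 - z / evalA (f * \sum_(i < d) (a i) *: 'X^i)).
Definition is_expo (f : {poly Fq}) (z e : C) : Prop :=
  cvgC (fun d => expo_trunc f d z) e.

(* Near oo, psi is a convergent power series without constant term in the
   parameter 1 / e, where e is the exponential of f F_q[t]. *)
Definition vanishing_expansion (f : {poly Fq}) (psi : C -> C) : Prop :=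
  exists (r : R) (a : nat -> C), forall z, Omega z -> far r z ->
    exists e, [/\ is_expo f z e, e != 0
      & cvgC (fun N => \sum_(i < N) a i * e ^- i.+1) (psi z)].

(* Every cusp is g(oo) for some g in GL_2(K).  If phi is modular for a
   congruence subgroup, phi |_{k,m} g is periodic under f F_q[t] for f
   sufficiently divisible, and being holomorphic and vanishing at oo does not
   depend on the parameter 1 / e among those f. *)
Definition vanishing_at_cusps (k : nat) (m : int) (phi : C -> C) : Prop :=
  forall g, GL2K g -> exists2 f0 : {poly Fq}, f0 != 0 &
    forall f, f != 0 -> f0 %| f -> vanishing_expansion f (slash k m phi g).

(* S^1_{k,m}(G) *)
Definition cusp_form (G : pred 'M[{poly Fq}]_2) (k : nat) (m : int)
    (phi : C -> C) : Prop :=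
  [/\ on_Omega phi, rigid_analytic phi,
      forall g, G g -> slash k m phi (mxA g) =1 phi
    & vanishing_at_cusps k m phi].

Definition delta1 (phi : C -> C) : C -> C := phi.
Definition deltat (m : int) (phi : C -> C) : C -> C :=
  fun z => t ^ m * phi (t * z).

Definition oldform (k : nat) (m : int) (chi : C -> C) : Prop :=
  exists phi psi, [/\ cusp_form GL2A k m phi, cusp_form GL2A k m psi
    & chi =1 (fun z => delta1 phi z + deltat m psi z)].

Definition fricke (k : nat) (m : int) (phi : C -> C) : C -> C :=
  slash k m phi (mx2 0 (-1) t 0).

Definition trace (k : nat) (m : int) (phi : C -> C) : C -> C :=
  fun z => slash k m phi 1%:M z
           + \sum_(b : Fq) slash k m phi (mx2 0 (-1) 1 (embC b)) z.

Definition trace' (k : nat) (m : int) (phi : C -> C) : C -> C :=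
  trace k m (fricke k m phi).

Definition newform (k : nat) (m : int) (phi : C -> C) : Prop :=
  [/\ cusp_form Gamma0 k m phi, trace k m phi =1 (fun=> 0)
    & trace' k m phi =1 (fun=> 0)].

Definition lincomb (d : nat) (e : 'I_d -> C -> C) (x : 'cV[C]_d) : C -> C :=
  fun z => \sum_i x i 0 * e i z.

Definition is_basis (U : (C -> C) -> Prop) (d : nat) (e : 'I_d -> C -> C) : Prop :=
  (forall phi, U phi <-> exists x, phi =1 lincomb e x)
  /\ (forall x, lincomb e x =1 (fun=> 0) -> x = 0).

Definition has_dim (U : (C -> C) -> Prop) (d : nat) : Prop :=
  exists e : 'I_d -> C -> C, is_basis U e.

(* U = U1 (+) U2, for subspaces U, U1, U2 *)
Definition is_direct_sum (U U1 U2 : (C -> C) -> Prop) : Prop :=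
  (forall phi, U phi <->
     exists phi1 phi2, [/\ U1 phi1, U2 phi2 & phi =1 (fun z => phi1 z + phi2 z)])
  /\ (forall phi, U1 phi -> U2 phi -> phi =1 (fun=> 0)).

(* The dual of V = (+)_(i <= k-2) C X^i Y^(k-2-i) is encoded as 'rV_(k-1):
   the entry w 0 i is w (X^i Y^(k-2-i)).  Setting Y = 1, the coefficient of
   X^l Y^(k-2-l) in (aX+bY)^i (cX+dY)^(k-2-i) is the coefficient of 'X^l in the
   polynomial below. *)
Definition dual_act (k : nat) (m : int) (g : 'M[C]_2) (w : 'rV[C]_k.-1) :
    'rV[C]_k.-1 :=
  \row_i ((\det g) ^ (1 - m) *
    \sum_(l < k.-1)
      ((g 0 0 *: 'X + (g 0 1)%:P) ^+ i
       * (g 1 0 *: 'X + (g 1 1)%:P) ^+ (k - 2 - i))`_l * w 0 l).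

Definition iwahori (h : 'M[C]_2) : Prop :=
  [/\ forall i i', Koo (h i i') /\ absC (h i i') <= 1, absC (\det h) = 1
    & absC (h 1 0) < 1].

(* A function on edges is a function c on GL_2(K_oo), right invariant under the
   scalars and the Iwahori subgroup (values of c off GL_2(K_oo) are irrelevant).
   The reverse of the edge g is g (0,1;1/t,0), and the edges with the same
   origin as g are g r, for r = 1 or r = (x,1;1,0) with x in F_q. *)
Definition harmonic_cocycle (G : pred 'M[{poly Fq}]_2) (k : nat) (m : int)
    (c : 'M[C]_2 -> 'rV[C]_k.-1) : Prop :=
  [/\ forall g x h, GL2Koo g -> Koo x -> x != 0 -> iwahori h ->
        c (g *m (x *: h)) = c g,
      forall g, GL2Koo g -> c (g *m mx2 0 1 t^-1 0) = - c g,
      forall g, GL2Koo g ->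
        c g + \sum_(x : Fq) c (g *m mx2 (embC x) 1 1 0) = 0
    & forall s g, G s -> GL2Koo g ->
        c (mxA s *m g) = dual_act m (mxA s) (c g)].

Definition ebar : 'M[C]_2 := mx2 0 1 1 0.

(* f z = \sum_(i >= 0) a_i z^i + \sum_(i >= 0) b_i z^(-i-1) on the annulus
   1 < |z| < q, which corresponds to the edge represented by 1; thus b_0 is the
   residue of f dz. *)
Definition laurent (f : C -> C) (a b : nat -> C) : Prop :=
  forall z, 1 < absC z -> absC z < q%:R ->
    exists s1 s2, [/\ cvgC (fun N => \sum_(i < N) a i * z ^+ i) s1,
      cvgC (fun N => \sum_(i < N) b i * z ^- i.+1) s2 & f z = s1 + s2].

Definition is_residue (f : C -> C) (r : C) : Prop :=
  exists a b, laurent f a b /\ r = b 0%N.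

(* c(g)(X^l Y^(k-2-l)) is the residue of z^l phi(z) dz along the edge g,
   computed on the standard annulus after the substitution z := g(w). *)
Definition residue_cocycle (k : nat) (phi : C -> C) (c : 'M[C]_2 -> 'rV[C]_k.-1) :
    Prop :=
  forall g (l : 'I_k.-1), GL2Koo g ->
    is_residue (fun w => mobius g w ^+ l * phi (mobius g w)
                         * (\det g * autj g w ^- 2)) (c g 0 l).

(* Teitelbaum's theorem for Gamma_1(t): phi |-> (residue cocycle of phi) is a
   bijection from S^1_{k,m}(Gamma_1(t)) onto the harmonic cocycles. *)
Definition residue_isomorphism (k : nat) (m : int) : Prop :=
  (forall phi, cusp_form Gamma1 k m phi ->
     exists2 c, harmonic_cocycle Gamma1 m c & residue_cocycle (k := k) phi c)
  /\ (forall c, harmonic_cocycle (k := k) Gamma1 m c ->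
     exists2 phi, cusp_form Gamma1 k m phi /\ residue_cocycle phi c &
       forall psi, cusp_form Gamma1 k m psi -> residue_cocycle psi c -> psi =1 phi).

(* Evaluation at ebar is a bijection from the harmonic cocycles onto the dual
   of V. *)
Definition ebar_isomorphism (k : nat) (m : int) : Prop :=
  (forall w, exists2 c, harmonic_cocycle (k := k) Gamma1 m c & c ebar = w)
  /\ (forall c c', harmonic_cocycle (k := k) Gamma1 m c ->
     harmonic_cocycle Gamma1 m c' -> c ebar = c' ebar ->
     forall g, GL2Koo g -> c g = c' g).

(* phi is the cusp form for Gamma_1(t) with residue cocycle c_i. *)
Definition standard_form (k : nat) (m : int) (i : nat) (phi : C -> C) : Prop :=
  cusp_form Gamma1 k m phi /\
  exists c, [/\ harmonic_cocycle (k := k) Gamma1 m c, residue_cocycle phi c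
    & c ebar = \row_l (l == i :> nat)%:R].

(* Rows and columns are numbered from 0, so that a and b below are one less than
   the usual row and column numbers. *)

Section Matrices.
Variables j n : nat.

Definition Mmx : 'M[C]_n := \matrix_(a, b)
  let top := (j + (n - a.+1) * (q - 1))%N in
  if a == b then (-1) ^+ j * 'C(top, j + a * (q - 1))%:R
  else - ('C(top, j + (n - b.+1) * (q - 1))%:R
          + (-1) ^+ j.+1 * 'C(top, j + b * (q - 1))%:R).

Definition expo_s (b : nat) : nat := (j + 1 + b * (q - 1))%N.

Definition Dmx : 'M[C]_n := diag_mx (\row_b t ^+ expo_s b).
Definition Fmx : 'M[C]_n :=
  \matrix_(a, b) if a == rev_ord b then (- t) ^+ expo_s b else 0.
Definition Amx : 'M[C]_n :=
  \matrix_(a, b) if a == rev_ord b then (-1) ^+ j.+1 else 0.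
Definition Tmx : 'M[C]_n := 1%:M + Mmx *m Amx.

End Matrices.

(* Matrices act on column vectors. *)
Definition mxlin (n : nat) (B : 'M[C]_n) : 'End('cV[C]_n) :=
  linfun (mulmx B : 'cV[C]_n -> 'cV[C]_n).
Definition Ker (n : nat) (B : 'M[C]_n) : {vspace 'cV[C]_n} := lker (mxlin B).

(* The subspace U of functions corresponds to the subspace W of C^n, via the
   coordinates on the basis e. *)
Definition identified (n : nat) (e : 'I_n -> C -> C) (U : (C -> C) -> Prop)
    (W : {vspace 'cV[C]_n}) : Prop :=
  forall phi, U phi <-> exists2 x, x \in W & phi =1 lincomb e x.

End DrinfeldForms.

(* Main.v *)
(** Residues along the edge ebar determine a cusp form for Gamma_1(t), and phi |_{k,m} h
    has the cocycle g |-> h^-1 c(h g).  Hence the Fricke involution and the trace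
    become linear maps on the values at ebar.  The coset representatives of the
    trace can be chosen so that q - 1 of them fix ebar up to the Iwahori subgroup,
    and harmonicity at the origin of ebar gives the contribution of the last one;
    the resulting matrices are t^(m-k) F and T.  A form for Gamma_0(t) has level
    one iff the trace fixes it, and delta_t is the Fricke involution on forms of
    level one, so that old and new forms are given by kernels.

    For n <= 4, Lucas' theorem gives T = 0 if j >= n - 1, and T = - a h with a
    column a, a row h and h a = -1 if j < n - 1.  Since F^2 = kappa = (-t)^k, all
    claims depend on g = h F a only: item 1 amounts to g <> 0, and item 3 to
    g^2 <> kappa, because the pairings of h and h F with a and F a form a matrix
    of determinant kappa - g^2; both follow from the computation of |g|.  Finally
    M D = (T - I) F is - F on the new space and has the eigenvalues 0 and - g on
    <a, F a>.  It is thus diagonalizable unless the characteristic is 2, where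
    kappa has a single square root mu, and F is not mu on the new space. *)

Require Import Defs.
From HB Require Import structures.
From mathcomp Require Import all_boot all_order finfield cyclic separable cyclotomic all_algebra.
From mathcomp Require Import boolp reals.
From mathcomp Require Import ring lra zify.
Set Implicit Arguments.
Unset Strict Implicit.
Unset Printing Implicit Defensive.
Import Order.TTheory GRing.Theory Num.Theory.
Local Open Scope ring_scope.

(** * Projections of rank one *)

(** The trace is the identity on forms of level one, as the index q + 1 of [Gamma0] equals 1 in C;
    so T is a projection, whose rank is the dimension of the level one space. For small n the rank
    is at most 1 because of digits: in base q, j + e (q - 1) is e q + (j - e) if e <= j, while q has
    to be borrowed if j < e <= q + j. Lucas kills the binomial coefficient of two distinct such
    numbers unless the upper one alone borrows, and the survivors factor by trinomial revision. The
    range e <= q + j contains all indices that occur for n <= 4, except if q = 2, j = 0, n = 4.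

    On the analytic side a residue is only a relation: some Laurent expansion exists. Matrices can
    be read off only once the zero function is known to have no residue but 0; averaging over roots
    of unity shows it.

    In characteristic 2, if n = 4 and T has rank one, the new space is a plane, and it is the
    antidiagonal shape of F that prevents F from being scalar there. *)

Section RankOne.
Variables (L : fieldType) (n : nat) (T F : 'M[L]_n) (a : 'cV[L]_n) (h : 'rV[L]_n).
Variables (g kappa : L).
Hypothesis TE : T = - (a *m h).
Hypothesis ha : h *m a = (-1)%:M.
Hypothesis hFa : h *m F *m a = g%:M.
Hypothesis FF : F *m F = kappa%:M.

Let TTE : T *m T = T.
Proof.
rewrite TE mulNmx mulmxN opprK mulmxA -(mulmxA a) ha.
by rewrite mul_mx_scalar -scalemxAl scaleN1r.
Qed.

Let TFTE : T *m F *m T = - g *: T.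
Proof.
rewrite TE mulNmx mulmxN mulNmx opprK -!mulmxA (mulmxA F) (mulmxA h) (mulmxA h) hFa.
by rewrite mul_scalar_mx -scalemxAr scalerN scaleNr opprK.
Qed.

(** [B] stands for M D, and [Q] is B (B + g) after the products T F T have been removed by
    [TFTE]. *)
Let B := (T - 1%:M) *m F.
Let Q := kappa *: (1%:M - T) - F *m T *m F - g *: F.

Lemma rank_one_quadratic : B *m (B + g%:M) = Q.
Proof.
rewrite mulmxDr mul_mx_scalar /B /Q !mulmxBl !mulmxBr !mul1mx.
have -> : T *m F *m (T *m F) = - g *: (T *m F).
  by rewrite mulmxA TFTE -scalemxAl.
rewrite -[T *m F *m F]mulmxA FF mul_mx_scalar mulmxA.
rewrite !(scalerBr, scaleNr) -scalemx1.
by apply/matrixP => i i'; rewrite !mxE; ring.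
Qed.

(** With the next lemma: the image of [Q] lies in the kernels of T and T F, that is, in the new
    space. *)
Lemma rank_one_T_quadratic : T *m Q = 0.
Proof.
rewrite /Q !mulmxBr -scalemxAr mulmxBr mulmx1 TTE subrr scaler0 sub0r.
rewrite mulmxA mulmxA TFTE -!scalemxAl -!scalemxAr scaleNr opprK.
by rewrite subrr.
Qed.

Lemma rank_one_TF_quadratic : T *m F *m Q = 0.
Proof.
rewrite /Q !mulmxBr -scalemxAr mulmxBr mulmx1 TFTE -scalemxAr.
rewrite !mulmxA -[T *m F *m F]mulmxA FF mul_mx_scalar -!scalemxAl TTE.
by apply/matrixP => i i'; rewrite !mxE; ring.
Qed.

(** The image of B (B + g) lies in the new space, where B acts as - F and B^2 as kappa. The roots of
    this polynomial are 0, - g and the square roots of kappa. *)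
Lemma rank_one_quartic : (B *m B - kappa%:M) *m (B *m (B + g%:M)) = 0.
Proof.
have -> : B *m B - kappa%:M = - g *: (T *m F) - kappa *: T - F *m (T *m F).
  have := rank_one_quadratic; rewrite mulmxDr mul_mx_scalar => /(canRL (addrK _)) ->.
  rewrite /Q /B mulmxBl mul1mx scalerBr scalerBr -scalemx1 mulmxA.
  by apply/matrixP => i i'; rewrite !mxE; ring.
rewrite rank_one_quadratic !mulmxBl -!scalemxAl rank_one_TF_quadratic.
rewrite rank_one_T_quadratic -(mulmxA F) rank_one_TF_quadratic.
by rewrite !scaler0 mulmx0 !subr0.
Qed.

(* (F - mu) Q is mu (mu + g) (F - mu) up to a matrix with image in <a, F a>. *)
Lemma rank_one_scalar (mu : L) : kappa = mu ^+ 2 -> (F - mu%:M) *m Q = 0 ->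
  exists u v : 'rV[L]_n, (mu * (mu + g)) *: (F - mu%:M) = a *m u + F *m a *m v.
Proof.
move=> kE; rewrite /Q => E.
exists (- (kappa *: (h *m F)) + (mu * kappa) *: h), (- (kappa *: h) + mu *: (h *m F)).
have FTF : F *m T *m F = - (F *m a *m h *m F).
  by rewrite TE mulmxN mulNmx !mulmxA.
move: E; rewrite FTF mulmxBl mul_scalar_mx.
rewrite !(mulmxBr, mulmxDr, mulmxN) -!scalemxAr !mulmxA FF mul_scalar_mx.
rewrite mulmxBr mulmx1 TE mulmxN !mulmxA -!scalemxAl => E.
move: (F *m a *m h *m F) (a *m h *m F) E => X Z; move: (F *m a *m h) (a *m h) => Y V E.
apply/matrixP => i i'; move/matrixP: E => /(_ i i').
rewrite kE -(scalemx1 _ mu) -(scalemx1 _ (mu ^+ 2)) !mxE => E.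
by apply/eqP; rewrite -subr_eq0 -E; apply/eqP; ring.
Qed.

End RankOne.

(** * Binomial coefficients modulo p and the matrix T *)

(* Simplification changes the shape of the coercions hidden in [#|Fq|], which
   [lia] would take for distinct atoms. *)
Ltac card_lia := simpl in *; lia.

Section Lucas.
Variables (L : comNzRingType) (p r : nat).
Hypothesis charL : p \in [pchar L].
Local Notation q := (p ^ r)%N.

Lemma coef_expX1D n i : ((1 + 'X : {poly L}) ^+ n)`_i = 'C(n, i)%:R.
Proof.
rewrite exprDn coef_sum.
under eq_bigr => l _ do rewrite expr1n mul1r coefMn coefXn.
case: (ltnP i n.+1) => [lin|lni].
  rewrite (bigD1 (Ordinal lin)) //= eqxx big1 ?addr0 // => l /negPf.
  by rewrite -val_eqE /= eq_sym => ->; rewrite mul0rn.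
rewrite bin_small // big1 // => l _; have := ltn_ord l.
by case: eqP => [<-|]; rewrite ?mul0rn // ltnNge lni.
Qed.

(** In characteristic p, (1 + X)^(u + q) = (1 + X)^u (1 + X^q). *)
Lemma bin_addq u v :
  'C(u + q, v)%:R = 'C(u, v)%:R + (if (q <= v)%N then 'C(u, v - q)%:R else 0) :> L.
Proof.
have qch : [pchar {poly L}].-nat q.
  have /(pcharf_eq) pE : p \in [pchar {poly L}] by rewrite pchar_poly.
  by rewrite (eq_pnat _ pE) pnatX pnat_id ?(pcharf_prime charL).
rewrite -!coef_expX1D exprD (exprDn_pchar 1 _ qch) expr1n mulrDr mulr1 coefD coefMXn.
by rewrite ltnNge; case: leqP.
Qed.

(** Only the last digit in base q is split off; x and z may be arbitrarily large. By [bin_addq],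
    both sides obey Pascal's rule in x and z. *)
Lemma lucas x y z w : (y < q)%N -> (w < q)%N ->
  'C(x * q + y, z * q + w)%:R = ('C(x, z) * 'C(y, w))%:R :> L.
Proof.
move=> ltyq ltwq; elim: x z => [|x IH] [|z].
- by rewrite !mul0n !add0n bin0 mul1n.
- rewrite mul0n add0n bin_small ?bin0n //.
  by rewrite (leq_trans ltyq) // mulSn -addnA leq_addr.
- rewrite mulSn [(q + _)%N]addnC addnAC bin_addq (IH 0%N).
  by rewrite mul0n add0n leqNgt ltwq /= addr0 !bin0.
- rewrite mulSn [(q + _)%N]addnC addnAC bin_addq IH.
  have -> : (q <= z.+1 * q + w)%N by rewrite mulSn -addnA leq_addr.
  have -> : (z.+1 * q + w - q = z * q + w)%N by rewrite mulSn -addnA addKn.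
  by rewrite IH binS mulnDl natrD.
Qed.

End Lucas.

(** * The absolute value of C_oo *)

Section Abs.
Variables (R : realType) (Fq : finFieldType) (C : Cinfty R Fq).
Local Notation q := #|Fq|.
Local Notation t := (tC C).
Implicit Types x y z : C.

Lemma card_gt1 : (1 < q)%N. Proof. exact: finNzRing_gt1. Qed.

Lemma expf_card_pred (x : Fq) : x != 0 -> x ^+ (q - 1) = 1.
Proof.
move=> x0; apply: (mulfI x0); rewrite -exprS subn1 prednK ?expf_card ?mulr1 //.
by rewrite (leq_trans _ card_gt1).
Qed.

Lemma absC0 : absC (0 : C) = 0.
Proof. by apply/eqP; rewrite absC_eq0. Qed.

Lemma absC_gt0 x : (0 < absC x) = (x != 0).
Proof. by rewrite lt_def absC_eq0 absC_ge0 andbT. Qed.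

Lemma absC1 : absC (1 : C) = 1.
Proof.
have n0 : absC (1 : C) != 0 by rewrite absC_eq0 oner_eq0.
by apply: (mulfI n0); rewrite -absCM !mulr1.
Qed.

Lemma absCX x n : absC (x ^+ n) = absC x ^+ n.
Proof. by elim: n => [|n IH]; rewrite ?expr0 ?absC1 // !exprS absCM IH. Qed.

Lemma absC_root1 x n : (0 < n)%N -> x ^+ n = 1 -> absC x = 1.
Proof.
move=> n0 xn; apply/eqP; rewrite -(@pexpr_eq1 _ _ n) ?absC_ge0 //.
by rewrite -absCX xn absC1.
Qed.

Lemma absCN x : absC (- x) = absC x.
Proof. by rewrite -mulN1r absCM (@absC_root1 (-1) 2) ?mul1r // sqrrN expr1n. Qed.

Lemma absCV x : absC x^-1 = (absC x)^-1.
Proof.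
have [->|x0] := eqVneq x 0; first by rewrite invr0 absC0 invr0.
have n0 : absC x != 0 by rewrite absC_eq0.
by apply: (mulfI n0); rewrite -absCM !divff // absC1.
Qed.

Lemma absC_emb (a : Fq) : a != 0 -> absC (embC a : C) = 1.
Proof.
move=> a0; apply: (@absC_root1 _ (q - 1)); first by rewrite subn_gt0 card_gt1.
by rewrite -rmorphXn expf_card_pred // rmorph1.
Qed.

Lemma absC_emb_le1 (a : Fq) : absC (embC a : C) <= 1.
Proof.
have [->|a0] := eqVneq a 0; first by rewrite rmorph0 absC0 ler01.
by rewrite absC_emb.
Qed.

(** Integers come from the finite field, whose nonzero elements are roots of unity. *)
Lemma absC_natr n : absC (n%:R : C) <= 1.
Proof. by rewrite -(rmorph_nat embC n) absC_emb_le1. Qed.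

Lemma absCD_le x y (e : R) : absC x <= e -> absC y <= e -> absC (x + y) <= e.
Proof. by move=> xe ye; rewrite (le_trans (absC_ultra x y)) // ge_max xe. Qed.

Lemma absCD_lt x y (e : R) : absC x < e -> absC y < e -> absC (x + y) < e.
Proof. by move=> xe ye; rewrite (le_lt_trans (absC_ultra x y)) // gt_max xe. Qed.

Lemma absCB_lt x y (e : R) : absC x < e -> absC y < e -> absC (x - y) < e.
Proof. by move=> xe ye; rewrite absCD_lt ?absCN. Qed.

(** Otherwise x = (x + y) - y would be a difference of two elements smaller than x. *)
Lemma absCD_dom x y : absC y < absC x -> absC (x + y) = absC x.
Proof.
move=> yx; apply/eqP; rewrite eq_le (absCD_le (lexx _) (ltW yx)) /=.
rewrite leNgt; apply/negP => lt.
by have := absCB_lt lt yx; rewrite addrK ltxx.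
Qed.

Lemma absC_sum_lt (I : Type) (s : seq I) (P : pred I) (u : I -> C) (e : R) :
  0 < e -> (forall i, P i -> absC (u i) < e) ->
  absC (\sum_(i <- s | P i) u i) < e.
Proof.
move=> e0 ue; elim/big_ind: _ => //; first by rewrite absC0.
by move=> x y; apply: absCD_lt.
Qed.

Lemma natq_gt1 : 1 < q%:R :> R. Proof. by rewrite ltr1n card_gt1. Qed.

Lemma natq_gt0 : 0 < q%:R :> R. Proof. exact: lt_trans natq_gt1. Qed.

Lemma tC_neq0 : t != 0.
Proof. by rewrite -absC_gt0 absC_t natq_gt0. Qed.

End Abs.

(** * Identities between M, D, A, F and T for all n *)

Section MatrixIdentities.
Variables (R : realType) (Fq : finFieldType) (C : Cinfty R Fq) (j n : nat).
Local Notation q := #|Fq|.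
Local Notation t := (tC C).

(** Fermat in F_q treats both parities at once: for even q the exponent may be odd, but then - 1 =
    1. *)
Lemma sign_card_pred b : (-1) ^+ (b * (q - 1)) = 1 :> C.
Proof.
rewrite mulnC exprM -(rmorphN1 embC) -rmorphXn expf_card_pred ?oppr_eq0 ?oner_eq0 //.
by rewrite rmorph1 expr1n.
Qed.

Lemma Fmx_mul m (X : 'M[C]_(n, m)) a b :
  (Fmx C j n *m X) a b = (- t) ^+ expo_s Fq j (n - a.+1) * X (rev_ord a) b.
Proof.
rewrite mxE (bigD1 (rev_ord a)) //= !mxE rev_ordK eqxx big1 ?addr0 // => i /negPf ia.
by rewrite mxE -(inj_eq rev_ord_inj) rev_ordK eq_sym ia mul0r.
Qed.

Lemma Fmx_sqr : Fmx C j n *m Fmx C j n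
  = ((- t) ^+ (2 * j + 2 + (n - 1) * (q - 1)))%:M.
Proof.
apply/matrixP => a b; rewrite Fmx_mul !mxE (inj_eq rev_ord_inj).
case: eqVneq => [->|]; rewrite ?mulr0 // -exprD mulr1n /expo_s.
congr (_ ^+ _); have := ltn_ord b; rewrite /=; move: (b : nat) => c cn.
have -> : (n - 1 = n - c.+1 + c)%N by lia.
by rewrite mulnDl; lia.
Qed.

(** This is A F = D: the exponents of - 1 add up to 2 (j + 1) + b (q - 1). *)
Lemma Mmx_Dmx : Mmx C j n *m Dmx C j n = (Tmx C j n - 1%:M) *m Fmx C j n.
Proof.
rewrite /Tmx addrC addKr -mulmxA; congr (_ *m _).
apply/matrixP => a b; rewrite [RHS]mxE (bigD1 (rev_ord a)) //= !mxE rev_ordK eqxx.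
rewrite big1 ?addr0; last first.
  by move=> i /negPf ia; rewrite mxE -(inj_eq rev_ord_inj) rev_ordK eq_sym ia mul0r.
rewrite (inj_eq rev_ord_inj); case: eqVneq => [->|]; rewrite ?mulr0 ?mulr1n ?mulr0n //.
rewrite (exprNn t) mulrA -exprD.
have -> : (j.+1 + expo_s Fq j b = 2 * j.+1 + b * (q - 1))%N by rewrite /expo_s; lia.
by rewrite exprD exprM sqrrN !expr1n sign_card_pred !mul1r.
Qed.

(** The entries of 1 - P, for the unipotent lower triangular matrix P of binomial coefficients by
    which translations act on the coefficients with exponents j + c (q - 1). *)
Definition nil_coef (c d : nat) : C :=
  if c == d then 0 else - 'C(j + c * (q - 1), j + d * (q - 1))%:R.

(** A diagonal entry of M lacks one of the two binomial coefficients, which would be 1 there. The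
    zero diagonal of [nil_coef] absorbs both this exception and the identity matrix in T. *)
Lemma Tmx_entry (a b : 'I_n) :
  Tmx C j n a b = nil_coef (n - a.+1) (n - b.+1)
                  + (-1) ^+ j.+1 * nil_coef (n - a.+1) b.
Proof.
have nil0 c : nil_coef c c = 0 by rewrite /nil_coef eqxx.
have sgn2 : (-1) ^+ j * (-1) ^+ j = 1 :> C.
  by rewrite -expr2 -exprM mulnC exprM sqrrN !expr1n.
have rb : (n - (rev_ord b).+1)%N = b by have := ltn_ord b; rewrite /=; lia.
rewrite !mxE (bigD1 (rev_ord b)) //= !mxE eqxx big1 ?addr0; last first.
  by move=> i /negPf ib; rewrite !mxE ib mulr0.
have [->|ab] := eqVneq a (rev_ord b).
  rewrite rb nil0 mulr0 addr0 exprS mulN1r mulrN mulrAC sgn2 mul1r /nil_coef -val_eqE /=.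
  rewrite [(n - b.+1)%N == b]eq_sym.
  by case: eqVneq => [<-|_]; rewrite ?binn ?subrr ?sub0r.
have rab : (n - a.+1 == b)%N = false.
  apply/negP => /eqP E; case/eqP: ab; apply/val_inj; rewrite /= -E.
  by have := ltn_ord a; lia.
have -> : nil_coef (n - a.+1) (n - b.+1) = (a == b)%:R
    - 'C(j + (n - a.+1) * (q - 1), j + (n - b.+1) * (q - 1))%:R.
  rewrite /nil_coef; have [->|ab'] := eqVneq a b; first by rewrite eqxx binn subrr.
  rewrite sub0r ifN //; apply: contraNneq ab' => E; apply/eqP/val_inj => /=.
  by have := ltn_ord a; have := ltn_ord b; lia.
rewrite /nil_coef rab rb /= exprS.
move: sgn2; set s := (-1) ^+ j => sgn2.
ring: sgn2.
Qed.

End MatrixIdentities.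

(** * The shape of T and the size of g for n <= 4 *)

Section SmallMatrix.
Variables (R : realType) (Fq : finFieldType) (C : Cinfty R Fq) (p r : nat).
Local Notation q := #|Fq|.
Local Notation t := (tC C).
Hypotheses (p_prime : prime p) (card_Fq : q = (p ^ r)%N).

Lemma pcharC : p \in [pchar C].
Proof. by rewrite (fmorph_pchar embC) (card_finPcharP card_Fq). Qed.

Lemma natf_card : q%:R = 0 :> C.
Proof.
have r_gt0 : (0 < r)%N by case: (r) card_Fq (card_gt1 Fq) => // ->.
by rewrite card_Fq natrX pcharf0 ?pcharC // expr0n eqn0Ngt r_gt0.
Qed.

Lemma natf_card_pred : (q - 1)%:R = -1 :> C.
Proof. by rewrite natrB ?natf_card ?sub0r // ltnW // card_gt1. Qed.

Section Entries.
Variables (j n : nat).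
Hypotheses (j_le : (j <= q - 2)%N).

Definition col_coef (c : nat) : C := if (j < c)%N then 'C(c.-1, j)%:R else 0.
Definition row_coef (d : nat) : C := if (d <= j)%N then (-1) ^+ (j - d) * 'C(j, d)%:R else 0.

(** Pascal's rule, applied to C(q, l) = 0 for 0 < l < q. *)
Lemma bin_pred_card i : (i <= 2)%N -> (i < q)%N -> 'C(q - 1, i)%:R = (-1) ^+ i :> C.
Proof.
have binS' l : (0 < l < q)%N -> 'C(q - 1, l)%:R = - 'C(q - 1, l.-1)%:R :> C.
  case: l => // l /andP[_ lq]; have := @bin_addq C p r pcharC 0 l.+1.
  rewrite -card_Fq add0n [in LHS](_ : q = (q - 1).+1); last first.
    by rewrite subn1 prednK // (leq_trans _ lq).
  rewrite binS natrD bin0n leqNgt lq /= addr0 => /eqP.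
  by rewrite addr_eq0 => /eqP.
case: i => [|[|[|//]]] _ iq; rewrite ?bin0 // binS' ?iq //= ?bin0 ?expr1 //.
by rewrite binS' ?bin0 ?opprK ?sqrrN ?expr1n // (ltn_trans _ iq).
Qed.

(** For d < c, Lucas leaves only the case d <= j < c, with the value C(c-1, d) C(q+j-c, j-d). Modulo
    p the second factor is (-1)^(j-d) C(c-1-d, j-d), and trinomial revision turns the product into
    C(c-1, j) (-1)^(j-d) C(j, d). As c <= 3, this last step is a check of cases. *)
Lemma nil_coef_small c d : (c <= 3)%N -> (c <= q + j)%N -> (d <= q + j)%N ->
  nil_coef C j c d = - (col_coef c * row_coef d).
Proof.
have luc x y z w : (y < q)%N -> (w < q)%N ->
    'C(x * q + y, z * q + w)%:R = ('C(x, z) * 'C(y, w))%:R :> C.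
  by rewrite card_Fq; move=> *; apply: (lucas pcharC).
have q_gt1 := card_gt1 Fq.
have expand e : (e <= j)%N -> (j + e * (q - 1) = e * q + (j - e))%N.
  by move=> ej; rewrite mulnBr muln1; have := leq_pmulr e (ltnW q_gt1); lia.
(* The last digit j - e would be negative, so q is borrowed. *)
have expand' e : (j < e <= q + j)%N ->
    (j + e * (q - 1) = e.-1 * q + (q + j - e))%N.
  case: e => // e /andP[je eq]; rewrite mulnBr muln1 mulSn /=.
  by have := leq_pmulr e (ltnW q_gt1); card_lia.
move=> c3 cq dq; rewrite /nil_coef /col_coef /row_coef.
case: (ltngtP d c) => [dc|cd|->]; last first.
- by case: leqP; rewrite ?mul0r ?mulr0 oppr0.
- rewrite bin_small; last by rewrite ltn_add2l ltn_mul2r subn_gt0 q_gt1.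
  by case: ifP; rewrite ?mul0r //; case: ifP; rewrite ?mulr0 //; lia.
(* If both numbers borrow or neither does, the last digit of the lower one exceeds that of the upper
   one, and the binomial coefficient is 0. *)
case: (ltnP j c) => [jc|cj]; last first.
  rewrite expand // expand ?(leq_trans (ltnW dc)) // luc; try lia.
  by rewrite (@bin_small (j - c)) ?muln0 ?mul0r ?oppr0 //; lia.
rewrite (expand' c) ?jc //; case: (leqP d j) => [dj|jd]; last first.
  rewrite expand' ?jd // luc; try lia.
  by rewrite (@bin_small (q + j - c)) ?muln0 ?mulr0 ?oppr0 //; lia.
rewrite expand // luc; try lia.
congr (- _); rewrite natrM.
have C0 x : 'C(x, 0)%:R = 1 :> C by rewrite bin0.
have E1 : (q + 1 - 2 = q - 1)%N by lia.
have E2 : (q + 2 - 3 = q - 1)%N by lia.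
have b1 : (1 < q)%N -> 'C(q - 1, 1)%:R = -1 :> C by apply: bin_pred_card.
have b2 : (2 < q)%N -> 'C(q - 1, 2)%:R = 1 :> C.
  by move=> q2; rewrite bin_pred_card // sqrrN expr1n.
have b3 : (2 < q)%N -> 'C(q + 1 - 3, 1)%:R = -2 :> C.
  by move=> q2; rewrite bin1 natrB ?natrD ?natf_card; [ring | lia].
have q2 : (0 < j)%N -> (2 < q)%N by lia.
case: c c3 dc jc cq => [|[|[|[|//]]]] _ dc jc cq //;
  case: (j) q2 jc dj cq => [|[|[|//]]] //= q2 _ dj cq;
  case: d dc dq dj => [|[|[|//]]] // _ dq _; rewrite /= ?subnn ?subn0 ?C0 ?E1 ?E2.
all: rewrite ?b1 ?b2 ?b3 ?bin1 ?binn ?q2 //; ring.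
Qed.

Definition Tcol : 'cV[C]_n := \col_a col_coef (n - a.+1).
Definition Trow : 'rV[C]_n :=
  \row_b (row_coef (n - b.+1) + (-1) ^+ j.+1 * row_coef b).

Hypothesis n_le4 : (n <= 4)%N.

Lemma Tmx_eq0 : (n <= j.+1)%N -> Tmx C j n = 0.
Proof.
move=> nj; apply/matrixP => a b; have := ltn_ord a; have := ltn_ord b => bn an.
rewrite Tmx_entry !nil_coef_small; try lia.
by rewrite /col_coef !ifN ?mul0r ?oppr0 ?mulr0 ?addr0 ?mxE //; lia.
Qed.

Lemma Tmx_rank1 : Tmx C j n = - (Tcol *m Trow).
Proof.
apply/matrixP => a b; rewrite Tmx_entry !mxE big_ord1 !mxE.
have := ltn_ord a; have := ltn_ord b => bn an.
case: (leqP n.-1 (q + j)) => [nqj|qjn].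
  by rewrite !nil_coef_small; try lia; ring.
have q_gt1 := card_gt1 Fq.
(* Only here does an index, namely 3, exceed q + j. C(3, 1) and C(3, 2) are odd, against
   [nil_coef_small], but they cancel in the entries of T. *)
have [q2 j0 n4] : [/\ q = 2, j = 0 & n = 4]%N by split; lia.
have c32 : 'C(3, 2) = 3%N by [].
have two : 2 = 0 :> C by rewrite -natf_card q2.
rewrite /nil_coef /col_coef /row_coef q2 j0.
case: a b an bn {qjn} => [a an] [b bn] /= _ _; subst n; move: an bn.
case: a => [|[|[|[|//]]]] _; case: b => [|[|[|[|//]]]] _;
  rewrite /= ?mulr0 ?mul0r ?addr0 ?add0r; 
  rewrite ?subSS ?subn0 ?subnn ?muln1 ?add0n ?mul0n ?bin0 ?bin1 ?binn ?c32 ?bin_small //;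
  rewrite ?expr0 ?mulr0n ?two.
all: ring.
Qed.

(** [row_coef] and [col_coef] have disjoint supports, so only the reversed half of [Trow] counts. Up
    to the sign it yields the j-th difference of the polynomial C(x, j), which is 1; for n <= 4 the
    sums are written out. *)
Lemma Trow_Tcol : (j < n.-1)%N -> Trow *m Tcol = (-1)%:M.
Proof.
move=> jn; apply/matrixP => a b; rewrite !ord1 !mxE.
under eq_bigr => i _ do rewrite !mxE.
move: n_le4 jn; rewrite /row_coef /col_coef.
case: (n) => [|[|[|[|[|//]]]]] // _; case: (j) => [|[|[|//]]] // _;
  rewrite !big_ord_recl big_ord0 /= ?bin0 ?binn ?bin1 /=; ring.
Qed.

Lemma Trow_Fmx_Tcol :
  Trow *m Fmx C j n *m Tcol
  = (\sum_(b < n) (row_coef (n - b.+1) + (-1) ^+ j.+1 * row_coef b)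
       * ((- t) ^+ expo_s Fq j (n - b.+1) * col_coef b))%:M.
Proof.
apply/matrixP => a b; rewrite !ord1 -mulmxA !mxE mulr1n.
apply: eq_bigr => i _; rewrite Fmx_mul !mxE /=; congr (_ * (_ * col_coef _)).
by have := ltn_ord i; lia.
Qed.

(** As the supports are disjoint, g is the sum of (-1)^(j-d) C(j, d) C(n-2-d, j) (-t)^(j+1+d(q-1))
    over d <= min(j, n-2-j). For n <= 4 the largest d has coefficient 1 or -1 and an exponent e with
    2 e < k; so |g| = q^e, while |kappa| = q^k. *)
Lemma Trow_Fmx_Tcol_small : (j < n.-1)%N ->
  exists g : C, [/\ Trow *m Fmx C j n *m Tcol = g%:M, g != 0
    & g ^+ 2 != (- t) ^+ (2 * j + 2 + (n - 1) * (q - 1))].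
Proof.
move=> jn; rewrite Trow_Fmx_Tcol; set g := \sum_(b < n) _.
have q_gt1 := card_gt1 Fq.
suff [e [ge ek]] : exists e, absC g = q%:R ^+ e /\ (e + e < 2 * j + 2 + (n - 1) * (q - 1))%N.
  have abs0 : absC g != 0 by rewrite ge expf_neq0 // pnatr_eq0 -lt0n ltnW.
  exists g; split => //; first by rewrite -absC_eq0.
  apply: contraTneq ek => /(congr1 absC); rewrite !absCX ge absCN absC_t -exprM.
  move=> /(ieexprIn (natq_gt0 R Fq) (negbT (gt_eqF (natq_gt1 R Fq)))) E.
  by rewrite -leqNgt; lia.
have absT e : absC ((- t) ^+ e) = q%:R ^+ e by rewrite absCX absCN absC_t.
have absS i : absC ((-1) ^+ i : C) = 1 by rewrite absCX absCN absC1 expr1n.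
move: (n_le4) jn; rewrite /g /row_coef /col_coef /expo_s.
case: (n) => [|[|[|[|[|//]]]]] // _; case: (j) j_le => [|[|[|//]]] // j_le' _;
  rewrite !big_ord_recl big_ord0 /= ?bin0 ?binn ?bin1 /=.
all: rewrite /bump /= !add1n ?subSS ?subn0 ?subnn ?mul0n ?addn0 ?mulr0 ?mulr1 ?addr0 ?add0r ?mul0r.
all: rewrite ?addr0 ?add0r ?expr0 ?mul1r.
(* Except for n = 4, j = 1, the sum has the single term d = 0, and e = j + 1. *)
all: try by exists 1%N; rewrite absT; split=> //; card_lia.
all: try by exists 2%N; rewrite absCM absS mul1r absT; split=> //; card_lia.
all: try by exists 3%N; rewrite absCM absS mul1r absT; split=> //; card_lia.
(* For n = 4, j = 1 one has g = (-t)^(q+1) - 2 t^2, and the first term dominates whatever 2 is in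
   C. *)
exists q.+1; split; last by card_lia.
have -> : (2 + 1 * (q - 1) = q.+1)%N by card_lia.
transitivity (absC ((- t) ^+ q.+1)); last exact: absT.
apply: absCD_dom; rewrite mulrCA absCM !absT.
apply: (@le_lt_trans _ _ (q%:R ^+ 2)); last by rewrite ltr_eXn2l ?natq_gt1 //; card_lia.
by rewrite ler_piMr ?exprn_ge0 // absCM absS mul1r absC_natr.
Qed.

End Entries.
End SmallMatrix.

(** * Kernels and diagonalizability *)

Section KernelDecomposition.
Variables (R : realType) (Fq : finFieldType) (C : Cinfty R Fq).
Variables (n : nat) (T F MA MD : 'M[C]_n) (kappa : C).
Hypotheses (MAE : 1%:M + MA = T) (MDE : MD = (T - 1%:M) *m F).
Hypotheses (FF : F *m F = kappa%:M) (kappa0 : kappa != 0).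
Hypothesis T_small : T = 0 \/ exists (a : 'cV[C]_n) (h : 'rV[C]_n) g,
  [/\ T = - (a *m h), h *m a = (-1)%:M, h *m F *m a = g%:M, g != 0
    & g ^+ 2 != kappa].

Lemma mem_Ker m (B : 'M[C]_m) x : (x \in Ker B) = (B *m x == 0).
Proof. by rewrite memv_ker lfunE. Qed.

Let MAE' : MA = T - 1%:M. Proof. by rewrite -MAE addrC addKr. Qed.

Let FFx (x : 'cV[C]_n) : F *m (F *m x) = kappa *: x.
Proof. by rewrite mulmxA FF mul_scalar_mx. Qed.

(** F is invertible with inverse kappa^-1 F. *)
Lemma mem_imF (B : 'M[C]_n) x :
  (x \in (mxlin F @: Ker B)%VS) = (B *m (F *m x) == 0).
Proof.
apply/memv_imgP/eqP => [[y yB ->]|BFx].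
  move: yB; rewrite mem_Ker lfunE /= FFx -scalemxAr => /eqP ->.
  by rewrite scaler0.
exists (kappa^-1 *: (F *m x)); first by rewrite mem_Ker -scalemxAr BFx scaler0.
by rewrite lfunE /= -scalemxAr FFx scalerA mulVf // scale1r.
Qed.

Lemma mem_KerMA x : (x \in Ker MA) = (T *m x == x).
Proof. by rewrite mem_Ker MAE' mulmxBl mul1mx subr_eq0. Qed.

Lemma mem_KerMD x : (x \in Ker MD) = (T *m (F *m x) == F *m x).
Proof. by rewrite mem_Ker MDE -mulmxA mulmxBl mul1mx subr_eq0. Qed.

(** The Fricke involution exchanges the two copies of the level one forms. *)
Lemma F_KerMD x : (F *m x \in Ker MD) = (x \in Ker MA).
Proof.
rewrite mem_KerMD mem_KerMA FFx -scalemxAr.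
by apply/eqP/eqP => [/(scalerI kappa0)|->].
Qed.

Let W := (Ker T :&: (mxlin F @: Ker T))%VS.

Lemma mem_newspace x : (x \in W) = (T *m x == 0) && (T *m (F *m x) == 0).
Proof. by rewrite memv_cap mem_Ker mem_imF. Qed.

(** F + M D = T F gives the first equality. For the second, a fixed vector x of T is - (h x) a, and
    then T F x = 0 means g (h x) = 0. *)
Lemma old_vs_F_ker :
  (Ker MA :&: Ker (F + MD) = Ker MA :&: (mxlin F @: Ker (1%:M + MA)))%VS
  /\ (Ker MA :&: (mxlin F @: Ker (1%:M + MA)))%VS = 0%VS.
Proof.
have E : Ker (F + MD) = (mxlin F @: Ker T)%VS.
  by apply/vspaceP => x; rewrite mem_Ker mem_imF MDE mulmxBl mul1mx addrC subrK mulmxA.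
rewrite MAE E; split=> //; apply/eqP; rewrite -subv0; apply/subvP => x.
rewrite memv_cap mem_KerMA mem_imF memv0 => /andP[/eqP Tx].
case: T_small => [T0|[a [h [g [TE ha hFa g0 _]]]]].
  by rewrite -Tx T0 !mul0mx eqxx.
have {}Tx : x = - (a *m (h *m x)) by rewrite -{1}Tx TE mulNmx mulmxA.
rewrite TE mulNmx oppr_eq0; move: Tx; move: (h *m x) => y Tx /eqP E0.
have : h *m (a *m h *m (F *m x)) = 0 by rewrite E0 mulmx0.
rewrite -mulmxA mulmxA ha mul_scalar_mx scaleN1r Tx !mulmxN opprK !mulmxA hFa.
rewrite mul_scalar_mx => /eqP; rewrite scaler_eq0 (negPf g0) /= => /eqP ->.
by rewrite mulmx0 oppr0.
Qed.

(** In the rank one case Ker M A and Ker M D are the lines of a and F a, and the new space is the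
    common kernel of h and h F. The pairing matrix is (-1, g; g, - kappa). *)
Lemma old_new_direct :
  directv (Ker MA + Ker MD + W) /\ (Ker MA + Ker MD + W)%VS = fullv.
Proof.
case: T_small => [T0|[a [h [g [TE ha hFa g0 gk]]]]].
  have MA0 : Ker MA = 0%VS.
    apply/eqP; rewrite -subv0; apply/subvP => x; rewrite mem_KerMA memv0 T0 mul0mx.
    by rewrite eq_sym.
  have MD0 : Ker MD = 0%VS.
    apply/eqP; rewrite -subv0; apply/subvP => x; rewrite mem_KerMD memv0 T0 mul0mx.
    move/eqP => /esym Fx; rewrite -(inj_eq (scalerI kappa0)) -FFx Fx mulmx0 scaler0.
    by rewrite eqxx.
  have WT : W = fullv.
    by apply/vspaceP => x; rewrite mem_newspace T0 !mul0mx eqxx memvf.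
  by rewrite MA0 MD0 WT directvE /= !add0v dimv0 !add0n !eqxx.
have hFFa : h *m F *m F *m a = (- kappa)%:M.
  by rewrite -(mulmxA h) FF mul_mx_scalar -scalemxAl ha -scalemx1 scalerA mulrN1 scalemx1.
have det0 : g ^+ 2 - kappa != 0 by rewrite subr_eq0.
have KA x : (x \in Ker MA) -> exists c, x = c *: a.
  rewrite mem_KerMA TE mulNmx -mulmxA => /eqP <-; move: (h *m x) => y; exists (- y 0 0).
  by rewrite {1}[y]mx11_scalar mul_mx_scalar scaleNr.
have aA : a \in Ker MA.
  by rewrite mem_KerMA TE mulNmx -mulmxA ha mul_mx_scalar scaleN1r opprK.
have FaD : F *m a \in Ker MD by rewrite F_KerMD.
have KD x : (x \in Ker MD) -> exists c, x = c *: (F *m a).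
  move=> xD; have /KA[c Fx] : F *m x \in Ker MA.
    by rewrite -F_KerMD FFx memvZ.
  exists (kappa^-1 * c); rewrite -scalerA scalemxAr -Fx FFx scalerA mulVf //.
  by rewrite scale1r.
have WE x : (x \in W) -> h *m x = 0 /\ h *m F *m x = 0.
  have inj y : a *m (h *m y) = 0 :> 'cV_n -> h *m y = 0.
    move=> E; have : h *m (a *m (h *m y)) = 0 by rewrite E mulmx0.
    by rewrite mulmxA ha mul_scalar_mx scaleN1r => /eqP; rewrite oppr_eq0 => /eqP.
  rewrite mem_newspace TE !mulNmx !oppr_eq0 -!mulmxA => /andP[/eqP/inj hx /eqP/inj hFx].
  by split.
have WI x : h *m x = 0 -> h *m F *m x = 0 -> x \in W.
  move=> hx hFx; rewrite mem_newspace TE !mulNmx -!mulmxA hx (mulmxA h) hFx.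
  by rewrite mulmx0 oppr0 eqxx.
have solve c d : c *: a + d *: (F *m a) \in W -> c = 0 /\ d = 0.
  move/WE; rewrite !mulmxDr -!scalemxAr !mulmxA ha hFa hFFa.
  case=> /matrixP/(_ 0 0) + /matrixP/(_ 0 0); rewrite !mxE !mulr1n => e1 e2.
  have d0 : d = 0.
    apply: (mulIf det0); rewrite mul0r -[RHS](addr0 0) -{1}e2 -(mulr0 g) -e1.
    by ring.
  by split=> //; move: e1; rewrite d0 mul0r addr0 mulrN1 => /eqP; rewrite oppr_eq0 => /eqP.
split.
  rewrite !directv_addE /= !directvE /= !eqxx /=; apply/andP; split.
    rewrite -subv0; apply/subvP => x; rewrite memv_cap memv0 => /andP[/KA[c xc] /KD[d xd]].
    have /solve[c0 _] : c *: a + (- d) *: (F *m a) \in W.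
      by rewrite -xc scaleNr -xd subrr mem0v.
    by rewrite xc c0 scale0r.
  rewrite -subv0; apply/subvP => x; rewrite memv_cap memv0 => /andP[/memv_addP[y /KA[c ->]]].
  by move=> [z /KD[d ->] ->] /solve[-> ->]; rewrite !scale0r addr0.
apply/vspaceP => x; rewrite memvf.
pose u := (h *m x) 0 0; pose v := (h *m F *m x) 0 0.
(* Cramer's rule for - c + g d = u and g c - kappa d = v, which say that h and h F kill x - c a - d
   F a. *)
pose d := (v + g * u) / (g ^+ 2 - kappa); pose c := g * d - u.
rewrite -(subrK (c *: a + d *: (F *m a)) x) addrC.
apply: memv_add; first by apply: memv_add; rewrite memvZ.
have uE : h *m x = u%:M by apply: mx11_scalar.
have vE : h *m F *m x = v%:M by apply: mx11_scalar.
have dE : d * (g ^+ 2 - kappa) = v + g * u by rewrite divfK.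
apply: WI; rewrite mulmxBr !mulmxDr -!scalemxAr !mulmxA ?ha hFa ?hFFa ?uE ?vE;
  apply/matrixP => i i'; rewrite !ord1 !mxE !mulr1n.
  by rewrite /c; ring.
transitivity (v - (d * (g ^+ 2 - kappa) - g * u)); first by rewrite /c; ring.
by rewrite dE; ring.
Qed.

End KernelDecomposition.

Section Diagonalization.
Variables (L : fieldType) (n : nat).
Implicit Types A : 'M[L]_n.

Lemma diagonalizable_annul A (rs : seq L) : (0 < n)%N -> uniq rs ->
  foldr (fun r X => (A - r%:M) *m X) 1%:M rs = 0 -> diagonalizable A.
Proof.
case: n A => // n' A _ urs annul; apply/diagonalizableP; exists rs => //.
apply: mxminpoly_min; rewrite -annul {annul urs}; elim: rs => [|r rs IH] /=.
  by rewrite big_nil rmorph1.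
by rewrite big_cons rmorphM rmorphB /= horner_mx_X horner_mx_C IH.
Qed.

Lemma diagonalizable_sqr A (l : L) m (X : 'M[L]_(n, m)) : diagonalizable A ->
  (A - l%:M) *m ((A - l%:M) *m X) = 0 -> (A - l%:M) *m X = 0.
Proof.
case=> P Pu /(similar_diagLR Pu)[D ->].
rewrite conjumx ?unitmx_inv // invmxK.
have -> : invmx P *m diag_mx D *m P - l%:M = invmx P *m (diag_mx D - l%:M) *m P.
  by rewrite mulmxBr mulmxBl mul_mx_scalar -scalemxAl mulVmx // scalemx1.
rewrite -diag_const_mx -raddfB /=; set d := D - _ => E.
have {E} : diag_mx d *m (diag_mx d *m (P *m X)) = 0.
  rewrite -[LHS](mulKVmx Pu) -[RHS](mulmx0 _ P) -E; congr (_ *m _).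
  by rewrite !mulmxA (mulmxK Pu).
rewrite -!mulmxA; move: (P *m X) => Y E; suff -> : diag_mx d *m Y = 0 by rewrite mulmx0.
apply/matrixP => i i'; move/matrixP: E => /(_ i i').
rewrite !mul_diag_mx !mxE => /eqP; rewrite mulf_eq0 => /orP[/eqP->|/eqP//].
by rewrite mul0r.
Qed.

Lemma mulmx_cV_eq0 A : (forall x : 'cV_n, A *m x = 0) -> A = 0.
Proof.
move=> A0; apply/matrixP => i i'; move/matrixP: (A0 (delta_mx i' 0)) => /(_ i 0).
by rewrite -colE !mxE.
Qed.

End Diagonalization.

Section KernelDiagonalization.
Variables (R : realType) (Fq : finFieldType) (C : Cinfty R Fq).
Variables (n : nat) (T F MD : 'M[C]_n) (kappa : C).
Hypotheses (n_gt0 : (0 < n)%N) (MDE : MD = (T - 1%:M) *m F).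
Hypotheses (FF : F *m F = kappa%:M) (kappa0 : kappa != 0).
Hypothesis T_small : T = 0 \/ exists (a : 'cV[C]_n) (h : 'rV[C]_n) g,
  [/\ T = - (a *m h), h *m a = (-1)%:M, h *m F *m a = g%:M, g != 0
    & g ^+ 2 != kappa].

Let FFx (x : 'cV[C]_n) : F *m (F *m x) = kappa *: x.
Proof. by rewrite mulmxA FF mul_scalar_mx. Qed.

Let sqrt_kappa : exists mu, kappa = mu ^+ 2.
Proof.
have /closed_rootP[mu] : size ('X^2 - kappa%:P : {poly C}) != 1%N by rewrite size_XnsubC.
by rewrite rootE !hornerE subr_eq0 => /eqP <-; exists mu.
Qed.

(** The roots of [rank_one_quartic] are simple: mu and - mu differ, and neither is - g because g^2
    is not kappa. *)
Lemma diagonalizable_odd : 2 != 0 :> C -> diagonalizable MD.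
Proof.
move=> two0; have [mu kE] := sqrt_kappa.
have mu0 : mu != 0 by move: kappa0; rewrite kE sqrf_eq0.
have muN : mu != - mu by rewrite -addr_eq0 -mulr2n -mulr_natr mulf_neq0.
have quad (B : 'M[C]_n) : (B - mu%:M) *m (B - (- mu)%:M) = B *m B - kappa%:M.
  rewrite raddfN opprK mulmxBl mulmxDr mul_mx_scalar mul_scalar_mx scalerDr scale_scalar_mx.
  by rewrite -expr2 -kE addrKA.
case: T_small => [T0|[a [h [g [TE ha hFa g0 gk]]]]].
  apply: (@diagonalizable_annul _ _ _ [:: mu; - mu]) => //=.
    by rewrite inE muN.
  by rewrite mulmx1 quad MDE T0 sub0r mulNmx mul1mx mulNmx mulmxN opprK FF subrr.
have gmu : g != mu by apply: contraNneq gk => ->; rewrite kE.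
have gNmu : g != - mu by apply: contraNneq gk => ->; rewrite kE sqrrN.
apply: (@diagonalizable_annul _ _ _ [:: mu; - mu; 0; - g]) => //=.
  have muNg : mu != - g by apply: contraNneq gNmu => ->; rewrite opprK.
  by rewrite !inE !negb_or muN muNg mu0 eqr_opp oppr_eq0 mu0 eq_sym gmu eq_sym oppr_eq0 g0.
rewrite mulmx1 mulmxA quad raddf0 subr0 raddfN opprK MDE.
exact: rank_one_quartic TE ha hFa FF.
Qed.

Let W := (Ker T :&: (mxlin F @: Ker T))%VS.
Hypothesis two0 : 2 = 0 :> C.

Let opp2 (x : C) : - x = x.
Proof. by apply/eqP; rewrite eq_sym -addr_eq0 -mulr2n -mulr_natr two0 mulr0. Qed.

Let oppM m n' (X : 'M[C]_(m, n')) : - X = X.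
Proof. by apply/matrixP => i i'; rewrite mxE opp2. Qed.

Let W_F x : x \in W -> F *m x \in W.
Proof.
rewrite !(mem_newspace _ FF kappa0) FFx -scalemxAr => /andP[/eqP -> ->].
by rewrite scaler0 eqxx.
Qed.

Let Q_W (a : 'cV[C]_n) (h : 'rV[C]_n) g (y : 'cV[C]_n) :
  T = - (a *m h) -> h *m a = (-1)%:M -> h *m F *m a = g%:M ->
  MD *m (MD + g%:M) *m y \in W.
Proof.
move=> TE ha hFa; rewrite MDE (rank_one_quadratic TE hFa FF).
rewrite (mem_newspace _ FF kappa0) !mulmxA (rank_one_T_quadratic _ TE ha hFa).
by rewrite (rank_one_TF_quadratic TE ha hFa FF) !mul0mx eqxx.
Qed.

(** In characteristic 2 the roots mu and - mu of [rank_one_quartic] coincide. If F is mu on W, a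
    single factor M D - mu already kills the image of M D (M D + g). *)
Lemma diagonalizable_even_scalar mu : kappa = mu ^+ 2 ->
  (forall x, x \in W -> F *m x = mu *: x) -> diagonalizable MD.
Proof.
move=> kE FW; have mu0 : mu != 0 by move: kappa0; rewrite kE sqrf_eq0.
case: T_small => [T0|[a [h [g [TE ha hFa g0 gk]]]]].
  have -> : MD = mu%:M; last exact: diagonalizable_scalar.
  rewrite MDE T0 sub0r mulNmx mul1mx oppM; apply/matrixP => i i'.
  have /FW : delta_mx i' 0 \in W by rewrite (mem_newspace _ FF kappa0) T0 !mul0mx eqxx.
  rewrite -colE => /matrixP/(_ i 0); rewrite !mxE andbT => ->.
  by rewrite mulr_natr.
have gmu : g != mu by apply: contraNneq gk => ->; rewrite kE.
apply: (@diagonalizable_annul _ _ _ [:: mu; 0; g]) => //=.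
  by rewrite !inE negb_or mu0 eq_sym gmu eq_sym g0.
rewrite mulmx1 raddf0 subr0 (oppM g%:M).
apply: mulmx_cV_eq0 => x.
rewrite -mulmxA; have yW := Q_W x TE ha hFa.
move: (MD *m _ *m x) yW (FW _ yW) => y.
rewrite (mem_newspace _ FF kappa0) => /andP[_ /eqP TFy] Fy; rewrite mulmxBl.
have -> : MD *m y = F *m y by rewrite {1}MDE -mulmxA mulmxBl TFy mul1mx sub0r oppM.
by rewrite Fy mul_scalar_mx subrr.
Qed.

(** On a line F is a scalar with square kappa, and mu is the only such scalar. *)
Lemma diagonalizable_even_dim : (\dim W <= 1)%N -> diagonalizable MD.
Proof.
move=> dimW; have [mu kE] := sqrt_kappa.
apply: (diagonalizable_even_scalar kE) => x xW.
have [->|x0] := eqVneq x 0; first by rewrite mulmx0 scaler0.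
have WE : W = <[x]>%VS.
  apply/esym/eqP; rewrite eqEdim -memvE xW dim_vline x0.
  by [].
have /vlineP[l Fx] : F *m x \in <[x]>%VS by rewrite -WE W_F.
suff -> : mu = l by [].
have : kappa *: x = l ^+ 2 *: x by rewrite -FFx Fx -scalemxAr Fx scalerA.
move/eqP; rewrite -subr_eq0 -scalerBl scaler_eq0 (negPf x0) orbF subr_eq0 kE.
by rewrite eqf_sqr opp2 orbb => /eqP.
Qed.

(** On W, where M D = F, the square of M D - mu is F^2 + mu^2 = 2 kappa = 0, and a diagonalizable
    matrix has no nilpotent part. *)
Lemma diagonalizable_even_W mu x : kappa = mu ^+ 2 -> diagonalizable MD ->
  x \in W -> F *m x = mu *: x.
Proof.
move=> kE dMD xW.
have MDW y : y \in W -> MD *m y = F *m y.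
  rewrite (mem_newspace _ FF kappa0) => /andP[_ /eqP TFy].
  by rewrite MDE -mulmxA mulmxBl TFy mul1mx sub0r oppM.
suff : (MD - mu%:M) *m x = 0.
  by rewrite mulmxBl MDW // mul_scalar_mx => /eqP; rewrite subr_eq0 => /eqP.
apply: diagonalizable_sqr => //.
have Ey y : y \in W -> (MD - mu%:M) *m y = F *m y - mu *: y.
  by move=> yW; rewrite mulmxBl MDW // mul_scalar_mx.
have xW' : F *m x - mu *: x \in W by rewrite rpredB ?rpredZ ?W_F.
rewrite !Ey // mulmxBr FFx -scalemxAr scalerBr scalerA -expr2 -kE opprB.
by rewrite -[X in X + _]oppM addNr.
Qed.

Hypothesis n_le4 : (n <= 4)%N.
Hypothesis F_anti : forall a b, (F a b == 0) = (a != rev_ord b).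

(** F is mu on W. If T = 0, then F is both scalar and antidiagonal, so n = 1. If T has rank one, two
    lines split off from W, which settles n <= 3; beyond that F - mu would have rank one. *)
Lemma diagonalizable_even_dim_le : diagonalizable MD -> (\dim W <= 1)%N.
Proof.
move=> dMD; have [mu kE] := sqrt_kappa.
have FW x : x \in W -> F *m x = mu *: x by apply: diagonalizable_even_W.
have mu0 : mu != 0 by move: kappa0; rewrite kE sqrf_eq0.
case: T_small => [T0|[a [h [g [TE ha hFa g0 gk]]]]].
  have FE a b : F a b = mu *+ (a == b).
    have /FW : delta_mx b 0 \in W by rewrite (mem_newspace _ FF kappa0) T0 !mul0mx eqxx.
    by rewrite -colE => /matrixP/(_ a 0); rewrite !mxE andbT mulr_natr.
  rewrite (leq_trans (dimvS (subvf _))) // dimvf dim_matrix ?muln1 ?mul1n.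
  rewrite leqNgt; apply/negP => n1; have := F_anti (Ordinal n_gt0) (Ordinal n_gt0).
  rewrite FE eqxx mulr1n (negPf mu0) -val_eqE /= => /esym/negbFE/eqP.
  by lia.
have muE : g != mu by apply: contraNneq gk => ->; rewrite kE.
have a0 : a != 0.
  apply: contraTneq (oner_neq0 C) => a0; move: ha; rewrite a0 mulmx0.
  by move=> /matrixP/(_ 0 0)/eqP; rewrite !mxE eq_sym oppr_eq0 => ->.
have Fa0 : F *m a != 0.
  by apply: contraNneq a0 => Fa; rewrite -(inj_eq (scalerI kappa0)) -FFx Fa mulmx0 scaler0.
have [n3|n4] := leqP n 3.
  have MAE : 1%:M + (T - 1%:M) = T by rewrite addrC subrK.
  have [] := old_new_direct MAE MDE FF kappa0 T_small.
  rewrite directvE /= => /eqP + full; rewrite full dimvf dim_matrix ?muln1 ?mul1n -/W.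
  have dim1 (U : {vspace 'cV[C]_n}) (x : 'cV[C]_n) : x != 0 -> x \in U -> (0 < \dim U)%N.
    by move=> x0; rewrite memvE => /dimvS; rewrite dim_vline x0.
  have aA : a \in Ker (T - 1%:M).
    by rewrite (mem_KerMA MAE) TE mulNmx -mulmxA ha mul_mx_scalar scaleN1r opprK.
  have := dim1 _ _ a0 aA; have : (0 < \dim (Ker MD))%N.
    by apply: dim1 Fa0 _; rewrite (F_KerMD MAE MDE FF).
  by move: n3; clear; move: (\dim _) (\dim _) (\dim _) => x y z; lia.
exfalso.
have FQ : (F - mu%:M) *m (kappa *: (1%:M - T) - F *m T *m F - g *: F) = 0.
  rewrite -(rank_one_quadratic TE hFa FF) -MDE; apply: mulmx_cV_eq0 => x.
  by rewrite -mulmxA mulmxBl FW ?(Q_W x TE ha hFa) // mul_scalar_mx subrr.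
have [u [v]] := rank_one_scalar TE FF kE FQ.
have mug : mu * (mu + g) != 0 by rewrite mulf_neq0 // addr_eq0 opp2 eq_sym.
set G := F - mu%:M => GE.
have GG : G *m G = 0.
  rewrite /G mulmxBl !mulmxBr FF mul_mx_scalar !mul_scalar_mx scale_scalar_mx.
  rewrite -expr2 -kE.
  by rewrite opprB -[X in X + _]oppM addNr.
have GF : G *m F = - (mu *: G).
  rewrite /G mulmxBl FF mul_scalar_mx scalerBr scale_scalar_mx -expr2 -kE opprB.
  by [].
have Ga0 : G *m a != 0.
  apply: contraNneq muE => /(congr1 (mulmx h)); rewrite mulmx0 mulmxA mulmxBr mulmxBl hFa.
  rewrite mul_mx_scalar -scalemxAl ha => /matrixP/(_ 0 0)/eqP.
  by rewrite !mxE !mulr1n mulrN1 opprK addr_eq0 opp2.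
(* Multiplication by G, where G^2 = 0 and G F = - mu G, leaves (G a) (u - mu v) = 0 with G a
   nonzero; thus the rank of G drops from 2 to 1. *)
have uv : u = mu *: v.
  apply/eqP; rewrite -subr_eq0; apply/eqP.
  have : (G *m a) *m (u - mu *: v) = 0.
    have := congr1 (mulmx G) GE; rewrite -scalemxAr GG scaler0 mulmxDr !mulmxA GF.
    by rewrite mulmxBr !mulNmx -!scalemxAl -!scalemxAr => <-.
  move: (G *m a) (u - _) Ga0 => c d c0 cd.
  have [i ci] : exists i, c i 0 != 0.
    apply/existsP; apply: contraR c0; rewrite negb_exists => /forallP c0.
    apply/eqP/matrixP => i i'; rewrite ord1 mxE; exact/eqP/negbNE/c0.
  apply/matrixP => i0 j'.
  move/matrixP: cd => /(_ i j'); rewrite !mxE big_ord1 (ord1 i0) => /eqP.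
  by rewrite mulf_eq0 (negPf ci) => /eqP.
have {}GE : exists w : 'cV[C]_n, G = w *m v.
  exists ((mu * (mu + g))^-1 *: (mu *: a + F *m a)).
  by rewrite -scalemxAl mulmxDl -scalemxAl scalemxAr -uv -GE scalerA mulVf ?scale1r.
case: GE => w GE.
have o1 : (1 < n)%N by rewrite (leq_trans _ n4).
have o2 : (n - 2 < n)%N by move: n4; clear; lia.
have o3 : (n - 1 < n)%N by move: n4; clear; lia.
(* The antidiagonal entries (0, n-1) and (1, n-2) of G = w v are nonzero, hence so are w_0 and
   v_(n-2). But the entry (0, n-2) lies on neither diagonal and is 0. *)
pose i0 := Ordinal n_gt0; pose i1 := Ordinal o1.
pose i2 := Ordinal o2; pose i3 := Ordinal o3.
have Gij i i' : i != i' -> (w i 0 * v 0 i' == 0) = (i != rev_ord i').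
  move=> ii'; rewrite -F_anti; move/matrixP: GE => /(_ i i').
  by rewrite !mxE big_ord1 (negPf ii') subr0 => ->.
have := Gij i0 i3; have := Gij i1 i2; have := Gij i0 i2.
rewrite !mulf_eq0 -!val_eqE /=.
have [-> -> ->] : [/\ (0 == n - 2)%N = false, (0 == n - 1)%N = false
    & (1 == n - 2)%N = false] by move: n4; clear; split; lia.
have [-> -> ->] : [/\ (0 == n - (n - 2).+1)%N = false, (0 == n - (n - 1).+1)%N
    & (1 == n - (n - 2).+1)%N] by move: n4; clear; split; lia.
move=> /(_ isT)/orP[] -> // /(_ isT).
  by move=> _ /(_ isT).
by rewrite orbT.
Qed.

End KernelDiagonalization.

(** * The field K_oo and its projective action *)

Section Koo.
Variables (R : realType) (Fq : finFieldType) (C : Cinfty R Fq).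
Local Notation q := #|Fq|.
Local Notation t := (tC C).
Local Notation evalA := (@evalA R Fq C).
Local Notation ratK := (@ratK R Fq C).
Local Notation Koo := (@Koo R Fq C).
Implicit Types x y z : C.

HB.instance Definition _ :=
  GRing.RMorphism.copy evalA (horner_eval t \o map_poly embC).

Lemma evalAX : evalA 'X = t.
Proof. by rewrite /evalA /evalA_for map_polyX hornerX. Qed.

Lemma evalAC (c : Fq) : evalA c%:P = embC c.
Proof. by rewrite /evalA /evalA_for map_polyC hornerC. Qed.

(** The leading term dominates since |t| > 1. In particular t is transcendental over F_q. *)
Lemma absC_evalA (a : {poly Fq}) :
  absC (evalA a) = if a == 0 then 0 else q%:R ^+ (size a).-1.
Proof.
elim/poly_ind: a => [|a c IH]; first by rewrite eqxx rmorph0 absC0.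
rewrite rmorphD rmorphM /= evalAX evalAC.
have [a0|a0] := eqVneq a 0.
  rewrite a0 rmorph0 !mul0r !add0r polyC_eq0 size_polyC.
  by have [->|c0] := eqVneq c 0; rewrite ?rmorph0 ?absC0 ?absC_emb.
have aX : a * 'X + c%:P != 0.
  by rewrite -size_poly_eq0 size_MXaddC (negPf a0).
rewrite (negPf aX) size_MXaddC (negPf a0) /=.
have sa : (size a = (size a).-1.+1)%N by rewrite prednK // size_poly_gt0.
have E : absC (evalA a * t) = q%:R ^+ size a.
  by rewrite absCM IH (negPf a0) absC_t -exprSr -sa.
rewrite absCD_dom E // (le_lt_trans (absC_emb_le1 _ _)) //.
by rewrite exprn_egt1 ?natq_gt1 // sa.
Qed.

Lemma evalA_eq0 (a : {poly Fq}) : (evalA a == 0) = (a == 0).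
Proof.
rewrite -absC_eq0 absC_evalA; have [_|_] := eqVneq a 0; first by rewrite eqxx.
by rewrite expf_eq0 gt_eqF ?natq_gt0 ?andbF.
Qed.

Lemma ratK_evalA a : ratK (evalA a).
Proof. by exists a, 1; rewrite oner_neq0 /= -[evalA_for _ _ 1]/(evalA 1) rmorph1 divr1. Qed.

Lemma ratKD x y : ratK x -> ratK y -> ratK (x + y).
Proof.
move=> [a [b [b0 ->]]] [a' [b' [b0' ->]]]; rewrite -!/(evalA _).
exists (a * b' + a' * b), (b * b'); split; first by rewrite mulf_neq0.
by rewrite -!/(evalA _) rmorphD !rmorphM /= addf_div ?evalA_eq0.
Qed.

Lemma ratKM x y : ratK x -> ratK y -> ratK (x * y).
Proof.
move=> [a [b [b0 ->]]] [a' [b' [b0' ->]]]; rewrite -!/(evalA _).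
exists (a * a'), (b * b'); split; first by rewrite mulf_neq0.
by rewrite -!/(evalA _) !rmorphM /= mulf_div.
Qed.

Lemma ratKN x : ratK x -> ratK (- x).
Proof.
move=> [a [b [b0 ->]]]; rewrite -!/(evalA _); exists (- a), b; split=> //.
by rewrite -!/(evalA _) rmorphN mulNr.
Qed.

Lemma ratKV x : ratK x -> ratK x^-1.
Proof.
move=> [a [b [b0 ->]]]; rewrite -!/(evalA _).
have [->|a0] := eqVneq a 0.
  by rewrite rmorph0 mul0r invr0 -(rmorph0 evalA); apply: ratK_evalA.
by exists b, a; rewrite -!/(evalA _) invf_div.
Qed.

Lemma absC_ratK x : ratK x -> x != 0 -> exists e : int, absC x = q%:R ^ e.
Proof.
move=> [a [b [b0 ->]]]; rewrite -!/(evalA _) mulf_eq0 negb_or evalA_eq0 => /andP[a0 _].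
rewrite absCM absCV !absC_evalA (negPf a0) (negPf b0).
exists ((size a).-1%:Z - (size b).-1%:Z).
by rewrite expfzDr ?gt_eqF ?natq_gt0 // -invr_expz.
Qed.

Lemma Koo_ratK x : ratK x -> Koo x.
Proof. by move=> xK e e0; exists x => //; rewrite subrr absC0. Qed.

Lemma Koo_evalA a : Koo (evalA a).
Proof. exact/Koo_ratK/ratK_evalA. Qed.

Lemma Koo_emb (c : Fq) : Koo (embC c).
Proof. by rewrite -evalAC; apply: Koo_evalA. Qed.

Lemma Koo0 : Koo 0.
Proof. by rewrite -(rmorph0 evalA); apply: Koo_evalA. Qed.

Lemma Koo1 : Koo 1.
Proof. by rewrite -(rmorph1 evalA); apply: Koo_evalA. Qed.

Lemma Koo_t : Koo t.
Proof. by rewrite -evalAX; apply: Koo_evalA. Qed.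

Lemma KooD x y : Koo x -> Koo y -> Koo (x + y).
Proof.
move=> xK yK e e0; have [x' x'K xx'] := xK e e0; have [y' y'K yy'] := yK e e0.
exists (x' + y'); first exact: ratKD.
by rewrite opprD addrACA absCD_lt.
Qed.

Lemma KooN x : Koo x -> Koo (- x).
Proof.
move=> xK e e0; have [x' x'K xx'] := xK e e0.
by exists (- x'); [apply: ratKN | rewrite -opprD absCN].
Qed.

Lemma KooB x y : Koo x -> Koo y -> Koo (x - y).
Proof. by move=> xK yK; apply/KooD/KooN. Qed.

Lemma KooM x y : Koo x -> Koo y -> Koo (x * y).
Proof.
move=> xK yK e e0.
have [y' y'K yy'] : exists2 y', ratK y' & absC (y - y') < e / (absC x + 1).
  by apply: yK; rewrite divr_gt0 // ltr_wpDl ?absC_ge0.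
have [x' x'K xx'] : exists2 x', ratK x' & absC (x - x') < e / (absC y' + 1).
  by apply: xK; rewrite divr_gt0 // ltr_wpDl ?absC_ge0.
exists (x' * y'); first exact: ratKM.
have small u v : absC u < e / (absC v + 1) -> absC (v * u) < e.
  rewrite ltr_pdivlMr ?ltr_wpDl ?absC_ge0 // => h; rewrite absCM.
  apply: le_lt_trans h; rewrite mulrC ler_wpM2l ?absC_ge0 //.
  by rewrite lerDl ler01.
have -> : x * y - x' * y' = x * (y - y') + y' * (x - x') by ring.
by apply: absCD_lt; apply: small.
Qed.

Lemma absC_close x y : absC (x - y) < absC x -> absC y = absC x.
Proof.
move=> xy; have -> : y = x + - (x - y) by rewrite opprB addrC subrK.
by rewrite absCD_dom // absCN.
Qed.

Lemma KooV x : Koo x -> Koo x^-1.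
Proof.
move=> xK; have [->|x0] := eqVneq x 0; first by rewrite invr0; apply: Koo0.
have ax : 0 < absC x by rewrite absC_gt0.
move=> e e0; have [|y yK] := xK (Num.min (absC x) (e * absC x ^+ 2)).
  by rewrite lt_min ax mulr_gt0 ?exprn_gt0.
rewrite lt_min => /andP[/absC_close yx xy].
have y0 : y != 0 by rewrite -absC_gt0 yx.
exists y^-1; first exact: ratKV.
have -> : x^-1 - y^-1 = - ((x - y) / (x * y)) by field; rewrite x0 y0.
by rewrite absCN absCM absCV absCM yx -expr2 ltr_pdivrMr ?exprn_gt0.
Qed.

Lemma absC_Koo x : Koo x -> x != 0 -> exists e : int, absC x = q%:R ^ e.
Proof.
move=> xK x0; have [|y yK /absC_close yx] := xK (absC x); first by rewrite absC_gt0.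
by rewrite -yx; apply: absC_ratK; rewrite // -absC_gt0 yx absC_gt0.
Qed.

(** Nonzero elements of K_oo have integral powers of q as absolute values, and none lies strictly
    between 1 and q. *)
Lemma annulus_Omega x : 1 < absC x -> absC x < q%:R -> Omega x.
Proof.
move=> x1 xq xK; have x0 : x != 0 by rewrite -absC_gt0 (lt_trans _ x1).
have [e xe] := absC_Koo xK x0; rewrite xe in x1 xq.
have : (q%:R : R) ^ (0 : int) < q%:R ^ e by rewrite expr0z.
have : (q%:R : R) ^ e < q%:R ^ (1 : int) by rewrite expr1z.
by rewrite !ltr_eXz2l ?natq_gt1 //; lia.
Qed.

End Koo.

Section Matrix2.
Variable (S : comPzRingType).
Implicit Types g h : 'M[S]_2.

Lemma sum_I2 (V : nmodType) (u : 'I_2 -> V) : \sum_i u i = u 0 + u 1.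
Proof.
by rewrite big_ord_recl big_ord1; congr (_ + u _); apply/val_inj.
Qed.

Lemma forall_I2 (P : 'I_2 -> Prop) : P 0 -> P 1 -> forall i, P i.
Proof.
move=> P0 P1; case=> [[|[|//]]] h.
  by rewrite (_ : Ordinal h = 0) //; apply/val_inj.
by rewrite (_ : Ordinal h = 1) //; apply/val_inj.
Qed.

Lemma mulmx2E g h i i' : (g *m h) i i' = g i 0 * h 0 i' + g i 1 * h 1 i'.
Proof. by rewrite mxE sum_I2. Qed.

Lemma eq_mx2 g h : g 0 0 = h 0 0 -> g 0 1 = h 0 1 -> g 1 0 = h 1 0 ->
  g 1 1 = h 1 1 -> g = h.
Proof.
by move=> e00 e01 e10 e11; apply/matrixP; do 2!apply: forall_I2.
Qed.

Lemma mx2E (a b c d : S) : let g := mx2 a b c d in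
  (g 0 0 = a) * (g 0 1 = b) * (g 1 0 = c) * (g 1 1 = d).
Proof. by rewrite /= !mxE. Qed.

Lemma det_mx2 g : \det g = g 0 0 * g 1 1 - g 0 1 * g 1 0.
Proof.
rewrite (expand_det_row _ 0) sum_I2 /cofactor !det_mx11 !mxE /= expr0 expr1 mul1r mulN1r.
have -> : lift (0 : 'I_2) 0 = 1 by apply/val_inj.
have -> : lift (1 : 'I_2) 0 = 0 by apply/val_inj.
by rewrite mulrN.
Qed.

Lemma det_mx2E (a b c d : S) : \det (mx2 a b c d) = a * d - b * c.
Proof. by rewrite det_mx2 !mx2E. Qed.

End Matrix2.

(** * The slash action *)

Section Slash.
Variables (R : realType) (Fq : finFieldType) (C : Cinfty R Fq).
Local Notation Koo := (@Koo R Fq C).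
Local Notation Omega := (@Omega R Fq C).
Implicit Types (x y z : C) (g h : 'M[C]_2) (phi psi : C -> C).

Lemma unitmx2 g : (g \in unitmx) = (\det g != 0).
Proof. by rewrite unitmxE unitfE. Qed.

Lemma GL2Koo_mx2 (a b c d : C) : Koo a -> Koo b -> Koo c -> Koo d ->
  a * d - b * c != 0 -> GL2Koo (mx2 a b c d).
Proof.
move=> aK bK cK dK det0; split; last by rewrite unitmx2 det_mx2E.
by do 2!apply: forall_I2; rewrite mx2E.
Qed.

Lemma GL2K_mx2 (a b c d : C) : ratK a -> ratK b -> ratK c -> ratK d ->
  a * d - b * c != 0 -> GL2K (mx2 a b c d).
Proof.
move=> aK bK cK dK det0; split; last by rewrite unitmx2 det_mx2E.
by do 2!apply: forall_I2; rewrite mx2E.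
Qed.

Lemma GL2K_Koo g : GL2K g -> GL2Koo g.
Proof. by case=> gK gu; split=> // i i'; apply: Koo_ratK. Qed.

Lemma GL2KM g h : GL2K g -> GL2K h -> GL2K (g *m h).
Proof.
move=> [gK gu] [hK hu]; split; last by rewrite unitmx_mul gu.
by move=> i i'; rewrite mulmx2E; apply: ratKD; apply: ratKM.
Qed.

Lemma GL2KooM g h : GL2Koo g -> GL2Koo h -> GL2Koo (g *m h).
Proof.
move=> [gK gu] [hK hu]; split; last by rewrite unitmx_mul gu.
by move=> i i'; rewrite mulmx2E; apply: KooD; apply: KooM.
Qed.

Lemma GL2K_mxA (s : 'M[{poly Fq}]_2) : s \in unitmx -> GL2K (mxA C s).
Proof.
move=> su; split; first by move=> i i'; rewrite mxE; apply: ratK_evalA.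
rewrite unitmx2 det_map_mx evalA_eq0; move: su; rewrite unitmxE.
by apply: contraTneq => ->; rewrite unitr0.
Qed.

Lemma mxAM (s s' : 'M[{poly Fq}]_2) : mxA C (s *m s') = mxA C s *m mxA C s'.
Proof. exact: map_mxM. Qed.

Lemma Koo_mobius g x : GL2Koo g -> Koo x -> Koo (mobius g x).
Proof.
case=> gK _ xK; apply: KooM; last apply: KooV; apply: KooD => //; exact: KooM.
Qed.

Lemma linear_Omega_neq0 (u v z : C) : Koo u -> Koo v -> Omega z ->
  (u != 0) || (v != 0) -> u * z + v != 0.
Proof.
move=> uK vK zO; have [->|u0 _] := eqVneq u 0; first by rewrite mul0r add0r.
apply: contra_notN zO; rewrite addr_eq0 => /eqP uz.
have -> : z = - v / u by rewrite -uz mulrAC divff // mul1r.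
by apply: KooM; [apply: KooN | apply: KooV].
Qed.

Lemma autj_neq0 g z : GL2Koo g -> Omega z -> autj g z != 0.
Proof.
case=> gK; rewrite unitmx2 det_mx2 => det0 zO; apply: linear_Omega_neq0 => //.
rewrite -negb_and; apply: contra det0 => /andP[/eqP -> /eqP ->].
by rewrite !mulr0 subr0.
Qed.

Lemma mobiusK h z : autj h z != 0 ->
  mobius h z * autj h z = h 0 0 * z + h 0 1.
Proof. by move=> h0; rewrite /mobius divfK. Qed.

Lemma autjM g h z : autj h z != 0 -> autj (g *m h) z = autj g (mobius h z) * autj h z.
Proof.
move=> h0; rewrite [autj g _]/autj mulrDl -mulrA mobiusK // /autj !mulmx2E.
by ring.
Qed.

Lemma mobiusM g h z : autj h z != 0 -> mobius (g *m h) z = mobius g (mobius h z).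
Proof.
move=> h0; rewrite {1 2}/mobius autjM //.
have -> : (g *m h) 0 0 * z + (g *m h) 0 1
    = (g 0 0 * mobius h z + g 0 1) * autj h z.
  by rewrite mulrDl -mulrA mobiusK // /autj !mulmx2E; ring.
by rewrite invfM mulrACA divff // mulr1.
Qed.

Lemma Omega_mobius g z : GL2Koo g -> Omega z -> Omega (mobius g z).
Proof.
move=> gK zO; have j0 := autj_neq0 gK zO; case: gK => gK; rewrite unitmx2 det_mx2 => det0.
move=> wK; set w := mobius g z in wK.
have E : (g 0 0 - w * g 1 0) * z + (g 0 1 - w * g 1 1) = 0.
  have : w * autj g z = g 0 0 * z + g 0 1 by rewrite /w /mobius divfK.
  by move=> E; rewrite /autj in E; rewrite -[RHS](subrr (w * (g 1 0 * z + g 1 1))) {1}E; ring.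
have /eqP := E; apply/negP; apply: linear_Omega_neq0 => //.
- by apply: KooB => //; apply: KooM.
- by apply: KooB => //; apply: KooM.
rewrite -negb_and; apply: contra det0 => /andP[]; rewrite !subr_eq0 => /eqP -> /eqP ->.
by apply/eqP; ring.
Qed.

Lemma slashM k m phi g h z : GL2Koo g -> GL2Koo h -> Omega z ->
  slash k m (slash k m phi g) h z = slash k m phi (g *m h) z.
Proof.
move=> gK hK zO; have h0 := autj_neq0 hK zO.
rewrite /slash mobiusM // autjM // det_mulmx.
rewrite expfzMl exprMn invfM.
by rewrite -!mulrA; congr (_ * (_ * _)); rewrite mulrCA.
Qed.

Lemma on_Omega_slash k m phi g : GL2Koo g -> on_Omega phi -> on_Omega (slash k m phi g).
Proof.
move=> gK phiO z zO; rewrite /slash phiO ?mul0r //.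
by move=> /(_ (Koo_mobius gK (contrapT zO))).
Qed.

(** Off Omega both sides vanish by [on_Omega], which makes this an equality of functions. *)
Lemma slashM_fun k m phi g h : GL2Koo g -> GL2Koo h -> on_Omega phi ->
  slash k m (slash k m phi g) h = slash k m phi (g *m h).
Proof.
move=> gK hK phiO; apply/funext => z; have [zO|zO] := EM (Omega z).
  exact: slashM.
by rewrite !on_Omega_slash //; [apply: GL2KooM | apply: on_Omega_slash].
Qed.

Lemma slash1 k m phi : slash k m phi 1%:M = phi.
Proof.
apply/funext => z; rewrite /slash /mobius /autj !mxE /= !mulr1n !mulr0n.
by rewrite mul0r mul1r addr0 add0r divr1 det1 exp1rz expr1n invr1 !mulr1.
Qed.

End Slash.

(** * Cuspidal functions *)

Section Limits.
Variables (R : realType) (Fq : finFieldType) (C : Cinfty R Fq).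
Implicit Types (u v : nat -> C) (x y l : C).

Lemma cvgC_ext u v l : u =1 v -> cvgC u l -> cvgC v l.
Proof.
by move=> uv ul e e0; have [N NP] := ul e e0; exists N => i Ni; rewrite -uv NP.
Qed.

Lemma cvgCD u v x y : cvgC u x -> cvgC v y -> cvgC (fun i => u i + v i) (x + y).
Proof.
move=> ux vy e e0; have [N NP] := ux e e0; have [N' NP'] := vy e e0.
exists (maxn N N') => i; rewrite geq_max => /andP[Ni N'i].
by rewrite opprD addrACA absCD_lt ?NP ?NP'.
Qed.

Lemma cvgCZ u x c : cvgC u x -> cvgC (fun i => c * u i) (c * x).
Proof.
move=> ux e e0; have c1 : 0 < absC c + 1 by rewrite ltr_wpDl ?absC_ge0.
have [|N NP] := ux (e / (absC c + 1)); first by rewrite divr_gt0.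
exists N => i /NP; rewrite -mulrBr absCM ltr_pdivlMr // => h.
by apply: le_lt_trans h; rewrite mulrC ler_wpM2l ?absC_ge0 // lerDl ler01.
Qed.

Lemma cvgC_cst x : cvgC (fun=> x) x.
Proof. by move=> e e0; exists 0%N => i _; rewrite subrr absC0. Qed.

Lemma cvgC_unique u x y : cvgC u x -> cvgC u y -> x = y.
Proof.
move=> ux uy; apply/eqP; rewrite -subr_eq0; apply: contraT => xy.
have e0 : 0 < absC (x - y) by rewrite absC_gt0.
have [N NP] := ux _ e0; have [N' NP'] := uy _ e0.
have := absCB_lt (NP' _ (leq_maxr N N')) (NP _ (leq_maxl N N')).
by rewrite (_ : _ - _ = x - y) ?ltxx //; ring.
Qed.

End Limits.

Section Cuspidal.
Variables (R : realType) (Fq : finFieldType) (C : Cinfty R Fq).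
Local Notation q := #|Fq|.
Local Notation Koo := (@Koo R Fq C).
Local Notation Omega := (@Omega R Fq C).
Implicit Types (x y z : C) (g h : 'M[C]_2) (phi psi : C -> C).

Lemma rigidD phi psi : rigid_analytic phi -> rigid_analytic psi ->
  rigid_analytic (fun z => phi z + psi z).
Proof.
move=> phiR psiR i e e0; have [P [Q PQ]] := phiR i e e0.
have [P' [Q' PQ']] := psiR i e e0.
exists (P * Q' + P' * Q), (Q * Q') => z zO.
have [Qz phiz] := PQ z zO; have [Qz' psiz] := PQ' z zO.
split; first by rewrite hornerM mulf_neq0.
by rewrite hornerD !hornerM -addf_div // opprD addrACA absCD_lt.
Qed.

Lemma rigidZ c phi : rigid_analytic phi -> rigid_analytic (fun z => c * phi z).
Proof.
move=> phiR i e e0; have c1 : 0 < absC c + 1 by rewrite ltr_wpDl ?absC_ge0.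
have [|P [Q PQ]] := phiR i (e / (absC c + 1)); first by rewrite divr_gt0.
exists (c *: P), Q => z zO; have [Qz h] := PQ z zO; split=> //.
move: h; rewrite hornerZ -mulrA -mulrBr absCM ltr_pdivlMr // => h.
by apply: le_lt_trans h; rewrite mulrC ler_wpM2l ?absC_ge0 // lerDl ler01.
Qed.

Lemma absC_tri x y : absC (x + y) <= absC x + absC y.
Proof.
by apply: absCD_le; rewrite (lerDl, lerDr) absC_ge0.
Qed.

(** If u is nonzero, z is at distance at least q^-i from - v / u, so the form is at least |u| q^-i.
    This also serves v as long as |v| <= |u| q^i; beyond, v dominates u z. *)
Lemma form_lower i (u v z : C) : Koo u -> Koo v -> Omega_aff i z ->
  absC u * q%:R ^- (2 * i) <= absC (u * z + v)
  /\ absC v * q%:R ^- (2 * i) <= absC (u * z + v).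
Proof.
move=> uK vK [zi zf].
have q_gt0 := natq_gt0 R Fq; have q_ge1 := ltW (natq_gt1 R Fq).
have qi0 : 0 < q%:R ^+ i :> R by rewrite exprn_gt0.
have qi1 : 1 <= q%:R ^+ i :> R by rewrite exprn_ege1.
have q2i : (q%:R : R) ^- (2 * i) <= 1 by rewrite invf_le1 ?exprn_gt0 // exprn_ege1.
have [u0|u0] := eqVneq u 0.
  rewrite u0 absC0 !mul0r add0r absC_ge0; split=> //.
  by rewrite ler_piMr ?absC_ge0.
have low : absC u * q%:R ^- i <= absC (u * z + v).
  have := zf (- v / u) (KooM (KooN vK) (KooV uK)).
  rewrite mulNr opprK => h.
  have -> : u * z + v = u * (z + v / u) by rewrite mulrDr mulrCA divff // mulr1.
  by rewrite absCM ler_wpM2l ?absC_ge0.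
have q2E : (q%:R : R) ^- (2 * i) = q%:R ^- i * q%:R ^- i.
  by rewrite mul2n -addnn exprD invfM.
split.
  apply: le_trans low; rewrite ler_wpM2l ?absC_ge0 // q2E.
  by rewrite ler_piMr ?invr_ge0 ?(ltW qi0) ?invf_le1.
have [vu|uv] := leP (absC v) (absC u * q%:R ^+ i).
  apply: le_trans low; rewrite q2E mulrA ler_wpM2r ?invr_ge0 ?(ltW qi0) //.
  by rewrite ler_pdivrMr.
rewrite addrC absCD_dom; first by rewrite ler_piMr ?absC_ge0.
by rewrite absCM (le_lt_trans _ uv) // ler_wpM2l ?absC_ge0.
Qed.

Lemma autj_bounds i g : GL2Koo g -> exists lo hi : R, [/\ 0 < lo, 0 < hi &
  forall z, Omega_aff i z -> lo <= absC (autj g z) <= hi].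
Proof.
case=> gK; rewrite unitmx2 det_mx2 => det0.
pose M := absC (g 1 0) + absC (g 1 1).
have M0 : 0 < M.
  rewrite lt_def addr_ge0 ?absC_ge0 // andbT paddr_eq0 ?absC_ge0 // !absC_eq0.
  by apply: contra det0 => /andP[/eqP -> /eqP ->]; rewrite !mulr0 subr0.
have q_gt0 := natq_gt0 R Fq; have q_ge1 := ltW (natq_gt1 R Fq).
(* The lower bound is the mean of the two bounds in [form_lower]. *)
exists (M / 2 * q%:R ^- (2 * i)), (M * q%:R ^+ i); split.
- by rewrite !mulr_gt0 ?invr_gt0 ?exprn_gt0.
- by rewrite mulr_gt0 ?exprn_gt0.
move=> z zi; apply/andP; split.
  have [h1 h2] := form_lower (gK 1 0) (gK 1 1) zi.
  by rewrite /M mulrAC mulrDl -/(autj g z) in h1 h2 *; lra.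
case: zi => zi _; apply: le_trans (absC_tri _ _) _.
rewrite absCM /M mulrDl lerD ?ler_wpM2l ?absC_ge0 //.
by rewrite ler_peMr ?absC_ge0 ?exprn_ege1.
Qed.

Lemma natq_pow_ge (B : R) : exists i : nat, B <= q%:R ^+ i.
Proof.
exists (Num.bound `|B|); apply: le_trans (ler_norm _) _.
apply/ltW/(lt_le_trans (archi_boundP (normr_ge0 B))).
by rewrite -natrX ler_nat ltnW // ltn_expl // card_gt1.
Qed.

(** For x in K_oo, g z - x is (u z + v) / (c z + d), where u and v depend on x. Since det g = d u -
    c v, they are not both small, uniformly in x. *)
Lemma mobius_affinoid i g : GL2Koo g ->
  exists i', forall z, Omega_aff i z -> Omega_aff i' (mobius g z).
Proof.
move=> gG; have [lo [hi [lo0 hi0 jb]]] := autj_bounds i gG.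
case: (gG) => gK; rewrite unitmx2 det_mx2 => det0.
set D := g 0 0 * g 1 1 - g 0 1 * g 1 0 in det0.
have q_gt0 := natq_gt0 R Fq; have q_ge1 := ltW (natq_gt1 R Fq).
pose M := absC (g 1 0) + absC (g 1 1) + 1.
have M0 : 0 < M by rewrite ltr_wpDl // addr_ge0 ?absC_ge0.
pose e := absC D / M * q%:R ^- (2 * i) / hi.
have e0 : 0 < e by rewrite !mulr_gt0 ?invr_gt0 ?exprn_gt0 ?absC_gt0.
have [i1 B1] := natq_pow_ge ((absC (g 0 0) * q%:R ^+ i + absC (g 0 1)) / lo).
have [i2 B2] := natq_pow_ge e^-1.
exists (maxn i1 i2) => z zi; have /andP[jlo jhi] := jb z zi.
have j0 : 0 < absC (autj g z) by apply: lt_le_trans jlo.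
split.
  apply: (@le_trans _ _ (q%:R ^+ i1)); last by rewrite ler_weXn2l ?leq_maxl.
  apply: le_trans B1; rewrite /mobius absCM absCV ler_pM ?invr_ge0 ?absC_ge0 //.
    apply: le_trans (absC_tri _ _) _; rewrite absCM lerD ?ler_wpM2l ?absC_ge0 //.
    by case: zi.
  by rewrite lef_pV2.
move=> x xK; apply: (@le_trans _ _ e).
  rewrite -[e]invrK lef_pV2 ?posrE ?exprn_gt0 ?invr_gt0 //.
  by apply: le_trans B2 _; rewrite ler_weXn2l ?leq_maxr.
pose u := g 0 0 - x * g 1 0; pose v := g 0 1 - x * g 1 1.
have uK : Koo u by apply: KooB => //; apply: KooM.
have vK : Koo v by apply: KooB => //; apply: KooM.
have -> : mobius g z - x = (u * z + v) / autj g z.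
  rewrite /mobius -[X in _ - X](mulfK (x := autj g z)) -?absC_gt0 // -mulrBl.
  by congr (_ / _); rewrite /u /v /autj; ring.
have q2 : 0 < (q%:R : R) ^- (2 * i) by rewrite invr_gt0 exprn_gt0.
rewrite absCM absCV; apply: ler_pM.
- by apply/ltW; rewrite !mulr_gt0 ?invr_gt0 ?exprn_gt0 ?absC_gt0.
- by rewrite invr_ge0 ltW.
- have [h1 h2] := form_lower uK vK zi.
  have DE : D = g 1 1 * u - g 1 0 * v by rewrite /D /u /v; ring.
  rewrite mulrAC ler_pdivrMr // DE.
  have tri := absC_tri (g 1 1 * u) (- (g 1 0 * v)).
  rewrite absCN !absCM in tri.
  apply: (@le_trans _ _ ((absC (g 1 1) * absC u + absC (g 1 0) * absC v) * q%:R ^- (2 * i))).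
    by rewrite ler_wpM2r // ltW.
  rewrite /M mulrDl -!mulrA [leRHS]mulrDr mulr1.
  have l1 := ler_wpM2l (absC_ge0 (g 1 1)) h1.
  have l2 := ler_wpM2l (absC_ge0 (g 1 0)) h2.
  have l3 := absC_ge0 (u * z + v).
  by rewrite mulrDr; lra.
- by rewrite lef_pV2.
Qed.

(* (cX + d)^N P((aX + b)/(cX + d)), as soon as size P <= N. *)
Definition homogenize N (P : {poly C}) g : {poly C} :=
  \sum_(l < N) P`_l *: ((g 0 0 *: 'X + (g 0 1)%:P) ^+ l
                        * (g 1 0 *: 'X + (g 1 1)%:P) ^+ (N - l)).

Lemma homogenizeE N (P : {poly C}) g z : (size P <= N)%N -> autj g z != 0 ->
  (homogenize N P g).[z] = autj g z ^+ N * P.[mobius g z].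
Proof.
move=> sP j0; rewrite horner_sum (horner_coef_wide _ sP) mulr_sumr.
apply: eq_bigr => l _; have linE (u v : C) : (u *: 'X + v%:P).[z] = u * z + v.
  by rewrite !hornerE.
rewrite hornerZ hornerM !horner_exp !linE [RHS]mulrCA -/(autj g z) -(mobiusK j0).
by congr (_ * _); rewrite exprMn -mulrA -exprD subnKC 1?mulrC // ltnW.
Qed.

(** The approximation P / Q is pulled back. Homogenizing P and Q with the same N lets the powers of
    c z + d cancel, and B bounds the automorphy factor on the affinoid. *)
Lemma rigid_slash k m phi g : GL2Koo g -> rigid_analytic phi ->
  rigid_analytic (slash k m phi g).
Proof.
move=> gG phiR i e e0; have [i' gi] := mobius_affinoid i gG.
have [lo [hi [lo0 hi0 jb]]] := autj_bounds i gG.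
pose B := absC (\det g ^ m) / lo ^+ k + 1.
have B0 : 0 < B by rewrite ltr_wpDl // mulr_ge0 ?absC_ge0 // invr_ge0 exprn_ge0 // ltW.
have [|P [Q PQ]] := phiR i' (e / B); first by rewrite divr_gt0.
pose N := maxn (size P) (size Q).
exists (\det g ^ m *: homogenize N P g),
  (homogenize N Q g * (g 1 0 *: 'X + (g 1 1)%:P) ^+ k) => z zi.
have /andP[jlo jhi] := jb z zi.
have j0 : autj g z != 0 by rewrite -absC_gt0 (lt_le_trans lo0).
have [Qz phiz] := PQ _ (gi _ zi).
have jE : (g 1 0 *: 'X + (g 1 1)%:P).[z] = autj g z by rewrite !hornerE.
rewrite hornerZ hornerM !homogenizeE ?leq_maxl ?leq_maxr // horner_exp jE.
split; first by rewrite !mulf_neq0 ?expf_neq0.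
have -> : slash k m phi g z - \det g ^ m * (autj g z ^+ N * P.[mobius g z]) /
     (autj g z ^+ N * Q.[mobius g z] * autj g z ^+ k)
   = (phi (mobius g z) - P.[mobius g z] / Q.[mobius g z]) * (\det g ^ m / autj g z ^+ k).
  by rewrite /slash; field; rewrite Qz ?expf_neq0.
rewrite absCM; move: phiz; rewrite ltr_pdivlMr // => h; apply: le_lt_trans h.
rewrite ler_wpM2l ?absC_ge0 // /B absCM absCV absCX ler_wpDr ?ler01 //.
rewrite ler_wpM2l ?absC_ge0 // lef_pV2 ?posrE ?exprn_gt0 //; last exact: lt_le_trans jlo.
by rewrite lerXn2r // ?nnegrE ?ltW // (lt_le_trans lo0).
Qed.

(** The two expansions share their parameter because limits, and thus the e of [is_expo], are
    unique. *)
Lemma vanishing_expansionD f phi psi :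
  vanishing_expansion f phi -> vanishing_expansion f psi ->
  vanishing_expansion f (fun z => phi z + psi z).
Proof.
move=> [r1 [a1 h1]] [r2 [a2 h2]].
exists (Num.max r1 r2), (fun i => a1 i + a2 i) => z zO zf.
have [|e [ez e0 s1]] := h1 z zO.
  by move=> x /zf; apply: le_trans; rewrite le_max lexx.
have [|e' [ez' _ s2]] := h2 z zO.
  by move=> x /zf; apply: le_trans; rewrite le_max lexx orbT.
exists e; split=> //; rewrite -(cvgC_unique ez ez') in s2.
apply: cvgC_ext (cvgCD s1 s2) => N.
by rewrite -big_split; apply: eq_bigr => i _; rewrite mulrDl.
Qed.

Lemma vanishing_expansionZ f c phi :
  vanishing_expansion f phi -> vanishing_expansion f (fun z => c * phi z).
Proof.
move=> [r [a h]]; exists r, (fun i => c * a i) => z zO zf.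
have [e [ez e0 s]] := h z zO zf; exists e; split=> //.
apply: cvgC_ext (cvgCZ c s) => N.
by rewrite mulr_sumr; apply: eq_bigr => i _; rewrite mulrA.
Qed.

Lemma eq_vanishing_expansion f phi psi : (forall z, Omega z -> phi z = psi z) ->
  vanishing_expansion f phi -> vanishing_expansion f psi.
Proof.
move=> E [r [a h]]; exists r, a => z zO zf.
by have [e [ez e0 s]] := h z zO zf; exists e; rewrite -E.
Qed.

(** The conditions of [cusp_form] other than invariance. All of GL_2(K) preserves them, so the terms
    of a trace can be treated one by one. *)
Definition cuspidal k m phi :=
  [/\ on_Omega phi, rigid_analytic phi & vanishing_at_cusps k m phi].

Lemma cuspidalD k m phi psi : cuspidal k m phi -> cuspidal k m psi ->
  cuspidal k m (fun z => phi z + psi z).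
Proof.
move=> [o1 r1 v1] [o2 r2 v2]; split.
- by move=> z zO; rewrite o1 ?o2 ?addr0.
- exact: rigidD.
move=> g gK; have [f1 f10 h1] := v1 g gK; have [f2 f20 h2] := v2 g gK.
exists (f1 * f2) => [|f f0 fdvd]; first by rewrite mulf_neq0.
have := vanishing_expansionD
  (h1 f f0 (dvdp_trans (dvdp_mulr _ (dvdpp _)) fdvd))
  (h2 f f0 (dvdp_trans (dvdp_mull _ (dvdpp _)) fdvd)).
by apply: eq_vanishing_expansion => z _; rewrite /slash !mulrDl.
Qed.

Lemma cuspidalZ k m c phi : cuspidal k m phi -> cuspidal k m (fun z => c * phi z).
Proof.
move=> [o r v]; split.
- by move=> z zO; rewrite o ?mulr0.
- exact: rigidZ.
move=> g gK; have [f0 f00 h] := v g gK; exists f0 => // f fn fdvd.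
have := vanishing_expansionZ c (h f fn fdvd).
by apply: eq_vanishing_expansion => z _; rewrite /slash !mulrA.
Qed.

Lemma cuspidal_slash k m g phi : GL2K g -> cuspidal k m phi ->
  cuspidal k m (slash k m phi g).
Proof.
move=> gK [o r v]; have gKoo := GL2K_Koo gK; split.
- exact: on_Omega_slash.
- exact: rigid_slash.
move=> h hK; have [f0 f00 H] := v _ (GL2KM gK hK); exists f0 => // f fn fdvd.
apply: eq_vanishing_expansion (H f fn fdvd) => z zO.
by rewrite slashM //; apply: GL2K_Koo.
Qed.

Lemma cuspidal_sum k m (I : Type) (s : seq I) (u : I -> C -> C) phi :
  cuspidal k m phi -> (forall i, cuspidal k m (u i)) ->
  cuspidal k m (fun z => \sum_(i <- s) u i z).
Proof.
move=> phic uc; elim: s => [|i s IH].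
  rewrite (_ : (fun z => _) = fun z => 0 * phi z); first exact: cuspidalZ.
  by apply/funext => z; rewrite big_nil mul0r.
by under eq_fun do rewrite big_cons; apply: cuspidalD.
Qed.

End Cuspidal.

(** * Residues *)

Section RootsOfUnity.

Lemma closed_prim_root (L : closedFieldType) n : (0 < n)%N -> n%:R != 0 :> L ->
  exists w : L, n.-primitive_root w.
Proof.
move=> n0 nL; have [rs rsE] := closed_field_poly_normal ('X^n - 1 : {poly L}).
have lead1 : lead_coef ('X^n - 1 : {poly L}) = 1 by rewrite lead_coefXnsubC.
rewrite lead1 scale1r in rsE.
have urs : uniq rs by rewrite -separable_prod_XsubC -rsE separable_Xn_sub_1.
have : has n.-primitive_root rs.
  apply: has_prim_root => //.
    apply/allP => z zr; have : root ('X^n - 1) z by rewrite rsE root_prod_XsubC.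
    by rewrite rootE !hornerE subr_eq0 => /eqP zn; apply/unity_rootP.
  by have := size_prod_XsubC rs id; rewrite -rsE size_Xn_sub_1 // => -[->].
by case/hasP => w _ wp; exists w.
Qed.

Lemma sum_prim_root (L : fieldType) n (w : L) e : n.-primitive_root w ->
  \sum_(s < n) (w ^+ s) ^+ e = if (n %| e)%N then n%:R else 0.
Proof.
move=> wp; under eq_bigr => s _ do rewrite -exprM mulnC exprM.
rewrite (prim_order_dvd wp); have [->|we] := eqVneq.
  by under eq_bigr do rewrite expr1n; rewrite sumr_const card_ord.
apply: (mulfI (x := w ^+ e - 1)); first by rewrite subr_eq0.
by rewrite mulr0 -subrX1 exprAC (prim_expr_order wp) expr1n subrr.
Qed.

Lemma prim_rootV (L : fieldType) n (w : L) :
  n.-primitive_root w -> n.-primitive_root w^-1.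
Proof.
case/andP=> n0 /forallP wn; apply/andP; split=> //; apply/forallP => i.
by have := wn i; rewrite !unity_rootE exprVn invr_eq1.
Qed.

End RootsOfUnity.

Section Residues.
Variables (R : realType) (Fq : finFieldType) (C : Cinfty R Fq).
Local Notation q := #|Fq|.
Implicit Types (x y z : C) (g h : 'M[C]_2) (f phi psi : C -> C) (a b : nat -> C).

Lemma cvg_series_terms (u : nat -> C) s : cvgC (fun N => \sum_(i < N) u i) s ->
  forall e : R, 0 < e -> exists N, forall i, (N <= i)%N -> absC (u i) < e.
Proof.
move=> us e e0; have [N NP] := us e e0; exists N => i Ni.
have := absCB_lt (NP i.+1 (leqW Ni)) (NP i Ni).
by rewrite opprB addrA subrK big_ord_recr /= addrC addKr.
Qed.

Lemma laurent_ext f f' a b : (forall z, 1 < absC z -> absC z < q%:R -> f z = f' z) ->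
  laurent f a b -> laurent f' a b.
Proof.
by move=> E fl z z1 zq; have [s1 [s2 [? ? s12]]] := fl z z1 zq; exists s1, s2; rewrite -E.
Qed.

Lemma laurentD f f' a b a' b' : laurent f a b -> laurent f' a' b' ->
  laurent (fun z => f z + f' z) (fun i => a i + a' i) (fun i => b i + b' i).
Proof.
move=> fl fl' z z1 zq; have [s1 [s2 [h1 h2 ->]]] := fl z z1 zq.
have [s1' [s2' [h1' h2' ->]]] := fl' z z1 zq.
exists (s1 + s1'), (s2 + s2'); split; last by rewrite addrACA.
  apply: cvgC_ext (cvgCD h1 h1') => N.
  by rewrite -big_split; apply: eq_bigr => i _; rewrite mulrDl.
apply: cvgC_ext (cvgCD h2 h2') => N.
by rewrite -big_split; apply: eq_bigr => i _; rewrite mulrDl.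
Qed.

Lemma laurentZ c f a b : laurent f a b ->
  laurent (fun z => c * f z) (fun i => c * a i) (fun i => c * b i).
Proof.
move=> fl z z1 zq; have [s1 [s2 [h1 h2 ->]]] := fl z z1 zq.
exists (c * s1), (c * s2); split; last by rewrite mulrDr.
  apply: cvgC_ext (cvgCZ c h1) => N.
  by rewrite mulr_sumr; apply: eq_bigr => i _; rewrite mulrA.
apply: cvgC_ext (cvgCZ c h2) => N.
by rewrite mulr_sumr; apply: eq_bigr => i _; rewrite mulrA.
Qed.

Lemma annulus_point : exists z : C, 1 < absC z /\ absC z < q%:R.
Proof.
have /closed_rootP[z] : size ('X^2 - (tC C)%:P : {poly C}) != 1%N by rewrite size_XnsubC.
rewrite rootE !hornerE subr_eq0 => /eqP /(congr1 absC); rewrite absCX absC_t => zq.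
have z0 := absC_ge0 z; have q1 := natq_gt1 R Fq.
exists z; split.
  by rewrite ltNge; apply/negP => z1; move: q1; rewrite -zq ltNge expr_le1 ?z1.
rewrite -zq expr2 ltr_pMr; last first.
  by rewrite lt_def z0 andbT; apply: contraTneq q1 => E; rewrite -zq E expr0n ltr10.
by rewrite ltNge; apply/negP => z1; move: q1; rewrite -zq ltNge expr_le1 ?z1.
Qed.

(* Averaging [z f(z)] over the rotations by the N-th roots of unity leaves only
   every N-th coefficient of the expansion, and all of them but [b_0] are small
   for large N. *)
Lemma laurent0_residue a b : laurent (fun=> 0 : C) a b -> b 0%N = 0.
Proof.
move=> lab; have [z [z1 zq]] := annulus_point.
have z0 : z != 0 by rewrite -absC_gt0 (lt_trans _ z1).
apply/eqP; apply: contraT => b0.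
pose e := absC (b 0%N / z).
have e0 : 0 < e by rewrite absC_gt0 mulf_neq0 ?invr_eq0.
have [s1 [s2 [c1 c2 _]]] := lab z z1 zq.
have [N1 N1P] := cvg_series_terms (u := fun i => a i * z ^+ i) c1 e0.
have [N2 N2P] := cvg_series_terms (u := fun i => b i * z ^- i.+1) c2 e0.
have [p _ pF] := finPcharP Fq.
have pC : p \in [pchar C] by rewrite (fmorph_pchar embC).
(* N is 1 modulo p, so primitive N-th roots of unity exist and the average needs no division; it
   also exceeds the ranks N1 and N2 beyond which terms are small. *)
pose N := (p * (N1 + N2).+1).+1.
have NC : N%:R = 1 :> C by rewrite /N -addn1 natrD natrM pcharf0 // mul0r add0r.
have N_gt : (N1 + N2 < N - 1)%N.
  by rewrite /N subn1 /= leq_pmull // prime_gt0 // (pcharf_prime pF).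
have [w wp] : exists w : C, N.-primitive_root w.
  by apply: closed_prim_root; rewrite // NC oner_eq0.
have absw s : absC (w ^+ s) = 1.
  by rewrite absCX (absC_root1 _ (prim_expr_order wp)) ?expr1n.
have w0 : w != 0 by have := absC_gt0 (w ^+ 1); rewrite absw ltr01 expr1 => <-.
pose S M x := \sum_(i < M) a i * x ^+ i + \sum_(i < M) b i * x ^- i.+1.
have S_small s : exists M0, forall M, (M0 <= M)%N -> absC (S M (w ^+ s * z)) < e.
  have absz : absC (w ^+ s * z) = absC z by rewrite absCM absw mul1r.
  have [||r1 [r2 [d1 d2 d0]]] := lab (w ^+ s * z); rewrite ?absz //.
  have /(_ _ e0)[M0 M0P] := cvgCD d1 d2; exists M0 => M /M0P.
  by rewrite -d0 subr0.
have [M0 M0P] : exists M0, forall s : 'I_N, forall M, (M0 <= M)%N -> absC (S M (w ^+ s * z)) < e.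
  pose m (s : 'I_N) := sval (cid (S_small s)).
  exists (\max_s m s)%N => s M sM.
  exact: (svalP (cid (S_small s))) (leq_trans (leq_bigmax s) sM).
pose M := (maxn M0 N).+1.
have MP s : absC (S M (w ^+ (s : 'I_N) * z)) < e.
  by apply: M0P; rewrite (leq_trans (leq_maxl _ N)).
have avg : absC (\sum_(s < N) w ^+ s * S M (w ^+ s * z)) < e.
  by apply: absC_sum_lt => // s _; rewrite absCM absw mul1r.
have avgE : \sum_(s < N) w ^+ s * S M (w ^+ s * z)
   = \sum_(i < M | (N %| i.+1)%N) a i * z ^+ i + \sum_(i < M | (N %| i)%N) b i * z ^- i.+1.
  rewrite /S; under eq_bigr do rewrite mulrDr !mulr_sumr.
  rewrite big_split; congr (_ + _); rewrite exchange_big [RHS]big_mkcond /=.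
    apply: eq_bigr => i _.
    have E s : w ^+ s * (a i * (w ^+ s * z) ^+ i) = (w ^+ s) ^+ i.+1 * (a i * z ^+ i).
      by rewrite exprMn exprS; ring.
    under eq_bigr do rewrite E.
    rewrite -mulr_suml (sum_prim_root _ wp).
    by case: ifP => _; rewrite ?NC ?mul1r ?mul0r.
  apply: eq_bigr => i _.
  have E s : w ^+ s * (b i * (w ^+ s * z) ^- i.+1) = (w^-1 ^+ s) ^+ i * (b i * z ^- i.+1).
    by rewrite exprVn exprVn exprMn !exprS; field; rewrite z0 !expf_neq0.
  under eq_bigr do rewrite E; rewrite -mulr_suml.
  rewrite (sum_prim_root _ (prim_rootV wp)).
  by case: ifP => _; rewrite ?NC ?mul1r ?mul0r.
have tail : absC (\sum_(i < M | (N %| i.+1)%N) a i * z ^+ i +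
     \sum_(i < M | (N %| i)%N && (i != ord0)) b i * z ^- i.+1) < e.
  apply: absCD_lt; apply: absC_sum_lt => // i.
    move=> /(dvdn_leq (ltn0Sn _)) Ni; apply: N1P.
    by rewrite -ltnS (leq_trans _ Ni) //; move: N_gt; clear; lia.
  case/andP => Ni i0; apply: N2P.
  have i_gt0 : (0 < i)%N by rewrite lt0n; apply: contra i0 => /eqP i0; apply/eqP/val_inj.
  by have := dvdn_leq i_gt0 Ni; move: N_gt; clear; lia.
(* The average is b_0 / z plus the tail; the average and the tail are both smaller than e = |b_0 /
   z|. *)
move: avg; rewrite avgE [X in _ + X](bigD1 ord0) //= expr1 addrCA => avg.
have := absCB_lt avg tail.
by rewrite addrK ltxx.
Qed.

Lemma is_residue_unique f f' r r' :
  (forall z, 1 < absC z -> absC z < q%:R -> f z = f' z) ->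
  is_residue f r -> is_residue f' r' -> r = r'.
Proof.
move=> E [a [b [fl ->]]] [a' [b' [fl' ->]]].
apply/eqP; rewrite -subr_eq0 -mulN1r; apply/eqP.
have := laurentD fl (laurentZ (-1) fl') => h.
apply: (@laurent0_residue (fun i => a i + -1 * a' i) (fun i => b i + -1 * b' i)).
by apply: laurent_ext h => z z1 zq; rewrite E // mulN1r subrr.
Qed.

Lemma is_residue_ext f f' r : (forall z, 1 < absC z -> absC z < q%:R -> f z = f' z) ->
  is_residue f r -> is_residue f' r.
Proof. by move=> E [a [b [fl ->]]]; exists a, b; split=> //; apply: laurent_ext fl. Qed.

Lemma is_residueD f f' r r' : is_residue f r -> is_residue f' r' ->
  is_residue (fun z => f z + f' z) (r + r').
Proof.
move=> [a [b [fl ->]]] [a' [b' [fl' ->]]].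
by exists (fun i => a i + a' i), (fun i => b i + b' i); split=> //; apply: laurentD.
Qed.

Lemma is_residueZ c f r : is_residue f r -> is_residue (fun z => c * f z) (c * r).
Proof.
move=> [a [b [fl ->]]].
by exists (fun i => c * a i), (fun i => c * b i); split=> //; apply: laurentZ.
Qed.

Lemma is_residue0 : is_residue (fun=> 0 : C) 0.
Proof.
exists (fun=> 0), (fun=> 0); split=> // z _ _; exists 0, 0; split; rewrite ?addr0 //.
  by apply: cvgC_ext (cvgC_cst 0) => N; rewrite big1 // => i _; rewrite mul0r.
by apply: cvgC_ext (cvgC_cst 0) => N; rewrite big1 // => i _; rewrite mul0r.
Qed.

Lemma is_residue_sum (I : Type) (s : seq I) (u : I -> C -> C) (r : I -> C) :
  (forall i, is_residue (u i) (r i)) ->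
  is_residue (fun z => \sum_(i <- s) u i z) (\sum_(i <- s) r i).
Proof.
move=> ur; elim: s => [|i s IH].
  by rewrite big_nil; apply: is_residue_ext is_residue0 => z _ _; rewrite big_nil.
rewrite big_cons; apply: is_residue_ext (is_residueD (ur i) IH) => z _ _.
by rewrite big_cons.
Qed.

Definition integrand phi g (l : nat) : C -> C :=
  fun w => mobius g w ^+ l * phi (mobius g w) * (\det g * autj g w ^- 2).

Definition residues k phi g (v : 'rV[C]_k.-1) :=
  forall l : 'I_k.-1, is_residue (integrand phi g l) (v 0 l).

Lemma residues_unique k phi g (v v' : 'rV[C]_k.-1) :
  residues phi g v -> residues phi g v' -> v = v'.
Proof.
move=> pv pv'; apply/matrixP => i l; rewrite ord1.
by apply: is_residue_unique (pv l) (pv' l).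
Qed.

Lemma residuesD k phi psi g (v v' : 'rV[C]_k.-1) :
  residues phi g v -> residues psi g v' ->
  residues (fun z => phi z + psi z) g (v + v').
Proof.
move=> pv pv' l; rewrite mxE; apply: is_residue_ext (is_residueD (pv l) (pv' l)) => z _ _.
by rewrite /integrand -mulrDl -mulrDr.
Qed.

Lemma residuesZ k c phi g (v : 'rV[C]_k.-1) :
  residues phi g v -> residues (fun z => c * phi z) g (c *: v).
Proof.
move=> pv l; rewrite mxE; apply: is_residue_ext (is_residueZ c (pv l)) => z _ _.
by rewrite /integrand !mulrA [c * _]mulrC.
Qed.

Lemma residues_sum k (I : Type) (s : seq I) (u : I -> C -> C) g (v : I -> 'rV[C]_k.-1) :
  (forall i, residues (u i) g (v i)) ->
  residues (fun z => \sum_(i <- s) u i z) g (\sum_(i <- s) v i).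
Proof.
move=> uv l; rewrite summxE.
apply: is_residue_ext (is_residue_sum s (fun i => uv i l)) => z _ _.
by rewrite /integrand mulr_sumr mulr_suml.
Qed.

(** Substitution u = h z, with J = c z + d. As z = h^-1 u, the polynomial [Q] takes the value z^i
    J^(2-k) at u; together with du = det h J^-2 dz this produces the weight k, and a power of det h
    is left over. *)
Lemma residues_slash k m phi g h (v : 'rV[C]_k.-1) : (2 <= k)%N ->
  GL2Koo g -> GL2Koo h -> residues phi (h *m g) v ->
  residues (slash k m phi h) g (dual_act m (invmx h) v).
Proof.
move=> k2 gK hK pv i; rewrite mxE; case: (hK) => _ hu.
set Q : {poly C} := _ ^+ i * _.
have := is_residueZ (\det (invmx h) ^ (1 - m))
  (is_residue_sum (index_enum 'I_k.-1) (fun l => is_residueZ Q`_l (pv l))).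
apply: is_residue_ext => w w1 wq; have wO := annulus_Omega w1 wq.
rewrite /integrand mobiusM ?autjM ?autj_neq0 //.
have j0 := autj_neq0 gK wO.
have zO := Omega_mobius gK wO; set z := mobius g w in zO *.
have jh0 := autj_neq0 hK zO; set u := mobius h z; set J := autj h z in jh0 *.
have hVK : invmx h *m h = 1%:M by rewrite mulVmx.
have jV : autj (invmx h) u = J^-1.
  apply: (mulIf jh0); rewrite mulVf // /u /J -autjM // hVK /autj !mxE /=.
  by rewrite mul0r add0r.
have mV : mobius (invmx h) u = z.
  by rewrite /u -mobiusM // hVK /mobius /autj !mxE /= mulr0n !mul0r mul1r addr0 add0r divr1.
have numV : invmx h 0 0 * u + invmx h 0 1 = z * J^-1.
  by rewrite -jV -mV mobiusK // jV invr_neq0.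
have sQ : (size Q <= k.-1)%N.
  have le2 (x y : C) e : (size ((x *: 'X + y%:P) ^+ e) <= e.+1)%N.
    apply: leq_trans (size_poly_exp_leq _ _) _; rewrite ltnS -[leqRHS]mul1n leq_mul2r.
    rewrite -subn1 leq_subLR (leq_trans (size_polyD _ _)) ?orbT // geq_max size_polyC.
    by rewrite (leq_trans (size_scale_leq _ _)) ?size_polyX //; case: eqP.
  apply: leq_trans (size_polyMleq _ _) _.
  rewrite -subn1 leq_subLR (leq_trans (leq_add (le2 _ _ _) (le2 _ _ _))) //.
  by have := ltn_ord i; lia.
have Qu : Q.[u] = z ^+ i * J ^- (k - 2).
  have linE (x y : C) : (x *: 'X + y%:P).[u] = x * u + y by rewrite !hornerE.
  rewrite hornerM !horner_exp !linE numV -/(autj (invmx h) u) jV exprMn -mulrA.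
  rewrite -exprD subnKC ?exprVn //.
  by have := ltn_ord i; lia.
under eq_bigr do rewrite -!mulrA mulrA.
rewrite -mulr_suml -(horner_coef_wide _ sQ) Qu /slash det_inv.
rewrite exprz_inv opprB expfzDr; last by rewrite -unitmx2.
have -> : autj h z ^- k = J ^- (k - 2) * J ^- 2 by rewrite -invfM -exprD subnK.
rewrite exprN1 det_mulmx -/u; move: (\det h ^ m) => dm.
have d0 : \det h != 0 by rewrite -unitmx2.
by field; rewrite d0 jh0 j0 expf_neq0.
Qed.

End Residues.

(** * Congruence subgroups and the trace *)

Lemma invmx_left (L : comUnitRingType) n (g h : 'M[L]_n) : h *m g = 1%:M -> invmx g = h.
Proof.
move=> hg; have gu : g \in unitmx by case/mulmx1_unit: hg.
by rewrite -[LHS]mul1mx -hg mulmxK.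
Qed.

Lemma coef_linear_exp (L : comNzRingType) (x y : L) N l :
  ((x *: 'X + y%:P) ^+ N)`_l = 'C(N, l)%:R * x ^+ l * y ^+ (N - l).
Proof.
rewrite addrC exprDn coef_sum.
have E (i : nat) : (y%:P ^+ (N - i) * (x *: 'X) ^+ i *+ 'C(N, i) : {poly L})`_l
    = (l == i)%:R * ('C(N, i)%:R * x ^+ i * y ^+ (N - i)).
  rewrite coefMn exprZn -scalerAr coefZ -rmorphXn /= mul_polyC coefZ coefXn -mulr_natr.
  by ring.
under eq_bigr => i _ do rewrite E.
case: (ltnP l N.+1) => [lN|Nl].
  rewrite (bigD1 (Ordinal lN)) //= eqxx mul1r big1 ?addr0 // => i /negPf.
  by rewrite -val_eqE /= eq_sym => ->; rewrite mul0r.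
rewrite bin_small // !mul0r big1 // => i _; have := ltn_ord i.
by case: eqP => [<-|]; rewrite ?mul0r // ltnNge Nl.
Qed.

Section DualAction.
Variables (R : realType) (Fq : finFieldType) (C : Cinfty R Fq) (k : nat) (m : int).
Implicit Types (w : 'rV[C]_k.-1) (i : 'I_k.-1).

Lemma dual_act_lower (a c d : C) w i : dual_act m (mx2 a 0 c d) w 0 i
  = (a * d) ^ (1 - m) * \sum_(l < k.-1) (if (l < i)%N then 0 else
     a ^+ i * ('C(k - 2 - i, l - i)%:R * c ^+ (l - i) * d ^+ (k - 2 - i - (l - i)))) * w 0 l.
Proof.
rewrite mxE det_mx2E mul0r subr0 !mx2E; congr (_ * _); apply: eq_bigr => l _; congr (_ * _).
rewrite addr0 exprZn -scalerAl coefZ coefXnM coef_linear_exp.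
by case: ifP => _; rewrite ?mulr0.
Qed.

Lemma dual_act_diag (a d : C) w i : dual_act m (mx2 a 0 0 d) w 0 i
  = (a * d) ^ (1 - m) * (a ^+ i * d ^+ (k - 2 - i) * w 0 i).
Proof.
rewrite dual_act_lower (bigD1 i) //= ltnn subnn bin0 expr0 subn0 !mul1r big1 ?addr0 //.
move=> l /negPf li; case: ltnP => il; first by rewrite mul0r.
have : (i < l)%N by rewrite ltn_neqAle il eq_sym val_eqE li.
by rewrite -subn_gt0 => l0; rewrite expr0n eqn0Ngt l0 mulr0 mul0r mulr0 mul0r.
Qed.

Lemma dual_act_upper (x : C) w i : dual_act m (mx2 1 x 0 1) w 0 i
  = \sum_(l < k.-1) 'C(i, l)%:R * x ^+ (i - l) * w 0 l.
Proof.
rewrite mxE det_mx2E mulr0 subr0 mulr1 exp1rz mul1r !mx2E.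
apply: eq_bigr => l _; congr (_ * _).
by rewrite scale0r add0r expr1n mulr1 coef_linear_exp expr1n mulr1.
Qed.

Lemma dual_act_antidiag (b c : C) w i i' : (i + i' = k - 2)%N ->
  dual_act m (mx2 0 b c 0) w 0 i
  = (- (b * c)) ^ (1 - m) * (b ^+ i * c ^+ i' * w 0 i').
Proof.
move=> ii'; rewrite mxE det_mx2E mul0r sub0r !mx2E; congr (_ * _).
have -> : (k - 2 - i = i')%N by rewrite -ii' addKn.
rewrite scale0r add0r addr0 exprZn -rmorphXn /= mul_polyC.
rewrite (bigD1 i') //= big1 ?addr0 => [|l /negPf li].
  by rewrite !coefZ coefXn eqxx mulr1.
by rewrite !coefZ coefXn val_eqE li !mulr0 mul0r.
Qed.

End DualAction.

Section Groups.
Variables (Fq : finFieldType).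
Implicit Types (g h s : 'M[{poly Fq}]_2).

Lemma dvdX (p : {poly Fq}) : ('X %| p) = (p.[0] == 0).
Proof. by rewrite -['X]subr0 dvdp_XsubCl. Qed.

Lemma polyX_divK (p : {poly Fq}) : p.[0] == 0 -> exists p', p = 'X * p'.
Proof. by rewrite -dvdX => /dvdpP[p' ->]; exists p'; rewrite mulrC. Qed.

Lemma Gamma0E g : Gamma0 g = (g \in unitmx) && ((g 1 0).[0] == 0).
Proof. by rewrite /Gamma0 dvdX. Qed.

Lemma Gamma1E g : Gamma1 g = [&& g \in unitmx, (g 1 0).[0] == 0,
  (g 0 0).[0] == 1 & (g 1 1).[0] == 1].
Proof.
rewrite /Gamma1 Gamma0E !dvdX !hornerE.
by rewrite !subr_eq0.
Qed.

Lemma Gamma1_Gamma0 g : Gamma1 g -> Gamma0 g.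
Proof. by case/and3P. Qed.

Lemma Gamma0_GL2A g : Gamma0 g -> GL2A g.
Proof. by case/andP. Qed.

Lemma unit_mx2A (a b c d : {poly Fq}) :
  (mx2 a b c d \in unitmx) = (a * d - b * c \is a GRing.unit).
Proof. by rewrite unitmxE det_mx2E. Qed.

Lemma mx2_eta (S : comPzRingType) (g : 'M[S]_2) : g = mx2 (g 0 0) (g 0 1) (g 1 0) (g 1 1).
Proof. by apply: eq_mx2; rewrite mx2E. Qed.

Lemma polyC_unit (c : Fq) : (c%:P \is a GRing.unit) = (c != 0).
Proof. by rewrite poly_unitE coefC unitfE size_polyC /=; case: (c == 0). Qed.

(** At 0 the determinant is the product of the diagonal entries, so these are nonzero constants
    there, by which the rows can be divided. *)
Lemma Gamma0_diag g : Gamma0 g -> exists a d h, [/\ a != 0, d != 0, Gamma1 h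
  & g = mx2 a%:P 0 0 d%:P *m h].
Proof.
rewrite Gamma0E => /andP[gu /eqP g10].
have det0 : (\det g).[0] != 0.
  move: gu; rewrite unitmxE poly_unitE -horner_coef0 unitfE => /andP[_]; exact.
move: det0; rewrite det_mx2 !hornerE g10 mulr0 subr0 mulf_eq0 negb_or => /andP[a0 d0].
set a := (g 0 0).[0] in a0; set d := (g 1 1).[0] in d0.
exists a, d, (mx2 (a^-1 *: g 0 0) (a^-1 *: g 0 1) (d^-1 *: g 1 0) (d^-1 *: g 1 1)).
split=> //.
  rewrite Gamma1E !mx2E !hornerZ g10 mulr0 -/a -/d !mulVf // !eqxx !andbT.
  rewrite unit_mx2A -!scalerAl -!scalerAr !scalerA [_^-1 * _]mulrC -scalerBr -det_mx2.
  by rewrite -mul_polyC unitrM polyC_unit mulf_neq0 ?invr_eq0 //= -unitmxE.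
apply: eq_mx2; rewrite mulmx2E !mx2E !mul0r ?addr0 ?add0r mul_polyC scalerA divff //;
  by rewrite scale1r.
Qed.

Lemma Gamma1_conj_diag a d g : a != 0 -> d != 0 -> Gamma1 g ->
  exists2 g', Gamma1 g' & mx2 a%:P 0 0 d%:P *m g = g' *m mx2 a%:P 0 0 d%:P.
Proof.
move=> a0 d0; rewrite Gamma1E => /and4P[gu /eqP g10 g00 g11].
exists (mx2 (g 0 0) ((a / d) *: g 0 1) ((d / a) *: g 1 0) (g 1 1)).
  rewrite Gamma1E !mx2E g00 g11 !hornerZ g10 mulr0 eqxx !andbT.
  rewrite unit_mx2A -scalerAl -scalerAr scalerA -invf_div mulVf ?mulf_neq0 ?invr_eq0 //.
  by rewrite scale1r -det_mx2 -unitmxE.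
apply: eq_mx2; rewrite !mulmx2E !mx2E !(mul0r, mulr0, addr0, add0r) !mul_polyC.
- by rewrite mulrC mul_polyC.
- by rewrite mulrC mul_polyC scalerA mulrC divfK.
- by rewrite mulrC mul_polyC scalerA mulrC divfK.
- by rewrite mulrC mul_polyC.
Qed.

Lemma Gamma0_conj_Fricke g : Gamma0 g ->
  exists2 g', Gamma0 g' & mx2 0 (-1) 'X 0 *m g = g' *m mx2 0 (-1) 'X 0.
Proof.
rewrite Gamma0E => /andP[gu g10]; have [c cE] := polyX_divK g10.
exists (mx2 (g 1 1) (- c) (- ('X * g 0 1)) (g 0 0)).
  rewrite Gamma0E unit_mx2A !mx2E hornerN hornerM hornerX mul0r oppr0 eqxx andbT.
  have -> : g 1 1 * g 0 0 - - c * - ('X * g 0 1) = g 0 0 * g 1 1 - g 0 1 * g 1 0.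
    by rewrite cE; ring.
  by rewrite -det_mx2 -unitmxE.
apply: eq_mx2; rewrite !mulmx2E !mx2E ?cE; ring.
Qed.

End Groups.

Lemma big_option (V : nmodType) (I : finType) (u : option I -> V) :
  \sum_o u o = u None + \sum_i u (Some i).
Proof.
rewrite (bigD1 None) //=; congr (_ + _).
rewrite (reindex_omap Some id) /=; last by case.
by apply: eq_bigl => i; rewrite eqxx.
Qed.

Section BottomRows.
Variable (F : fieldType).

(* The classes of B \ GL_2(F), for B the upper triangular matrices, are the lines
   spanned by the bottom rows; the line of (0,1) is [None], that of (1,b) is
   [Some b]. *)
Definition row_class (w : 'rV[F]_2) : option F :=
  if w 0 0 == 0 then None else Some (w 0 1 / w 0 0).
Definition class_row (o : option F) : 'rV[F]_2 :=
  \row_i if o is Some b then (if i == 0 then 1 else b) else (i != 0)%:R.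

Lemma class_rowK : cancel class_row row_class.
Proof.
case=> [b|]; rewrite /row_class !mxE /= ?eqxx //.
by rewrite oner_eq0 divr1.
Qed.

Lemma row_classZ l w : l != 0 -> row_class (l *: w) = row_class w.
Proof.
move=> l0; rewrite /row_class !mxE mulf_eq0 (negPf l0) /=.
by case: eqVneq => // w0; rewrite -mulf_div divff // mul1r.
Qed.

Lemma row_class_scale w : w != 0 -> exists2 l, l != 0 & w = l *: class_row (row_class w).
Proof.
rewrite /row_class; have [w0 wn|w0 _] := eqVneq (w 0 0) 0.
  exists (w 0 1).
    apply: contraNneq wn => w1; apply/eqP/matrixP => i; rewrite ord1.
    by apply: forall_I2; rewrite mxE.
  by apply/matrixP => i; rewrite ord1; apply: forall_I2; rewrite !mxE /= ?mulr0 ?mulr1.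
exists (w 0 0) => //; apply/matrixP => i; rewrite ord1.
by apply: forall_I2; rewrite !mxE /= ?mulr1 // mulrC divfK.
Qed.

(** This permutation of the cosets reindexes the trace. *)
Lemma row_class_inj (g : 'M[F]_2) : g \in unitmx ->
  injective (fun o => row_class (class_row o *m g)).
Proof.
move=> gu o1 o2 E.
have nz o : class_row o *m g != 0.
  apply: contraTneq isT => /(congr1 (mulmxr (invmx g))).
  rewrite /= mulmxK // mul0mx => /matrixP E'.
  by case: o E' => [b|] /(_ 0) E'; [have := E' 0 | have := E' 1];
    rewrite !mxE /= => /eqP; rewrite oner_eq0.
have [l1 l10 E1] := row_class_scale (nz o1); have [l2 l20 E2] := row_class_scale (nz o2).
have {}E : class_row o1 = (l1 / l2) *: class_row o2.
  have h1 := congr1 (mulmxr (invmx g)) E1; have h2 := congr1 (mulmxr (invmx g)) E2.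
  move: h1 h2; rewrite /= !mulmxK // E -!scalemxAl; move: (_ *m invmx g) => X -> ->.
  by rewrite scalerA divfK.
by rewrite -[o1]class_rowK E row_classZ ?class_rowK // mulf_neq0 ?invr_eq0.
Qed.

End BottomRows.

Section Trace.
Variables (R : realType) (Fq : finFieldType) (C : Cinfty R Fq) (k : nat) (m : int).
Local Notation q := #|Fq|.
Local Notation t := (tC C).
Local Notation slash := (slash k m).
Implicit Types (phi psi : C -> C) (s : 'M[{poly Fq}]_2).

Lemma mxA_mx2 (a b c d : {poly Fq}) :
  mxA C (mx2 a b c d) = mx2 (evalA C a) (evalA C b) (evalA C c) (evalA C d).
Proof. by apply: eq_mx2; rewrite mxE !mx2E. Qed.

Lemma cusp_formP (G : pred 'M[{poly Fq}]_2) phi : cusp_form G k m phi <->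
  cuspidal k m phi /\ forall s, G s -> slash phi (mxA C s) = phi.
Proof.
split=> [[o r inv v]|[[o r v] inv]]; first by split=> // s sG; apply/funext/inv.
by split=> // s sG z; rewrite inv.
Qed.

Lemma cusp_form_sub (G G' : pred 'M[{poly Fq}]_2) phi : (forall s, G' s -> G s) ->
  cusp_form G k m phi -> cusp_form G' k m phi.
Proof. by move=> GG' [o r inv v]; split=> // s /GG'; apply: inv. Qed.

Lemma cusp_form_slash (G G' : pred 'M[{poly Fq}]_2) (h : 'M[C]_2) phi :
  GL2K h -> (forall s, G s -> s \in unitmx) ->
  (forall s, G' s -> s \in unitmx) ->
  (forall s, G' s -> exists2 s', G s' & h *m mxA C s = mxA C s' *m h) ->
  cusp_form G k m phi -> cusp_form G' k m (slash phi h).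
Proof.
move=> hK Gu G'u conj /cusp_formP[phic inv]; have [phiO _ _] := phic.
apply/cusp_formP; split; first exact: cuspidal_slash.
move=> s sG; have [s' s'G E] := conj s sG.
have sK := GL2K_Koo (GL2K_mxA C (G'u s sG)).
have s'K := GL2K_Koo (GL2K_mxA C (Gu s' s'G)).
have hKoo := GL2K_Koo hK.
by rewrite slashM_fun // E -slashM_fun // inv.
Qed.

Definition coset_rep (o : option Fq) : 'M[{poly Fq}]_2 :=
  if o is Some b then mx2 0 (-1) 1 b%:P else 1%:M.

Lemma coset_rep_unit o : coset_rep o \in unitmx.
Proof.
case: o => [b|]; rewrite /= ?unitmx1 // unit_mx2A mul0r mulr1 sub0r opprK.
exact: unitr1.
Qed.

Lemma traceE phi : trace k m phi = fun z => \sum_o slash phi (mxA C (coset_rep o)) z.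
Proof.
apply/funext => z; rewrite big_option /trace /= /mxA map_mx1; congr (_ + _).
apply: eq_bigr => b _; rewrite -/(mxA _ _) mxA_mx2 rmorph0 rmorph1 evalAC.
by rewrite rmorphN rmorph1.
Qed.

(** The coset of a matrix modulo [Gamma0] is read off from its bottom row at 0, which is
    [class_row o] for [coset_rep o]. *)
Lemma coset_rep_mul s o : s \in unitmx ->
  exists2 s', Gamma0 s' & coset_rep o *m s = s' *m coset_rep
    (row_class (class_row o *m map_mx (horner_eval 0) s)).
Proof.
move=> su; set w := class_row o *m map_mx (horner_eval 0) s; set o' := row_class w.
have repV_unit : invmx (coset_rep o') \in unitmx by rewrite unitmx_inv coset_rep_unit.
exists (coset_rep o *m s *m invmx (coset_rep o')); last by rewrite mulmxKV ?coset_rep_unit.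
rewrite Gamma0E !unitmx_mul coset_rep_unit su repV_unit /=.
have wE i : ((coset_rep o *m s) 1 i).[0] = w 0 i.
  rewrite /w mulmx2E !mxE sum_I2 !mxE /horner_eval /=.
  case: (o) => [b|]; rewrite /= ?mx2E ?mxE /= hornerD !hornerM //=.
    by rewrite !hornerC.
  by rewrite mulr0n mulr1n !hornerC.
rewrite mulmx2E hornerD !hornerM !wE /o' /row_class; case: (eqVneq (w 0 0) 0) => [w0|w0].
  by rewrite /= invmx1 w0 mul0r add0r [1%:M 1 0]mxE /= mulr0n hornerC mulr0.
rewrite /= (@invmx_left _ _ _ (mx2 (w 0 1 / w 0 0)%:P 1 (-1) 0)).
  by rewrite !mx2E hornerN !hornerC mulrC divfK // mulrN1 subrr.
by apply: eq_mx2; rewrite mulmx2E !mx2E !mxE /=; ring.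
Qed.

Lemma slash_sum (I : Type) (r : seq I) (u : I -> C -> C) (g : 'M[C]_2) :
  slash (fun z => \sum_(i <- r) u i z) g = fun z => \sum_(i <- r) slash (u i) g z.
Proof. by apply/funext => z; rewrite /Defs.slash !mulr_suml. Qed.

Lemma cusp_form_trace phi : cusp_form (@Gamma0 Fq) k m phi ->
  cusp_form (@GL2A Fq) k m (trace k m phi).
Proof.
move=> /cusp_formP[phic inv]; have [phiO _ _] := phic.
have repK o := GL2K_mxA C (coset_rep_unit o).
apply/cusp_formP; split.
  rewrite traceE; apply: (cuspidal_sum _ phic) => o.
  exact: cuspidal_slash.
move=> s su; have sK := GL2K_mxA C su.
have su0 : map_mx (horner_eval 0) s \in unitmx.
  by move: su; rewrite /GL2A !unitmxE det_map_mx => su; apply: rmorph_unit.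
rewrite traceE slash_sum; apply/funext => z.
rewrite [RHS](reindex_inj (row_class_inj su0)) /=; apply: eq_bigr => o _.
have [s' s'G E] := coset_rep_mul o su.
have s'u := Gamma0_GL2A s'G; have s'K := GL2K_Koo (GL2K_mxA C s'u).
rewrite (slashM_fun k m (GL2K_Koo (repK o)) (GL2K_Koo sK) phiO) -mxAM E mxAM.
by rewrite -(slashM_fun k m s'K (GL2K_Koo (repK _)) phiO) inv.
Qed.

Lemma trace_GL2A phi : q%:R = 0 :> C -> cusp_form (@GL2A Fq) k m phi ->
  trace k m phi = phi.
Proof.
move=> q0 /cusp_formP[phic inv]; rewrite traceE; apply/funext => z.
under eq_bigr => o _ do rewrite inv ?[GL2A _]coset_rep_unit //.
by rewrite sumr_const card_option mulrS -mulr_natl q0 mul0r addr0.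
Qed.

(** (0,-1;t,0) = (0,-1;1,0) (t,0;0,1), and the first factor leaves phi invariant. *)
Lemma deltat_fricke phi : cusp_form (@GL2A Fq) k m phi -> deltat m phi = fricke k m phi.
Proof.
move=> /cusp_formP[phic inv]; apply/funext => z.
have /inv/(congr1 (fun f => f (t * z))) : GL2A (mx2 0 (-1) 1 0 : 'M[{poly Fq}]_2).
  by rewrite /GL2A unit_mx2A mul0r mulr1 sub0r opprK unitr1.
rewrite /deltat /fricke mxA_mx2 !(rmorph0, rmorphN, rmorph1) /Defs.slash.
rewrite /mobius /autj !det_mx2E !mx2E !mul0r !mul1r !sub0r !mulN1r !opprK !addr0.
by rewrite exp1rz mulr1 => <-; rewrite mulrA [t ^ m * _]mulrC.
Qed.

Lemma GL2K_fricke : GL2K (mx2 0 (-1) t 0).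
Proof.
have rt : ratK t by rewrite -evalAX; apply: ratK_evalA.
have r0 : ratK (0 : C) by rewrite -(rmorph0 (evalA C)); apply: ratK_evalA.
have r1 : ratK (1 : C) by rewrite -(rmorph1 (evalA C)); apply: ratK_evalA.
apply: GL2K_mx2 => //; first exact: ratKN.
by rewrite mul0r sub0r mulN1r opprK tC_neq0.
Qed.

Lemma fricke_conj s : Gamma0 s -> exists2 s', Gamma0 s' &
  mx2 0 (-1) t 0 *m mxA C s = mxA C s' *m mx2 0 (-1) t 0.
Proof.
case/Gamma0_conj_Fricke => s' s'0 E; exists s' => //.
have <- : mxA C (mx2 0 (-1) 'X 0) = mx2 0 (-1) t 0.
  by rewrite mxA_mx2 rmorphN rmorph0 rmorph1 /= evalAX.
by rewrite -!mxAM E.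
Qed.

Lemma cusp_form_fricke phi : cusp_form (@Gamma0 Fq) k m phi ->
  cusp_form (@Gamma0 Fq) k m (fricke k m phi).
Proof.
apply: cusp_form_slash GL2K_fricke _ _ _ => [s /Gamma0_GL2A //|s /Gamma0_GL2A //|s].
exact: fricke_conj.
Qed.

End Trace.

(** * Coordinates of cusp forms *)

Section Identified.
Variables (R : realType) (Fq : finFieldType) (C : Cinfty R Fq) (n : nat).
Variable (e : 'I_n -> C -> C).
Hypothesis e_free : forall x, lincomb e x =1 (fun=> 0) -> x = 0.
Implicit Types (W : {vspace 'cV[C]_n}) (U : (C -> C) -> Prop).

Lemma lincomb_linear (I : finType) (y : I -> 'cV[C]_n) (a : I -> C) z :
  lincomb e (\sum_i a i *: y i) z = \sum_i a i * lincomb e (y i) z.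
Proof.
rewrite /lincomb; under [RHS]eq_bigr do rewrite mulr_sumr.
rewrite exchange_big; apply: eq_bigr => b _; rewrite summxE mulr_suml.
by apply: eq_bigr => i _; rewrite mxE mulrA.
Qed.

Lemma lincombDE x y z : lincomb e (x + y) z = lincomb e x z + lincomb e y z.
Proof. by rewrite /lincomb -big_split; apply: eq_bigr => b _; rewrite mxE mulrDl. Qed.

Lemma lincombBE x y z : lincomb e (x - y) z = lincomb e x z - lincomb e y z.
Proof. by rewrite /lincomb -sumrB; apply: eq_bigr => b _; rewrite !mxE mulrBl. Qed.

Lemma lincomb_free x y : lincomb e x =1 lincomb e y -> x = y.
Proof.
move=> E; apply/eqP; rewrite -subr_eq0; apply/eqP/e_free => z.
by rewrite lincombBE E subrr.
Qed.

Lemma identified_direct_sum U U1 U2 W1 W2 :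
  (forall phi, U phi <-> exists x, phi =1 lincomb e x) ->
  identified e U1 W1 -> identified e U2 W2 ->
  (W1 :&: W2 = 0)%VS -> (W1 + W2)%VS = fullv -> is_direct_sum U U1 U2.
Proof.
move=> US U1W U2W W12 Wfull; split=> [phi|phi].
  split=> [/US[x xE]|[phi1 [phi2 [/U1W[x _ xE] /U2W[y _ yE] E]]]].
    have /memv_addP[y yW [z zW xyz]] : x \in (W1 + W2)%VS by rewrite Wfull memvf.
    exists (lincomb e y), (lincomb e z); split; first by apply/U1W; exists y.
      by apply/U2W; exists z.
    by move=> w; rewrite xE xyz lincombDE.
  by apply/US; exists (x + y) => w; rewrite E xE yE lincombDE.
move=> /U1W[x xW xE] /U2W[y yW yE] z.
have xy : x = y by apply: lincomb_free => w; rewrite -xE yE.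
have : x \in (W1 :&: W2)%VS by rewrite memv_cap xW xy.
rewrite W12 memv0 xE => /eqP ->.
by rewrite /lincomb big1 // => b _; rewrite mxE mul0r.
Qed.

Lemma identified_has_dim U W : identified e U W -> has_dim U (\dim W).
Proof.
move=> UW; exists (fun i => lincomb e (vbasis W)`_i); split=> [phi|x].
  split=> [/UW[y yW yE]|[x xE]].
    exists (\col_i coord (vbasis W) i y) => z; rewrite yE {1}(coord_vbasis yW).
    by rewrite lincomb_linear; apply: eq_bigr => i _; rewrite mxE.
  apply/UW; exists (\sum_i x i 0 *: (vbasis W)`_i).
    by apply: memv_suml => i _; rewrite memvZ // vbasis_mem // mem_nth ?size_tuple.
  by move=> z; rewrite xE lincomb_linear.
move=> x0; have E : \sum_i x i 0 *: (vbasis W)`_i = 0.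
  by apply: e_free => z; rewrite lincomb_linear; apply: x0.
apply/matrixP => i i'; rewrite ord1 mxE.
by have /freeP/(_ (fun i => x i 0)) := basis_free (vbasisP W); apply.
Qed.

Lemma has_dim_identified U W d : identified e U W -> has_dim U d -> (\dim W <= d)%N.
Proof.
move=> UW [f [fU ffree]].
have fW i : exists2 x, x \in W & f i =1 lincomb e x.
  apply/UW/fU; exists (delta_mx i 0) => z; rewrite /lincomb (bigD1 i) //= mxE !eqxx mul1r.
  by rewrite big1 ?addr0 // => i' /negPf ii'; rewrite mxE ii' mul0r.
pose y i := s2val (cid2 (fW i)).
have yE i : f i =1 lincomb e (y i) by exact: (s2valP' (cid2 (fW i))).
have -> : d = size (codom y) by rewrite size_codom card_ord.
apply: leq_trans (dim_span _); apply/dimvS/subvP => x xW.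
have /fU[a xE] : U (lincomb e x) by apply/UW; exists x.
have -> : x = \sum_i a i 0 *: y i.
  apply: lincomb_free => z; rewrite xE lincomb_linear.
  by apply: eq_bigr => i _; rewrite yE.
by apply: memv_suml => i _; rewrite memvZ // memv_span // codom_f.
Qed.

End Identified.

(** * The standard basis and the matrices of the Fricke involution and the trace *)

Section Basis.
Variables (R : realType) (Fq : finFieldType) (C : Cinfty R Fq) (p r j n k : nat) (m : int).
Local Notation q := #|Fq|.
Local Notation t := (tC C).
Local Notation slash := (slash k m).
Implicit Types (phi psi : C -> C) (c : 'M[C]_2 -> 'rV[C]_k.-1) (v w : 'rV[C]_k.-1).
Hypotheses (p_prime : prime p) (card_Fq : q = (p ^ r)%N) (j_le : (j <= q - 2)%N).
Hypotheses (n_ge1 : (1 <= n)%N) (k_def : k = (2 * j + 2 + (n - 1) * (q - 1))%N).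
Hypothesis m_mod : (m = (j + 1)%N%:Z %[mod (q - 1)%N%:Z])%Z.
Hypotheses (resiso : residue_isomorphism C k m) (ebariso : ebar_isomorphism C k m).

Local Notation S0 := (cusp_form (C := C) (@Gamma0 Fq) k m).
Local Notation S1 := (cusp_form (C := C) (@Gamma1 Fq) k m).
Local Notation ebar := (ebar C).
Local Notation residues := (@residues R Fq C k).
Local Notation harmonic := (harmonic_cocycle (k := k) (@Gamma1 Fq) m).
Local Notation dual_act := (@dual_act R Fq C k m).

Lemma k_ge2 : (2 <= k)%N. Proof. by rewrite k_def addnAC leq_addl. Qed.

Lemma idx_lt (b : 'I_n) : (j + b * (q - 1) < k.-1)%N.
Proof.
have bn := ltn_ord b; have : (b * (q - 1) <= (n - 1) * (q - 1))%N.
  by apply: leq_mul => //; rewrite subn1 -ltnS prednK.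
by rewrite k_def; lia.
Qed.

Definition idx (b : 'I_n) : 'I_k.-1 := Ordinal (idx_lt b).

(** Hence antidiagonal matrices, which exchange X and Y, reverse the order of the basis. *)
Lemma idx_rev b : (idx b + idx (rev_ord b) = k - 2)%N.
Proof.
have bn := ltn_ord b.
rewrite -[LHS]/(j + b * (q - 1) + (j + (n - b.+1) * (q - 1)))%N k_def.
rewrite (_ : (n - 1 = b + (n - b.+1))%N); last by lia.
by rewrite mulnDl; move: (_ * (q - 1))%N (b * (q - 1))%N => x y; lia.
Qed.

Lemma q1_gt0 : (0 < q - 1)%N. Proof. by rewrite subn_gt0 card_gt1. Qed.

Lemma idx_inj : injective idx.
Proof.
move=> b b' /(congr1 val)/= /addnI/eqP; rewrite eqn_mul2r.
by rewrite eqn0Ngt q1_gt0 /= => /eqP/val_inj.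
Qed.

Lemma emb_neq0 (a : Fq) : a != 0 -> embC a != 0 :> C.
Proof. by rewrite fmorph_eq0. Qed.

Lemma emb_expz (a : Fq) : a != 0 -> (embC a : C) ^ m = embC a ^+ j.+1.
Proof.
move=> a0; have e0 := emb_neq0 a0.
have aq : (embC a : C) ^ (q - 1)%N%:Z = 1.
  by rewrite -exprnP -rmorphXn expf_card_pred // rmorph1.
have modE (i : int) : (embC a : C) ^ i = embC a ^ (i %% (q - 1)%N%:Z)%Z.
  rewrite {1}(divz_eq i (q - 1)%N%:Z) expfzDr // [(_ %/ _)%Z * _]mulrC -exprz_exp.
  by rewrite aq exp1rz mul1r.
by rewrite modE m_mod -modE exprnP addn1.
Qed.

Lemma emb_exp_idx (a : Fq) b : a != 0 -> (embC a : C) ^+ idx b = embC a ^+ j.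
Proof.
move=> a0; rewrite /= exprD mulnC exprM -(rmorphXn embC (q - 1)%N) /=.
by rewrite expf_card_pred // rmorph1 expr1n mulr1.
Qed.

(** A generator of the multiplicative group gives l = j modulo q - 1. Then l = j + b (q - 1) <= 2 j
    + (n - 1) (q - 1) and j < q - 1 force b < n. *)
Lemma idx_of_mod (l : 'I_k.-1) : (forall a : Fq, a != 0 -> a ^+ l = a ^+ j) ->
  exists b, l = idx b.
Proof.
move=> al; have [a ap] : exists a : Fq, (q - 1).-primitive_root a.
  have : has (q - 1).-primitive_root [seq x <- enum Fq | x != 0].
    apply: has_prim_root q1_gt0 _ (filter_uniq _ (enum_uniq _)) _.
      apply/allP => x; rewrite mem_filter => /andP[x0 _].
      by apply/unity_rootP/expf_card_pred.
    rewrite size_filter cardE -(count_predC (pred1 (0 : Fq))) count_uniq_mem ?enum_uniq //.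
    by rewrite mem_enum addKn.
  by case/hasP => x _ xp; exists x.
have a0 : a != 0 by rewrite (prim_root_eq0 ap) -lt0n q1_gt0.
have /eqP := al a a0; rewrite (eq_prim_root_expr ap) => /eqP lj.
have jq : (j < q - 1)%N by move: j_le q1_gt0; clear; move: #|Fq| => Q; lia.
rewrite (modn_small jq) in lj; have lE := divn_eq l (q - 1); rewrite lj in lE.
have bn : (l %/ (q - 1) < n)%N.
  rewrite ltnNge; apply/negP => nl.
  have : (n * (q - 1) <= l %/ (q - 1) * (q - 1))%N by rewrite leq_mul2r nl orbT.
  have := ltn_ord l; move: lE jq.
  have -> : (n * (q - 1) = (n - 1) * (q - 1) + (q - 1))%N.
    by rewrite -[in LHS](subnK n_ge1) mulnDl mul1n.
  have : (k.-1 = 2 * j + 1 + (n - 1) * (q - 1))%N.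
    by rewrite k_def; move: (_ * (q - 1))%N => x; clear; lia.
  move: ((n - 1) * (q - 1))%N => x; move: (l %/ (q - 1) * (q - 1))%N => y.
  by move: (q - 1)%N (nat_of_ord l) => z l'; clear; lia.
by exists (Ordinal bn); apply/val_inj; rewrite /= addnC.
Qed.

Lemma GL2Koo_ebar : GL2Koo ebar.
Proof.
apply: GL2Koo_mx2; try exact: Koo0; try exact: Koo1.
by rewrite mul0r mulr1 sub0r oppr_eq0 oner_eq0.
Qed.

Lemma cusp_cocycle phi : S1 phi ->
  exists2 c, harmonic c & forall g, GL2Koo g -> residues phi g (c g).
Proof. by case/(resiso.1) => c ch cr; exists c => // g gK l; apply: cr. Qed.

Lemma cusp_eq phi psi v : S1 phi -> S1 psi -> residues phi ebar v -> residues psi ebar v ->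
  phi = psi.
Proof.
move=> s1 s1' rv rv'.
have [c ch cr] := cusp_cocycle s1; have [c' ch' cr'] := cusp_cocycle s1'.
have cE : c ebar = c' ebar.
  by rewrite (residues_unique (cr _ GL2Koo_ebar) rv) (residues_unique (cr' _ GL2Koo_ebar) rv').
have cc' := ebariso.2 _ _ ch ch' cE.
have [chi [_ _] uniq] := resiso.2 _ ch.
have h1 : psi =1 chi.
  by apply: uniq => // g l gK; rewrite cc' //; apply: cr'.
have h2 : phi =1 chi by apply: uniq => // g l gK; apply: cr.
by apply/funext => z; rewrite h1 h2.
Qed.

Lemma residues_slash_ebar phi c (h h' : 'M[C]_2) : GL2Koo h -> h' *m h = 1%:M ->
  (forall g, GL2Koo g -> residues phi g (c g)) ->
  residues (slash phi h) ebar (dual_act h' (c (h *m ebar))).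
Proof.
move=> hK /invmx_left <- cr; apply: (residues_slash m k_ge2 GL2Koo_ebar hK).
by apply/cr/GL2KooM => //; apply: GL2Koo_ebar.
Qed.

Lemma cocycle_iwahori c g (a b d : Fq) (u v w : C) : harmonic c ->
  GL2Koo g -> u = embC a -> v = embC b -> w = embC d -> a != 0 -> d != 0 ->
  c (g *m mx2 u v 0 w) = c g.
Proof.
move=> [ci _ _ _] gK -> -> -> a0 d0; rewrite -[mx2 _ _ _ _]scale1r ci //.
- exact: Koo1.
- exact: oner_neq0.
split.
- by do 2!apply: forall_I2; rewrite mx2E ?absC0 ?absC_emb_le1 ?ler01; split=> //;
    try exact: Koo_emb; exact: Koo0.
- by rewrite det_mx2E mulr0 subr0 absCM !absC_emb // mulr1.
by rewrite mx2E absC0 ltr01.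
Qed.

Lemma mxA_diag (a d : Fq) : mxA C (mx2 a%:P 0 0 d%:P) = mx2 (embC a) 0 0 (embC d).
Proof. by rewrite mxA_mx2 !evalAC !rmorph0. Qed.

Lemma diag_unit (a d : Fq) : a != 0 -> d != 0 ->
  (mx2 a%:P 0 0 d%:P : 'M[{poly Fq}]_2) \in unitmx.
Proof. by move=> a0 d0; rewrite unit_mx2A mulr0 subr0 -polyCM polyC_unit mulf_neq0. Qed.

(** Diagonal matrices fix the edge ebar, so only their action on the dual of V is felt; the
    exponents j come from m - 1 = j modulo q - 1. *)
Lemma residues_diag phi v (a d : Fq) : S1 phi -> residues phi ebar v -> a != 0 -> d != 0 ->
  residues (slash phi (mx2 (embC a) 0 0 (embC d))) ebar
    (\row_l (embC a ^+ j * embC d ^+ j * embC a ^- l * embC d ^- (k - 2 - l) * v 0 l)).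
Proof.
move=> s1 rv a0 d0; have [c ch cr] := cusp_cocycle s1.
have ea := emb_neq0 a0; have ed := emb_neq0 d0.
have hK : GL2Koo (mx2 (embC a) 0 0 (embC d) : 'M[C]_2).
  by rewrite -mxA_diag; apply/GL2K_Koo/GL2K_mxA/diag_unit.
have hV : mx2 (embC a)^-1 0 0 (embC d)^-1 *m mx2 (embC a) 0 0 (embC d) = 1%:M :> 'M[C]_2.
  by apply: eq_mx2; rewrite mulmx2E !mx2E !mxE /= !(mul0r, mulr0, addr0, add0r) ?mulVf.
have cE : c (mx2 (embC a) 0 0 (embC d) *m ebar) = v.
  rewrite (_ : _ *m _ = ebar *m mx2 (embC d) 0 0 (embC a)); last first.
    by apply: eq_mx2; rewrite !mulmx2E !mx2E; ring.
  rewrite (@cocycle_iwahori c ebar d 0 a) ?rmorph0 //; last exact: GL2Koo_ebar.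
  exact: residues_unique (cr _ GL2Koo_ebar) rv.
have := residues_slash_ebar hK hV cr; rewrite cE.
congr (residues _ _ _); apply/matrixP => i l; rewrite ord1 dual_act_diag mxE.
rewrite -invfM exprz_inv opprB expfzDr ?mulf_neq0 // expfzMl !emb_expz // exprN1 !exprVn.
by rewrite !exprS; field; rewrite ea ed !expf_neq0.
Qed.

(** Invariance under diag(a, 1) multiplies the l-th coefficient by a^(j-l), so a nonzero coefficient
    forces l = j modulo q - 1. *)
Lemma S0_residues phi v : S0 phi -> residues phi ebar v ->
  forall l, (forall b, l != idx b) -> v 0 l = 0.
Proof.
move=> s0 rv l lb; have s1 := cusp_form_sub (@Gamma1_Gamma0 Fq) s0.
apply/eqP; apply: contraT => vl.
have [a a0|b lE] := @idx_of_mod l; last by have := lb b; rewrite lE eqxx.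
have := residues_diag s1 rv a0 (oner_neq0 Fq).
have /cusp_formP[_ inv] := s0.
rewrite -mxA_diag inv; last first.
  by rewrite Gamma0E diag_unit ?oner_neq0 // mx2E hornerC eqxx.
move/(residues_unique rv)/matrixP/(_ 0 l); rewrite mxE rmorph1 !expr1n invr1 !mulr1 => E.
have : embC a ^+ j * embC a ^- l * v 0 l = 1 * v 0 l :> C by rewrite -E mul1r.
move/(mulIf vl); rewrite -!rmorphXn => /eqP.
rewrite -/(_ / _) (can2_eq (mulfVK _) (mulfK _)) ?fmorph_eq0 ?expf_neq0 //.
by rewrite mul1r (inj_eq (fmorph_inj embC)) => /eqP.
Qed.

(** By [Gamma0_diag] only the diagonal matrices matter, and they act trivially at [idx b]: both
    [idx b] and k - 2 - [idx b] are j modulo q - 1. *)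
Lemma S0_of_residues phi v : S1 phi -> residues phi ebar v ->
  (forall l, (forall b, l != idx b) -> v 0 l = 0) -> S0 phi.
Proof.
move=> s1 rv v0; have /cusp_formP[phic inv] := s1; have [phiO _ _] := phic.
apply/cusp_formP; split=> // s /Gamma0_diag[a [d [h [a0 d0 h1 ->]]]].
have dK := GL2K_Koo (GL2K_mxA C (diag_unit a0 d0)).
have hK := GL2K_Koo (GL2K_mxA C (Gamma0_GL2A (Gamma1_Gamma0 h1))).
rewrite mxAM -(slashM_fun k m dK hK phiO).
suff -> : slash phi (mxA C (mx2 a%:P 0 0 d%:P)) = phi by exact: inv.
have s1' : S1 (slash phi (mxA C (mx2 a%:P 0 0 d%:P))).
  apply: cusp_form_slash (GL2K_mxA C (diag_unit a0 d0)) _ _ _ s1 =>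
    [g /Gamma1_Gamma0/Gamma0_GL2A //|g /Gamma1_Gamma0/Gamma0_GL2A //|g g1].
  have [g' g'1 E] := Gamma1_conj_diag a0 d0 g1; exists g' => //.
  by rewrite -!mxAM E.
apply: (cusp_eq s1' s1 (v := v)) => //.
rewrite mxA_diag; have := residues_diag s1 rv a0 d0.
congr (residues _ _ _); apply/matrixP => i l; rewrite ord1 mxE.
have [b /eqP lE|lb] := pickP (fun b => l == idx b); last first.
  by rewrite v0 ?mulr0 // => b; rewrite lb.
have -> : (k - 2 - l = idx (rev_ord b))%N by rewrite lE -(idx_rev b) addKn.
rewrite lE !emb_exp_idx // -[RHS]mul1r; congr (_ * _).
by field; rewrite !expf_neq0 ?emb_neq0.
Qed.

Definition vecof (x : 'cV[C]_n) : 'rV[C]_k.-1 :=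
  \row_l \sum_b x b 0 * (l == idx b)%:R.

Lemma vecof_idx x b : vecof x 0 (idx b) = x b 0.
Proof.
rewrite mxE (bigD1 b) //= eqxx mulr1 big1 ?addr0 // => b' /negPf bb'.
by rewrite (inj_eq idx_inj) eq_sym bb' mulr0.
Qed.

Lemma vecof_notidx x l : (forall b, l != idx b) -> vecof x 0 l = 0.
Proof. by move=> lb; rewrite mxE big1 // => b _; rewrite (negPf (lb b)) mulr0. Qed.

Lemma sum_vecof (u : 'I_k.-1 -> C) x :
  \sum_l u l * vecof x 0 l = \sum_b u (idx b) * x b 0.
Proof.
under eq_bigr do rewrite mxE mulr_sumr.
rewrite exchange_big; apply: eq_bigr => b _.
rewrite (bigD1 (idx b)) //= eqxx mulr1 big1 ?addr0 // => l /negPf lb.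
by rewrite lb !mulr0.
Qed.

Lemma standard_exists (i : 'I_k.-1) : exists phi : C -> C, standard_form k m i phi.
Proof.
have [c ch cE] := ebariso.1 (\row_l (l == i :> nat)%:R).
by have [phi [s1 cr] _] := resiso.2 _ ch; exists phi; split=> //; exists c.
Qed.

Definition std (b : 'I_n) : C -> C := sval (cid (standard_exists (idx b))).

Lemma std_standard (b : 'I_n) : standard_form k m (j + b * (q - 1)) (std b).
Proof. exact: svalP (cid (standard_exists (idx b))). Qed.

Lemma std_S1 b : S1 (std b). Proof. by case: (std_standard b). Qed.

Lemma lincomb_sum x : lincomb std x = fun z => \sum_b x b 0 * std b z.
Proof. by []. Qed.

Lemma residues_lincomb x : residues (lincomb std x) ebar (vecof x).
Proof.
have rs b : residues (std b) ebar (\row_l (l == idx b)%:R).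
  have [_ [c [ch cr cE]]] := std_standard b.
  have -> : \row_l (l == idx b)%:R = c ebar.
    by rewrite cE; apply/matrixP => i l; rewrite !mxE -val_eqE.
  by move=> l; apply: cr GL2Koo_ebar.
have := residues_sum (index_enum 'I_n) (fun b => residuesZ (x b 0) (rs b)).
congr (residues _ _ _); apply/matrixP => i l; rewrite summxE !mxE.
by apply: eq_bigr => b _; rewrite !mxE.
Qed.

Lemma S1_lincomb x : S1 (lincomb std x).
Proof.
have b0 : 'I_n := Ordinal n_ge1.
apply/cusp_formP; split.
  have /cusp_formP[c _] := std_S1 b0.
  apply: cuspidal_sum c _ => b; apply: cuspidalZ.
  by have /cusp_formP[] := std_S1 b.
move=> s s1; rewrite lincomb_sum slash_sum; apply/funext => z; apply: eq_bigr => b _.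
have /cusp_formP[_ inv] := std_S1 b.
by rewrite -{2}(inv s s1) /Defs.slash !mulrA.
Qed.

Lemma S0_lincomb x : S0 (lincomb std x).
Proof.
apply: S0_of_residues (S1_lincomb x) (residues_lincomb x) _ => l lb.
exact: vecof_notidx.
Qed.

Lemma S0_coords phi w (x : 'cV[C]_n) : S0 phi -> residues phi ebar w ->
  (forall b, w 0 (idx b) = x b 0) -> phi = lincomb std x.
Proof.
move=> s0 rw wx; have s1 := cusp_form_sub (@Gamma1_Gamma0 Fq) s0.
suff E : w = vecof x by apply: cusp_eq s1 (S1_lincomb x) rw _; rewrite E; apply: residues_lincomb.
apply/matrixP => i l; rewrite ord1.
have [b /eqP ->|lb] := pickP (fun b => l == idx b); first by rewrite vecof_idx wx.
have lb' b : l != idx b by rewrite lb.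
by rewrite vecof_notidx // (S0_residues s0 rw).
Qed.

Lemma S0_lincombP phi : S0 phi -> exists x, phi = lincomb std x.
Proof.
move=> s0; have [c _ cr] := cusp_cocycle (cusp_form_sub (@Gamma1_Gamma0 Fq) s0).
exists (\col_b c ebar 0 (idx b)); apply: S0_coords s0 (cr _ GL2Koo_ebar) _ => b.
by rewrite mxE.
Qed.

Lemma lincomb_inj x y : lincomb std x = lincomb std y -> x = y.
Proof.
move=> E; apply/matrixP => b i; rewrite ord1 -!vecof_idx.
suff -> : vecof x = vecof y by [].
apply: (residues_unique (residues_lincomb x)); rewrite E.
exact: residues_lincomb.
Qed.

(** The Fricke matrix reverses the edge ebar up to a scalar and an Iwahori matrix, whence a sign;
    its inverse then exchanges X and Y and contributes the powers of t. *)
Lemma fricke_lincomb (x : 'cV[C]_n) : fricke k m (lincomb std x)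
  = lincomb std (t ^ (m - k%:Z) *: (Fmx C j n *m x)).
Proof.
have [c ch cr] := cusp_cocycle (S1_lincomb x).
have t0 := tC_neq0 C.
have cx : c ebar = vecof x.
  exact: residues_unique (cr _ GL2Koo_ebar) (residues_lincomb x).
pose W : 'M[C]_2 := mx2 0 (-1) t 0; have WK : GL2Koo W := GL2K_Koo (GL2K_fricke C).
have WV : mx2 0 t^-1 (-1) 0 *m W = 1%:M.
  by apply: eq_mx2; rewrite mulmx2E !mx2E !mxE /= ?mul0r ?mulr0 ?addr0 ?add0r ?mulVf ?mulrNN ?mulr1.
have revK : GL2Koo (mx2 0 1 t^-1 0 : 'M[C]_2).
  apply: GL2Koo_mx2; try exact: Koo0; try exact: Koo1; first exact/KooV/Koo_t.
  by rewrite mul0r sub0r mul1r oppr_eq0 invr_eq0.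
have cW : c (W *m ebar) = - vecof x.
  have [ci cv _ _] := ch.
  have -> : W *m ebar = ebar *m mx2 0 1 t^-1 0 *m (t *: mx2 (-1) 0 0 1).
    by apply: eq_mx2; rewrite !(mulmx2E, mx2E, mxE) /=; field; rewrite t0.
  have wiw : iwahori (mx2 (-1) 0 0 1 : 'M[C]_2).
    split.
    - do 2!apply: forall_I2; rewrite mx2E ?absC0 ?absCN ?absC1 ?ler01; split=> //;
        try exact: Koo0; try exact: Koo1; apply: KooN; exact: Koo1.
    - by rewrite det_mx2E mulr0 subr0 absCM absCN !absC1 mulr1.
    by rewrite mx2E absC0 ltr01.
  rewrite ci //; [|by apply: GL2KooM; first exact: GL2Koo_ebar|exact: Koo_t].
  by rewrite cv ?cx //; apply: GL2Koo_ebar.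
have := residues_slash_ebar WK WV cr; rewrite cW => rW.
apply: S0_coords (cusp_form_fricke (S0_lincomb x)) rW _ => b.
rewrite (dual_act_antidiag _ _ _ _ (idx_rev b)) [(- vecof x) _ _]mxE vecof_idx.
rewrite [RHS]mxE Fmx_mul mulrN1 opprK.
have -> : expo_s Fq j (n - b.+1) = (idx (rev_ord b)).+1 by rewrite /expo_s /=; lia.
have kE : k = (idx b + idx (rev_ord b)).+2 by rewrite idx_rev; have := k_ge2; lia.
move: (x _ 0) kE => X.
move: (nat_of_ord (idx b)) (nat_of_ord (idx (rev_ord b))) => i i' ->.
have -> : m - (i + i').+2%:Z = (m - 1) + - (i + i').+1%:Z by lia.
rewrite exprz_inv opprB [in RHS]expfzDr // -invr_expz -exprnP (exprNn t) !exprS exprD exprVn.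
by field; rewrite !expf_neq0.
Qed.

Lemma emb_exp_mul (a : Fq) e : a != 0 -> (embC a : C) ^+ (e * (q - 1)) = 1.
Proof.
by move=> a0; rewrite mulnC exprM -(rmorphXn embC (q - 1)%N) /= expf_card_pred // rmorph1 expr1n.
Qed.

Lemma upper_unit (x : Fq) : Gamma1 (mx2 1 x%:P 0 1).
Proof.
by rewrite Gamma1E unit_mx2A mulr0 subr0 mulr1 unitr1 !mx2E !hornerC !eqxx.
Qed.

Lemma sum_neq0_cst (u : C) : \sum_(y : Fq | y != 0) u = - u.
Proof.
rewrite sumr_const (eq_card (B := predC1 (0 : Fq))) // cardC1 -subn1 -mulr_natr.
by rewrite (natf_card_pred _ p_prime card_Fq) mulrN1.
Qed.

Lemma nil_coefE b b' : nil_coef C j b b'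
  = (b == b' :> nat)%:R - 'C(j + b * (q - 1), j + b' * (q - 1))%:R.
Proof. by rewrite /nil_coef; case: eqP => [->|_]; rewrite ?binn ?subrr ?sub0r. Qed.

(* The value of the cocycle at the edge fixed by the upper triangular matrices
   follows from the harmonicity at the origin of [ebar]. *)
Lemma cocycle_one x c (b : 'I_n) : harmonic c -> c ebar = vecof x ->
  c 1%:M 0 (idx b) = - \sum_(b' < n) nil_coef C j b b' * x b' 0.
Proof.
move=> ch cx; have [_ _ charm ceq] := ch.
have eE y : ebar *m mx2 (embC y) 1 1 0 = mx2 1 0 (embC y) 1.
  by apply: eq_mx2; rewrite mulmx2E !mx2E; ring.
(* (1,0;y,1) = (1,1/y;0,1) ebar (y,1;0,-1/y), with first factor in [Gamma1] and last factor in the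
   Iwahori subgroup. *)
have c_lower y : y != 0 -> c (mx2 1 0 (embC y) 1) = dual_act (mx2 1 (embC y^-1) 0 1) (vecof x).
  move=> y0; have ey := emb_neq0 y0.
  have := ceq _ ebar (upper_unit y^-1) GL2Koo_ebar.
  rewrite mxA_mx2 !(rmorph0, rmorph1) evalAC cx => <-.
  have gK : GL2Koo (mx2 1 (embC y^-1) 0 1 *m ebar).
    apply: GL2KooM GL2Koo_ebar; apply: GL2Koo_mx2; try exact: Koo0; try exact: Koo1.
      exact: Koo_emb.
    by rewrite mulr0 subr0 mulr1 oner_neq0.
  rewrite -(@cocycle_iwahori c _ y 1 (- y^-1) (embC y) 1 (- (embC y)^-1) ch gK);
    rewrite ?oppr_eq0 ?invr_eq0 //.
  - by congr (c _); rewrite fmorphV; apply: eq_mx2; rewrite !mulmx2E !mx2E; field.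
  - by rewrite rmorph1.
  by rewrite rmorphN fmorphV.
have := charm _ GL2Koo_ebar; rewrite (bigD1 0) //= eE rmorph0 cx.
have -> : mx2 1 0 0 1 = 1%:M :> 'M[C]_2 by apply: eq_mx2; rewrite mx2E mxE.
rewrite addrCA => /(canRL (addrK _)); rewrite sub0r => ->.
rewrite mxE [(vecof x + _) _ _]mxE vecof_idx summxE; congr (- _).
pose P b' : C := 'C(j + b * (q - 1), j + b' * (q - 1))%:R.
(* The exponents of 1/y are multiples of q - 1, so the q - 1 summands agree, and their sum is minus
   one of them. *)
rewrite (eq_bigr (fun=> \sum_(b' < n) P b' * x b' 0)); last first.
  move=> y y0; rewrite eE c_lower // dual_act_upper sum_vecof.
  apply: eq_bigr => b' _; rewrite -[nat_of_ord (idx b)]/(j + b * (q - 1))%N.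
  rewrite -[nat_of_ord (idx b')]/(j + b' * (q - 1))%N subnDl -mulnBl.
  by rewrite emb_exp_mul ?invr_eq0 // mulr1.
rewrite sum_neq0_cst -sumrN -[x b 0]mul1r.
rewrite [RHS](eq_bigr (fun b' : 'I_n => (b == b')%:R * x b' 0 + - (P b' * x b' 0))).
  rewrite big_split; congr (_ + _); rewrite (bigD1 b) //= eqxx big1 ?addr0 // => b' /negPf bb'.
  by rewrite eq_sym bb' mul0r.
by move=> b' _; rewrite nil_coefE mulrBl.
Qed.

Lemma GL2Koo_lower (y : Fq) : y != 0 ->
  GL2Koo (mx2 (embC y)^-1 0 1 (embC y) : 'M[C]_2).
Proof.
move=> y0; apply: GL2Koo_mx2; try exact: Koo0; try exact: Koo1; try exact: Koo_emb.
  exact/KooV/Koo_emb.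
by rewrite mul0r subr0 mulVf ?emb_neq0 // oner_neq0.
Qed.

(* The representatives (0,-1;1,y) and (1/y,0;1,y) define the same coset of
   Gamma0, and the latter maps [ebar] to itself. *)
Lemma slash_lower phi (y : Fq) : S0 phi -> y != 0 ->
  slash phi (mx2 0 (-1) 1 (embC y)) = slash phi (mx2 (embC y)^-1 0 1 (embC y)).
Proof.
move=> /cusp_formP[[phiO _ _] inv] y0; have ey := emb_neq0 y0.
have uK := GL2K_Koo (GL2K_mxA C (Gamma0_GL2A (Gamma1_Gamma0 (upper_unit y^-1)))).
have hK : GL2Koo (mx2 0 (-1) 1 (embC y) : 'M[C]_2).
  apply: GL2Koo_mx2; try exact: Koo0; try exact: Koo1; try exact: Koo_emb.
    exact/KooN/Koo1.
  by rewrite mul0r sub0r mulN1r opprK oner_neq0.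
rewrite -[in LHS](inv _ (Gamma1_Gamma0 (upper_unit y^-1))) slashM_fun //.
congr (Defs.slash _ _ _ _); rewrite mxA_mx2 !(rmorph0, rmorph1) evalAC fmorphV.
by apply: eq_mx2; rewrite mulmx2E !mx2E; field.
Qed.

(** The contribution of the representative (0,-1;1,0), which moves ebar to the edge of 1. *)
Lemma dual_act_rep0 x c (b : 'I_n) : harmonic c -> c ebar = vecof x ->
  dual_act (mx2 0 1 (-1) 0) (c 1%:M) 0 (idx b)
  = (-1) ^+ j.+1 * \sum_(b' < n) nil_coef C j (n - b.+1) b' * x b' 0.
Proof.
move=> ch cx; rewrite (dual_act_antidiag _ _ _ _ (idx_rev b)) (cocycle_one _ ch cx).
rewrite mulrN1 opprK exp1rz expr1n !mul1r mulrN -[nat_of_ord (idx _)]/(j + (n - b.+1) * (q - 1))%N.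
by rewrite exprD sign_card_pred mulr1 exprS mulN1r mulNr.
Qed.

(** The sign and the powers of y disappear since all indices agree modulo q - 1. The symmetry of
    binomial coefficients brings in the reversed index of b'. *)
Lemma dual_act_rep x (y : Fq) (b : 'I_n) : y != 0 ->
  dual_act (mx2 (embC y) 0 (-1) (embC y)^-1) (vecof x) 0 (idx b)
  = \sum_(b' < n) 'C(j + (n - b.+1) * (q - 1), j + (n - b'.+1) * (q - 1))%:R * x b' 0.
Proof.
move=> y0; have ey := emb_neq0 y0; rewrite dual_act_lower divff // exp1rz mul1r sum_vecof.
apply: eq_bigr => b' _; congr (_ * _).
have -> : (k - 2 - idx b = idx (rev_ord b))%N by rewrite -(idx_rev b) addKn.
rewrite -[nat_of_ord (idx (rev_ord b))]/(j + (n - b.+1) * (q - 1))%N.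
have bn := ltn_ord b; have bn' := ltn_ord b'.
rewrite -[nat_of_ord (idx b')]/(j + b' * (q - 1))%N -[nat_of_ord (idx b)]/(j + b * (q - 1))%N.
rewrite ltn_add2l ltn_mul2r q1_gt0 andTb; case: ltnP => bb'.
  rewrite bin_small // ltn_add2l ltn_mul2r q1_gt0 andTb; lia.
rewrite subnDl -mulnBl sign_card_pred mulr1.
have -> : (n - b.+1 = (b' - b) + (n - b'.+1))%N by move: bn' bb'; clear; lia.
set u := (b' - b)%N; set u' := (n - b'.+1)%N.
have -> : (j + (u + u') * (q - 1) - u * (q - 1) = j + u' * (q - 1))%N.
  by rewrite mulnDl addnCA addKn.
rewrite exprVn [embC y ^+ (j + u' * _)]exprD emb_exp_mul // mulr1 emb_exp_idx //.
rewrite mulrCA divff ?expf_neq0 // mulr1; congr (_%:R).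
rewrite -bin_sub ?mulnDl; last by rewrite addnCA leq_addr.
by rewrite addnCA addKn.
Qed.

(** As q - 1 = -1 in C, the identity and the representatives with y nonzero add up to the first
    summand of [Tmx_entry]; y = 0 gives the second. *)
Lemma trace_lincomb (x : 'cV[C]_n) :
  trace k m (lincomb std x) = lincomb std (Tmx C j n *m x).
Proof.
have s0 := S0_lincomb x; have [c ch cr] := cusp_cocycle (S1_lincomb x).
have cx : c ebar = vecof x.
  exact: residues_unique (cr _ GL2Koo_ebar) (residues_lincomb x).
pose w (y : Fq) := if y == 0 then dual_act (mx2 0 1 (-1) 0) (c 1%:M)
  else dual_act (mx2 (embC y) 0 (-1) (embC y)^-1) (vecof x).
have rw y : residues (slash (lincomb std x) (mx2 0 (-1) 1 (embC y))) ebar (w y).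
  rewrite /w; have [->|y0] := eqVneq y 0.
    rewrite rmorph0; set h := mx2 0 (-1) 1 0.
    have hK : GL2Koo h.
      apply: GL2Koo_mx2; try exact: Koo0; try exact: Koo1; first exact/KooN/Koo1.
      by rewrite mul0r sub0r mulN1r opprK oner_neq0.
    have hV : mx2 0 1 (-1) 0 *m h = 1%:M.
      by apply: eq_mx2; rewrite mulmx2E !mx2E !mxE /=; ring.
    have := residues_slash_ebar hK hV cr; congr (residues _ _ (dual_act _ _)).
    have K1 : GL2Koo (1%:M : 'M[C]_2).
      by rewrite (mx2_eta 1%:M) !mxE; apply: GL2Koo_mx2; rewrite ?mulr0 ?subr0 ?mulr1 ?oner_neq0 //;
        try exact: Koo0; exact: Koo1.
    rewrite -[RHS](@cocycle_iwahori c _ (-1) 0 1 (-1) 0 1 ch K1);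
      rewrite ?rmorphN ?rmorph1 ?rmorph0 ?oppr_eq0 ?oner_neq0 //.
    by congr (c _); rewrite mul1mx; apply: eq_mx2; rewrite mulmx2E !mx2E; ring.
  rewrite (slash_lower s0 y0); have ey := emb_neq0 y0.
  have hV : mx2 (embC y) 0 (-1) (embC y)^-1 *m mx2 (embC y)^-1 0 1 (embC y) = 1%:M :> 'M[C]_2.
    by apply: eq_mx2; rewrite mulmx2E !mx2E !mxE /=; field.
  have := residues_slash_ebar (GL2Koo_lower y0) hV cr; congr (residues _ _ (dual_act _ _)).
  rewrite -cx -(@cocycle_iwahori c _ y 1 y^-1 (embC y) 1 (embC y)^-1 ch GL2Koo_ebar);
    rewrite ?rmorph1 ?fmorphV ?invr_eq0 //.
  by congr (c _); apply: eq_mx2; rewrite !mulmx2E !mx2E; ring.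
have rT := residuesD (residues_lincomb x) (residues_sum (index_enum Fq) rw).
apply: S0_coords (cusp_form_sub (@Gamma0_GL2A Fq) (cusp_form_trace s0)) _ _.
  move: rT; congr (residues _ _ _); apply/funext => z.
  by rewrite /trace slash1.
move=> b; rewrite mxE vecof_idx summxE (bigD1 0) //= /w eqxx (dual_act_rep0 _ ch cx).
under eq_bigr => y y0 do rewrite (negPf y0) dual_act_rep //.
rewrite sum_neq0_cst mxE.
under [RHS]eq_bigr => b' _ do rewrite Tmx_entry mulrDl -mulrA.
rewrite big_split /= -mulr_sumr addrCA addrC; congr (_ + _).
rewrite -sumrN -[x b 0]mul1r.
rewrite [RHS](eq_bigr (fun b' : 'I_n => (b == b')%:R * x b' 0
    + - ('C(j + (n - b.+1) * (q - 1), j + (n - b'.+1) * (q - 1))%:R * x b' 0))).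
  rewrite big_split; congr (_ + _); rewrite (bigD1 b) //= eqxx big1 ?addr0 // => b' /negPf bb'.
  by rewrite eq_sym bb' mul0r.
move=> b' _; rewrite nil_coefE mulrBl; congr ((nat_of_bool _)%:R * _ - _).
apply/eqP/eqP => [E|->//].
by apply/val_inj; have := ltn_ord b; have := ltn_ord b'; move: E; clear; rewrite /=; lia.
Qed.

Local Notation Mm := (Mmx C j n).
Local Notation Dm := (Dmx C j n).
Local Notation Am := (Amx C j n).
Local Notation Fm := (Fmx C j n).
Local Notation Tm := (Tmx C j n).

Let kappa : C := (- t) ^+ k.
Let kappa0 : kappa != 0. Proof. by rewrite expf_neq0 // oppr_eq0 tC_neq0. Qed.
Let FF : Fm *m Fm = kappa%:M. Proof. by rewrite Fmx_sqr /kappa k_def. Qed.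
Let MAE : 1%:M + Mm *m Am = Tm. Proof. by []. Qed.
Let MDE : Mm *m Dm = (Tm - 1%:M) *m Fm.
Proof. exact: Mmx_Dmx. Qed.

Lemma lincomb0 : lincomb std 0 = fun=> 0.
Proof. by apply/funext => z; rewrite /lincomb big1 // => b _; rewrite mxE mul0r. Qed.

Lemma std_basis : is_basis S0 std.
Proof.
split=> [phi|x x0].
  split=> [/S0_lincombP[x ->]|[x]]; first by exists x.
  by move/funext => ->; apply: S0_lincomb.
by apply: lincomb_inj; rewrite lincomb0; apply/funext.
Qed.

Lemma level1_lincomb x : cusp_form (@GL2A Fq) k m (lincomb std x) <-> x \in Ker (Mm *m Am).
Proof.
rewrite (mem_KerMA MAE); split=> [g|/eqP Tx].
  apply/eqP/lincomb_inj; rewrite -trace_lincomb trace_GL2A //.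
  exact: natf_card p_prime card_Fq.
by rewrite -Tx -trace_lincomb; apply: cusp_form_trace (S0_lincomb x).
Qed.

Lemma std_oldform : identified std (oldform (C := C) k m) (Ker (Mm *m Am) + Ker (Mm *m Dm)).
Proof.
have c0 : t ^ (m - k%:Z) != 0 by rewrite expfz_neq0 ?tC_neq0.
have sub1 phi : cusp_form (@GL2A Fq) k m phi ->
    exists2 x, x \in Ker (Mm *m Am) & phi = lincomb std x.
  move=> g; have [x xE] := S0_lincombP (cusp_form_sub (@Gamma0_GL2A Fq) g).
  by exists x => //; apply/level1_lincomb; rewrite -xE.
move=> chi; split=> [[phi [psi [phig psig /funext ->]]]|[x /memv_addP[y yA [z zD ->]] /funext ->]].
  have [x xA ->] := sub1 _ phig; have [y yA yE] := sub1 _ psig.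
  exists (x + t ^ (m - k%:Z) *: (Fm *m y)).
    by rewrite memv_add // memvZ // (F_KerMD MAE MDE FF).
  by move=> z; rewrite lincombDE -fricke_lincomb -yE (deltat_fricke psig).
(* The preimage of z under the matrix t^(m-k) F of the Fricke involution. *)
pose u := (t ^ (m - k%:Z) * kappa)^-1 *: (Fm *m z).
have uA : u \in Ker (Mm *m Am).
  by rewrite memvZ // -(F_KerMD MAE MDE FF kappa0) mulmxA FF mul_scalar_mx memvZ.
have uG : cusp_form (@GL2A Fq) k m (lincomb std u) by exact/level1_lincomb.
exists (lincomb std y), (lincomb std u); split; [exact/level1_lincomb | exact: uG | move=> w].
rewrite lincombDE (deltat_fricke uG) fricke_lincomb /u -scalemxAr mulmxA FF.
rewrite mul_scalar_mx !scalerA (_ : _ * _ = 1) ?scale1r //.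
by field; rewrite c0 kappa0.
Qed.

Lemma std_newform : identified std (newform (C := C) k m) (Ker Tm :&: (mxlin Fm @: Ker Tm)).
Proof.
have c0 : t ^ (m - k%:Z) != 0 by rewrite expfz_neq0 ?tC_neq0.
have newE x : newform k m (lincomb std x)
    <-> x \in (Ker Tm :&: (mxlin Fm @: Ker Tm))%VS.
  rewrite (mem_newspace Tm FF kappa0); split.
    case=> _ tr tr'; have Tx : Tm *m x = 0.
      by apply: lincomb_inj; apply/funext => z; rewrite -trace_lincomb tr lincomb0.
    have /lincomb_inj/eqP : lincomb std (Tm *m (t ^ (m - k%:Z) *: (Fm *m x))) = lincomb std 0.
      by apply/funext => z; rewrite -trace_lincomb -fricke_lincomb [LHS]tr' lincomb0.
    by rewrite Tx -scalemxAr scaler_eq0 (negPf c0) eqxx.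
  case/andP => /eqP T0 /eqP TF0; split; first exact: S0_lincomb.
    by rewrite trace_lincomb T0 lincomb0.
  by rewrite /trace' fricke_lincomb trace_lincomb -scalemxAr TF0 scaler0 lincomb0.
move=> phi; split=> [phin|[x xW /funext ->]]; last exact/newE.
have [x xE] : exists x, phi = lincomb std x by case: phin => s0 _ _; apply: S0_lincombP.
by exists x; rewrite ?xE //; apply/newE; rewrite -xE.
Qed.

Lemma cusp_form_basis : exists e : 'I_n -> C -> C,
  [/\ forall b : 'I_n, standard_form k m (j + b * (q - 1)) (e b), is_basis S0 e,
      identified e (oldform (C := C) k m) (Ker (Mm *m Am) + Ker (Mm *m Dm))
    & identified e (newform (C := C) k m) (Ker Tm :&: (mxlin Fm @: Ker Tm))].
Proof.
exists std; split; [exact: std_standard | exact: std_basis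
  | exact: std_oldform | exact: std_newform].
Qed.

End Basis.

Unset Implicit Arguments.

Theorem theorem5p14 (R : realType) (p r : nat) (Fq : finFieldType)
    (C : Cinfty R Fq) (j n k : nat) (m : int)
    (p_prime : prime p) (r_gt0 : (0 < r)%N) (card_Fq : #|Fq| = (p ^ r)%N)
    (j_le : (j <= #|Fq| - 2)%N) (n_ge1 : (1 <= n)%N)
    (k_def : k = (2 * j + 2 + (n - 1) * (#|Fq| - 1))%N)
    (m_mod : (m = (j + 1)%N%:Z %[mod (#|Fq| - 1)%N%:Z])%Z)
    (n_le4 : (n <= 4)%N) :
  let M := Mmx C j n in let D := Dmx C j n in let A := Amx C j n in
  let F := Fmx C j n in let T := Tmx C j n in
  let S := cusp_form (C := C) (@Gamma0 Fq) k m in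
  let Sold := oldform (C := C) k m in
  let Snew := newform (C := C) k m in
  (* 1 *)
  ((Ker (M *m A) :&: Ker (F + M *m D))%VS
     = (Ker (M *m A) :&: (mxlin F @: Ker (1%:M + M *m A)))%VS
   /\ (Ker (M *m A) :&: (mxlin F @: Ker (1%:M + M *m A)))%VS = 0%VS)
  (* 2 *)
  /\ ((odd #|Fq| -> diagonalizable (M *m D))
   /\ (~~ odd #|Fq| ->
       residue_isomorphism C k m -> ebar_isomorphism C k m ->
       (diagonalizable (M *m D) <-> exists2 d, has_dim Snew d & (d <= 1)%N)))
  (* 3 *)
  /\ ((directv (Ker (M *m A) + Ker (M *m D) + (Ker T :&: (mxlin F @: Ker T)))
   /\ (Ker (M *m A) + Ker (M *m D) + (Ker T :&: (mxlin F @: Ker T)))%VS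
        = fullv)
   /\ (residue_isomorphism C k m -> ebar_isomorphism C k m ->
       exists e : 'I_n -> C -> C,
         [/\ forall b : 'I_n, standard_form k m (j + b * (#|Fq| - 1)) (e b),
             is_basis S e,
             is_direct_sum S Sold Snew,
             identified e Sold (Ker (M *m A) + Ker (M *m D))
           & identified e Snew (Ker T :&: (mxlin F @: Ker T))])).
Proof.
move=> M D A F T S Sold Snew.
have t0 : - tC C != 0 by rewrite oppr_eq0 tC_neq0.
pose kappa := (- tC C) ^+ k.
have kappa0 : kappa != 0 by rewrite expf_neq0.
have FF : F *m F = kappa%:M by rewrite /F Fmx_sqr /kappa k_def.
have MAE : 1%:M + M *m A = T by [].
have MDE : M *m D = (T - 1%:M) *m F by exact: Mmx_Dmx.
have T_small : T = 0 \/ exists (a : 'cV[C]_n) (h : 'rV[C]_n) g,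
    [/\ T = - (a *m h), h *m a = (-1)%:M, h *m F *m a = g%:M, g != 0
      & g ^+ 2 != kappa].
  have [nj|jn] := leqP n j.+1.
    by left; apply: (Tmx_eq0 C p_prime card_Fq).
  have jn' : (j < n.-1)%N by rewrite -ltnS prednK.
  have [g [hFa g0 gk]] := Trow_Fmx_Tcol_small C p_prime card_Fq j_le n_le4 jn'.
  right; exists (Tcol C j n), (Trow C j n), g; split=> //.
  - exact: (Tmx_rank1 C p_prime card_Fq).
  - exact: Trow_Tcol.
  by rewrite /kappa k_def.
have [dir full] := old_new_direct MAE MDE FF kappa0 T_small.
split; first by rewrite -[1%:M + M *m A]/T; exact: old_vs_F_ker MAE MDE FF kappa0 T_small.
split.
  split=> [odd_q|even_q resiso ebariso].
    apply: (diagonalizable_odd n_ge1 MDE FF kappa0 T_small).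
    apply: contraTneq odd_q => /eqP; rewrite -(dvdn_pcharf (pcharC C p_prime card_Fq)).
    by rewrite dvdn_prime2 // => /eqP p2; rewrite card_Fq oddX p2 orbF -lt0n r_gt0.
  have two0 : 2 = 0 :> C.
    move: even_q; rewrite card_Fq oddX negb_or => /andP[_ /(prime_oddPn p_prime) p2].
    by apply: pcharf0; rewrite -p2; apply: pcharC p_prime card_Fq.
  have [e [_ [_ e_free] _ newW]] :=
    cusp_form_basis p_prime card_Fq j_le n_ge1 k_def m_mod resiso ebariso.
  split=> [dMD|[d Ud d1]].
    exists (\dim (Ker T :&: (mxlin F @: Ker T))); first exact: identified_has_dim newW.
    apply: (diagonalizable_even_dim_le n_ge1 MDE FF kappa0 T_small two0 n_le4 _ dMD).
    move=> a b; rewrite mxE; case: (a == rev_ord b); last by rewrite eqxx.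
    by rewrite expf_eq0 (negPf t0) andbF.
  apply: (diagonalizable_even_dim n_ge1 MDE FF kappa0 T_small two0).
  exact: leq_trans (has_dim_identified e_free newW Ud) d1.
split=> // resiso ebariso.
have [e [std [S_lin e_free] oldW newW]] :=
  cusp_form_basis p_prime card_Fq j_le n_ge1 k_def m_mod resiso ebariso.
exists e; split=> //.
apply: (identified_direct_sum e_free S_lin oldW newW _ full).
by move: dir; rewrite directv_addE => /and3P[_ _ /eqP].
Qed.
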